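(* Let $d\ge 2$ be a fixed integer. For $n\ge 1$ let $x_1,\dots,x_n$ be independent random points in $\mathbb{R}^d$, each distributed according to the standard normal distribution, and let $K_n=\mathrm{Conv}(x_1,\dots,x_n)$. There is a function $\epsilon(n)$ tending to $0$ as $n\to\infty$ such that for every real $t$, $$\left|\mathbb{P}\left(\frac{\mathrm{Vol}(K_n)-\mathbb{E}\,\mathrm{Vol}(K_n)}{\sqrt{\mathrm{Var}\,\mathrm{Vol}(K_n)}}\le t\right)-\Phi(t)\right|\le \epsilon(n).$$
   Context: $\Phi$ denotes the distribution function of the standard one-dimensional normal distribution. $\mathrm{Vol}$ is $d$-dimensional Lebesgue measure. $K_n$ is called the Gaussian polytope. *)

(* Defs.v *)
From HB Require Import structures.
From mathcomp Require Import all_boot all_order all_algebra.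
From mathcomp Require Import all_classical all_reals all_analysis.
Set Implicit Arguments. Unset Strict Implicit. Unset Printing Implicit Defensive.
Import Order.TTheory GRing.Theory Num.Theory.
Local Open Scope classical_set_scope.
Local Open Scope ring_scope.

Definition ord_cons (T : Type) (k : nat) (x : T) (y : 'I_k -> T) : 'I_k.+1 -> T :=
  fun i => if unlift ord0 i is Some j then y j else x.

(* Iterated (product) integration over T^k of a nonnegative extended-real
   function, given a one-coordinate integration operator [I].
   With [I] the Lebesgue integral (resp. the integral against the standard
   normal law) on R this is the k-fold product Lebesgue measure / product
   Gaussian measure (Fubini-Tonelli iterated form). *)
Fixpoint iprod (R : realType) (T : Type) (t0 : T)
    (I : (T -> \bar R) -> \bar R) (k : nat) : (('I_k -> T) -> \bar R) -> \bar R :=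
  match k with
  | 0 => fun f => f (fun _ => t0)
  | k'.+1 => fun f => I (fun x => iprod t0 I (fun y => f (ord_cons x y)))
  end.
Arguments iprod {R T} t0 I k _.

Definition lebesgue_d (R : realType) (d : nat) (A : set ('I_d -> R)) : \bar R :=
  iprod (0 : R) (fun f => (\int[@lebesgue_measure R]_x f x)%E) d
    (fun y => (\1_A y)%:E).

Definition Vol (R : realType) (d : nat) (A : set ('I_d -> R)) : R :=
  fine (lebesgue_d A).

Definition gauss_int (R : realType) (d : nat) (f : ('I_d -> R) -> \bar R) : \bar R :=
  iprod (0 : R) (fun g => (\int[@normal_prob R 0 1]_x g x)%E) d f.

Definition gauss_sample_int (R : realType) (d n : nat)
    (f : ('I_n -> 'I_d -> R) -> \bar R) : \bar R :=
  iprod (fun _ : 'I_d => (0 : R)) (@gauss_int R d) n f.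

Definition Esample (R : realType) (d n : nat) (X : ('I_n -> 'I_d -> R) -> R) : R :=
  fine (gauss_sample_int (fun x => (X x)%:E)).

Definition Varsample (R : realType) (d n : nat) (X : ('I_n -> 'I_d -> R) -> R) : R :=
  fine (gauss_sample_int (fun x => ((X x - Esample X) ^+ 2)%:E)).

Definition Psample (R : realType) (d n : nat) (E : set ('I_n -> 'I_d -> R)) : R :=
  fine (gauss_sample_int (fun x => (\1_E x)%:E)).

Definition conv_hull (R : realType) (d n : nat) (x : 'I_n -> 'I_d -> R)
    : set ('I_d -> R) :=
  [set y | exists lam : 'I_n -> R, (forall i, 0 <= lam i) /\
     \sum_(i < n) lam i = 1 /\ (forall j, y j = \sum_(i < n) lam i * x i j)].

Definition volK (R : realType) (d n : nat) (x : 'I_n -> 'I_d -> R) : R :=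
  Vol (conv_hull x).

Definition Phi (R : realType) (t : R) : R :=
  fine (@normal_prob R 0 1 [set u | u <= t]).

(* Main.v *)
Require Import Defs.
From HB Require Import structures.
From mathcomp Require Import all_boot all_order all_algebra.
From mathcomp Require Import all_classical all_reals all_analysis.
From mathcomp Require Import measurable_realfun zify ring lra.
Import Order.TTheory GRing.Theory Num.Theory.
Import numFieldNormedType.Exports.
Set Implicit Arguments. Unset Strict Implicit. Unset Printing Implicit Defensive.
Local Open Scope classical_set_scope.
Local Open Scope ring_scope.

(** Fix radii r < R0 with R0^2 - r^2 of order (ln n)^(1/2p) around the typical
    radius sqrt(2 ln n). With overwhelming probability the polytope equals the
    convex body generated by the ball of radius r and the sample points lying in
    the ball of radius R0. The volume of the latter is a local functional of the
    sample: deleting x_j changes it only if x_j lies in the shell r < |x_j| <= R0,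
    by a small amount, and two deletions interact only if both points lie in the
    shell and close to each other. For such functionals Stein's method along the
    martingale differences of the sample bounds the distance to the normal law
    by (expected number of shell points) * (influence)^3 / (standard deviation)^3
    and a similar term. The variance is bounded below by the contribution of the
    points with |x_j| about sqrt(2 ln n): such a point typically sees an empty
    cap and then adds a cone of volume at least a power of ln n. The number of
    shell points is of order at least (ln n)^((d-1)/2), while the suitably scaled
    remaining factors are powers of (ln n)^(1/2p) with exponents independent of p;
    so the error tends to 0 once p is large. The L^2 distance between the two
    volumes is negligible, which transfers the limit law. *)

(** * Bounded measurable functions and expectations *)

(** Deleting a point means moving it to the origin, which the ball of radius r absorbs; so [n] stays
    fixed and the sample space stays a product. The ball is also what makes influences bounded:
    without it the effect of one point on the hull has no deterministic bound, while the Stein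
    estimate below uses sup bounds on first and second differences. The error terms are compared as
    powers of y, where n = exp(y^(2p)) and Y = y^p is the order of r. One point has influence at
    most of order y^d / Y, and an outer point gains at least of order y^(1-d) / Y. The factors 1/Y
    cancel between numerator and denominator of each error term, and what remains of Y is the number
    Y^(d-1) of shell points (up to powers of y), with the larger power in the denominator. Since d
    >= 2 this leaves y^(p(d-1)) >= y^p to beat the other powers of y. The binding comparison is
    p(d-1) > 15 d + 1, hence p = 15 d + 3. Lebesgue volume is treated as a weighted Gaussian
    expectation, so that all integrals are taken against product probabilities and nearly all
    integrands are bounded. *)

Section bounded_measurable.
Context (R : realType) (d : measure_display) (T : measurableType d).
Implicit Types f g : T -> R.

(** The bound refers to no measure, so one hypothesis gives integrability for every probability, and
    it passes to slices and partial integrals. *)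
Definition bm f := measurable_fun setT f /\ exists M, forall x, `|f x| <= M.

Lemma bm_cst c : bm (fun=> c).
Proof. by split; [exact: measurable_cst|exists `|c|]. Qed.

Lemma bm_bound f : bm f -> exists2 M, 0 <= M & forall x, `|f x| <= M.
Proof.
move=> [_ [M fM]]; exists `|M| => // x; exact: le_trans (fM x) (ler_norm _).
Qed.

Lemma bmD f g : bm f -> bm g -> bm (fun x => f x + g x).
Proof.
move=> [mf [M fM]] [mg [N gN]]; split; first exact: measurable_funD.
by exists (M + N) => x; rewrite (le_trans (ler_normD _ _))// lerD.
Qed.

Lemma bmM f g : bm f -> bm g -> bm (fun x => f x * g x).
Proof.
move=> bf bg; split; first exact: measurable_funM bf.1 bg.1.
have [M M0 fM] := bm_bound bf; have [N N0 gN] := bm_bound bg.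
by exists (M * N) => x; rewrite normrM ler_pM.
Qed.

Lemma bmZ c f : bm f -> bm (fun x => c * f x).
Proof. exact: bmM (bm_cst c). Qed.

Lemma bmN f : bm f -> bm (fun x => - f x).
Proof.
by move=> [mf [M fM]]; split; [exact: measurable_funN|exists M => x; rewrite normrN].
Qed.

Lemma bmB f g : bm f -> bm g -> bm (fun x => f x - g x).
Proof. by move=> bf bg; apply: bmD => //; exact: bmN. Qed.

Lemma bm_norm f : bm f -> bm (fun x => `|f x|).
Proof.
move=> [mf [M fM]]; split; first exact: measurableT_comp.
by exists M => x; rewrite normr_id.
Qed.

Lemma bmX f k : bm f -> bm (fun x => f x ^+ k).
Proof.
move=> bf; elim: k => [|k IH]; first exact: bm_cst.
by under eq_fun do rewrite exprS; exact: bmM.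
Qed.

Lemma bm_sum (I : Type) (r : seq I) (p : pred I) (F : I -> T -> R) :
  (forall i, bm (F i)) -> bm (fun x => \sum_(i <- r | p i) F i x).
Proof.
move=> bF; elim: r => [|i r IH].
  by under eq_fun do rewrite big_nil; exact: bm_cst.
under eq_fun do rewrite big_cons; case: (p i) => //; exact: bmD.
Qed.

Lemma bm_indic (A : set T) : measurable A -> bm (\1_A : T -> R).
Proof.
move=> mA; split; first exact: measurable_indic.
by exists 1 => x; rewrite indicE; case: (_ \in _); rewrite ?normr1 ?normr0.
Qed.

Variable mu : probability T R.

Lemma bm_integrable f : bm f -> mu.-integrable setT (EFin \o f).
Proof.
move=> bf; apply: measurable_bounded_integrable => //.
- by rewrite [X in (X < _)%E]probability_setT ltry.
- exact: bf.1.
have [M M0 fM] := bm_bound bf.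
exists M; split; first exact: num_real.
by move=> N MN x _; rewrite /= (le_trans (fM x))// ltW.
Qed.

Definition Ex f : R := Rintegral mu setT f.

Lemma Ex_EFin f : bm f -> (Ex f)%:E = (\int[mu]_x (f x)%:E)%E.
Proof.
move=> bf; rewrite /Ex /Rintegral fineK//.
by apply: integrable_fin_num => //; exact: bm_integrable.
Qed.

Lemma ExD f g : bm f -> bm g -> Ex (fun x => f x + g x) = Ex f + Ex g.
Proof. by move=> bf bg; rewrite /Ex RintegralD//; exact: bm_integrable. Qed.

Lemma ExB f g : bm f -> bm g -> Ex (fun x => f x - g x) = Ex f - Ex g.
Proof. by move=> bf bg; rewrite /Ex RintegralB//; exact: bm_integrable. Qed.

Lemma ExZ c f : bm f -> Ex (fun x => c * f x) = c * Ex f.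
Proof. by move=> bf; rewrite /Ex RintegralZl//; exact: bm_integrable. Qed.

Lemma ExN f : bm f -> Ex (fun x => - f x) = - Ex f.
Proof.
by move=> bf; under eq_fun do rewrite -mulN1r; rewrite ExZ// mulN1r.
Qed.

Lemma Ex_cst c : Ex (fun=> c) = c.
Proof. by rewrite /Ex Rintegral_cst// [X in fine X]probability_setT mulr1. Qed.

Lemma Ex_le f g : bm f -> bm g -> (forall x, f x <= g x) -> Ex f <= Ex g.
Proof.
by move=> bf bg fg; apply: le_Rintegral => //; exact: bm_integrable.
Qed.

Lemma Ex_ge0 f : (forall x, 0 <= f x) -> 0 <= Ex f.
Proof. by move=> f0; exact: Rintegral_ge0. Qed.

Lemma Ex_norm f : bm f -> `|Ex f| <= Ex (fun x => `|f x|).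
Proof. by move=> bf; apply: le_normr_Rintegral => //; exact: bm_integrable. Qed.

Lemma Ex_sum (I : Type) (r : seq I) (p : pred I) (F : I -> T -> R) :
  (forall i, bm (F i)) ->
  Ex (fun x => \sum_(i <- r | p i) F i x) = \sum_(i <- r | p i) Ex (F i).
Proof.
move=> bF; elim: r => [|i r IH].
  by under eq_fun do rewrite big_nil; rewrite Ex_cst big_nil.
under eq_fun do rewrite big_cons; rewrite big_cons; case: (p i) => //.
by rewrite ExD//; [rewrite IH|exact: bm_sum].
Qed.

Lemma Ex_indic A : measurable A -> Ex (\1_A) = fine (mu A).
Proof.
by move=> mA; rewrite /Ex /Rintegral integral_indic// setIT.
Qed.

Lemma Ex_CS f g : bm f -> bm g ->
  Ex (fun x => f x * g x) ^+ 2 <= Ex (fun x => f x ^+ 2) * Ex (fun x => g x ^+ 2).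
Proof.
move=> bf bg.
set a := Ex (fun x => f x ^+ 2); set b := Ex (fun x => f x * g x).
set c := Ex (fun x => g x ^+ 2).
(* This form is the expectation of (s f + t g)^2; two test points give its discriminant
   inequality. *)
have q (s t : R) : 0 <= s ^+ 2 * a + s * t * 2 * b + t ^+ 2 * c.
  have [[b1 b2] b3] := (bmX 2 bf, bmM bf bg, bmX 2 bg).
  rewrite /a /b /c -(ExZ _ b1) -(ExZ _ b2) -(ExZ _ b3).
  rewrite -ExD; [|exact: bmZ|exact: bmZ].
  rewrite -ExD; [|by apply: bmD; exact: bmZ|exact: bmZ].
  apply: Ex_ge0 => x; have -> : s ^+ 2 * f x ^+ 2 + s * t * 2 * (f x * g x) +
    t ^+ 2 * g x ^+ 2 = (s * f x + t * g x) ^+ 2 by ring.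
  exact: sqr_ge0.
have a0 : 0 <= a by apply: Ex_ge0 => x; exact: sqr_ge0.
have c0 : 0 <= c by apply: Ex_ge0 => x; exact: sqr_ge0.
have [c00|c00] := eqVneq c 0.
  rewrite c00 mulr0; have [->|b0] := eqVneq b 0; first by rewrite expr0n.
  (* At this point the form equals - b^2 (a + 2), a contradiction; for c > 0 the point (c, - b)
     gives c (a c - b^2). *)
  have := q b (- (a + 1)); rewrite c00 => h.
  have b2 : 0 < b ^+ 2 by rewrite exprn_even_gt0.
  exfalso; nra.
have c1 : 0 < c by rewrite lt_neqAle eq_sym c00.
have := q c (- b) => h.
have : 0 <= c * (a * c - b ^+ 2) by nra.
by rewrite pmulr_rge0// subr_ge0.
Qed.

Lemma Ex_sqr f : bm f -> Ex f ^+ 2 <= Ex (fun x => f x ^+ 2).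
Proof.
move=> bf; have := Ex_CS bf (bm_cst 1).
by under eq_fun do rewrite mulr1; rewrite expr1n Ex_cst mulr1.
Qed.

End bounded_measurable.

Lemma bm_comp (R : realType) d1 d2 (T1 : measurableType d1) (T2 : measurableType d2)
    (f : T2 -> R) (g : T1 -> T2) :
  bm f -> measurable_fun setT g -> bm (fun x => f (g x)).
Proof.
by move=> [mf [M fM]] mg; split; [exact: measurableT_comp|exists M].
Qed.

Section bm_fubini.
Context (R : realType) d1 d2 (T1 : measurableType d1) (T2 : measurableType d2).
Variables (m1 : probability T1 R) (m2 : probability T2 R) (f : T1 * T2 -> R).
Hypothesis bf : bm f.

Lemma bm_slicel x : bm (fun y => f (x, y)).
Proof. by apply: (bm_comp bf); exact: pair1_measurable. Qed.

Lemma bm_slicer y : bm (fun x => f (x, y)).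
Proof. by apply: (bm_comp bf); exact: pair2_measurable. Qed.

Lemma bm_Exr : bm (fun x => Ex m2 (fun y => f (x, y))).
Proof.
split.
  apply/measurable_EFinP; rewrite (_ : _ \o _ = fubini_F m2 (EFin \o f)).
    apply: (@measurable_fubini_F _ _ _ _ _ m1 m2).
    exact: (bm_integrable (m1 \x m2)%E).
  by apply/funext => x; rewrite /= Ex_EFin//; exact: bm_slicel.
have [M M0 fM] := bm_bound bf; exists M => x.
have bx := bm_slicel x.
rewrite (le_trans (Ex_norm m2 bx))// -[leRHS](Ex_cst m2) Ex_le//.
- exact: bm_norm.
- exact: bm_cst.
Qed.

End bm_fubini.

Section bm_fubini2.
Context (R : realType) d1 d2 (T1 : measurableType d1) (T2 : measurableType d2).
Variables (m1 : probability T1 R) (m2 : probability T2 R) (f : T1 * T2 -> R).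
Hypothesis bf : bm f.

Lemma bm_Exl : bm (fun y => Ex m1 (fun x => f (x, y))).
Proof.
apply: (@bm_Exr _ _ _ _ _ m2 m1 (fun yx => f (yx.2, yx.1))).
by apply: (bm_comp bf); exact: measurable_fun_pair.
Qed.

Lemma Ex_fubini : Ex m1 (fun x => Ex m2 (fun y => f (x, y))) =
                  Ex m2 (fun y => Ex m1 (fun x => f (x, y))).
Proof.
apply: EFin_inj; rewrite !Ex_EFin//; last 2 first.
- exact: bm_Exl.
- exact: (bm_Exr m1).
transitivity (\int[m1]_x \int[m2]_y (EFin \o f) (x, y))%E.
  by apply: eq_integral => x _; rewrite Ex_EFin//; exact: bm_slicel.
rewrite Fubini; last exact: bm_integrable.
by apply: eq_integral => x _; rewrite Ex_EFin//; exact: bm_slicer.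
Qed.

End bm_fubini2.

(** * Product probability on tuples *)

Section tuple_update.
Context (R : realType) (d : measure_display) (T : measurableType d).

Definition tcons n (p : T * n.-tuple T) : n.+1.-tuple T := [tuple of p.1 :: p.2].

Lemma measurable_tcons n : measurable_fun setT (@tcons n).
Proof. exact: (measurable_cons measurable_fst measurable_snd). Qed.

HB.instance Definition _ n :=
  isMeasurableFun.Build _ _ _ _ (@tcons n) (@measurable_tcons n).

Definition upd n (x : n.-tuple T) (j : 'I_n) (y : T) : n.-tuple T :=
  [tuple if i == j then y else tnth x i | i < n].

Lemma tnth_upd n (x : n.-tuple T) j y i :
  tnth (upd x j y) i = if i == j then y else tnth x i.
Proof. by rewrite tnth_mktuple. Qed.

Lemma tnth_upd_eq n (x : n.-tuple T) j y : tnth (upd x j y) j = y.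
Proof. by rewrite tnth_upd eqxx. Qed.

Lemma tnth_upd_neq n (x : n.-tuple T) j y i :
  i != j -> tnth (upd x j y) i = tnth x i.
Proof. by rewrite tnth_upd => /negbTE ->. Qed.

Lemma upd_upd n (x : n.-tuple T) j y z : upd (upd x j y) j z = upd x j z.
Proof. by apply: eq_from_tnth => i; rewrite !tnth_upd; case: eqP. Qed.

Lemma updC n (x : n.-tuple T) j k y z :
  j != k -> upd (upd x j y) k z = upd (upd x k z) j y.
Proof.
move=> jk; apply: eq_from_tnth => i; rewrite !tnth_upd.
by have [->|//] := eqVneq i k; rewrite eq_sym (negbTE jk).
Qed.

Lemma measurable_upd2 n (j : 'I_n) :
  measurable_fun setT (fun p : n.-tuple T * T => upd p.1 j p.2).
Proof.
apply/measurable_fun_tnthP => i /=.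
have [ij|ij] := eqVneq i j.
  rewrite (_ : _ \o _ = snd)//.
  by apply/funext => p /=; rewrite ij tnth_upd_eq.
rewrite (_ : _ \o _ = (fun x => tnth x i) \o fst).
  exact: (measurableT_comp (measurable_tnth i) measurable_fst).
by apply/funext => p /=; rewrite tnth_upd_neq.
Qed.

Lemma measurable_upd n (j : 'I_n) y : measurable_fun setT (fun x => upd x j y).
Proof.
exact: (measurableT_comp (measurable_upd2 j) (pair2_measurable y)).
Qed.

Lemma measurable_updr n (x : n.-tuple T) (j : 'I_n) :
  measurable_fun setT (upd x j).
Proof.
exact: (measurableT_comp (measurable_upd2 j) (pair1_measurable x)).
Qed.

Lemma tnth_tcons0 n (p : T * n.-tuple T) : tnth (tcons p) ord0 = p.1.
Proof. by rewrite (tnth_nth p.1). Qed.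

Lemma tnth_tconsS n (p : T * n.-tuple T) (j : 'I_n) :
  tnth (tcons p) (lift ord0 j) = tnth p.2 j.
Proof. by rewrite !(tnth_nth p.1) /= . Qed.

Lemma upd_tcons0 n (p : T * n.-tuple T) y : upd (tcons p) ord0 y = tcons (y, p.2).
Proof.
apply: eq_from_tnth => i; rewrite tnth_upd.
by case: (unliftP ord0 i) => [k|] ->; rewrite ?tnth_tcons0 ?tnth_tconsS.
Qed.

Lemma upd_tconsS n (p : T * n.-tuple T) (j : 'I_n) y :
  upd (tcons p) (lift ord0 j) y = tcons (p.1, upd p.2 j y).
Proof.
apply: eq_from_tnth => i; rewrite tnth_upd.
case: (unliftP ord0 i) => [k|] ->; rewrite ?tnth_tcons0 ?tnth_tconsS//.
by rewrite tnth_upd (inj_eq lift_inj).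
Qed.

End tuple_update.

Section tuple_probability.
Context (R : realType) (d : measure_display) (T : measurableType d).
Variable P : probability T R.

(** The n-fold product of [P], with the same recursion as [iprod], so that the two are matched
    coordinate by coordinate. *)
Fixpoint tprob n : probability (n.-tuple T) R :=
  match n with
  | 0 => \d_([tuple])
  | n.+1 => distribution (P \x tprob n)%E (@tcons d T n)
  end.

Local Open Scope ereal_scope.

Lemma integral_tprob0 (f : 0.-tuple T -> \bar R) :
  measurable_fun setT f -> \int[tprob 0]_x f x = f [tuple].
Proof. by move=> mf; rewrite integral_dirac// diracT mul1e. Qed.

Lemma integral_tprobS n (f : n.+1.-tuple T -> \bar R) :
  measurable_fun setT f -> (forall x, 0 <= f x) ->
  \int[tprob n.+1]_x f x = \int[P]_x \int[tprob n]_y f (tcons (x, y)).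
Proof.
move=> mf f0; rewrite ge0_integral_distribution//.
rewrite fubini_tonelli1//=.
by apply: measurableT_comp => //; exact: measurable_tcons.
Qed.

Lemma integral_cst_prob d' (T' : measurableType d') (Q : probability T' R) c :
  \int[Q]_x c = c.
Proof. by rewrite integral_cst// [X in _ * X]probability_setT mule1. Qed.

#[local] Opaque tprob.

Lemma measurable_integral_upd n (j : 'I_n) (f : n.-tuple T -> \bar R) :
  measurable_fun setT f -> (forall x, 0 <= f x) ->
  measurable_fun setT (fun x => \int[P]_y f (upd x j y)).
Proof.
move=> mf f0.
apply: (@measurable_fun_fubini_tonelli_F _ _ _ _ _ P
  (fun p : n.-tuple T * T => f (upd p.1 j p.2))) => //.
exact: (measurableT_comp mf (measurable_upd2 j)).
Qed.

(** Induction on n: at the head coordinate this is Tonelli, behind it the induction hypothesis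
    applies inside the first integral. In this form independence enters the martingale arguments. *)
Lemma tprob_resample n (j : 'I_n) (f : n.-tuple T -> \bar R) :
  measurable_fun setT f -> (forall x, 0 <= f x) ->
  \int[tprob n]_x f x = \int[tprob n]_x \int[P]_y f (upd x j y).
Proof.
elim: n j f => [[]//|n IH j f mf f0].
rewrite (integral_tprobS mf f0) integral_tprobS; last 2 first.
- exact: measurable_integral_upd.
- by move=> x; exact: integral_ge0.
have mfc x : measurable_fun setT (fun y => f (tcons (x, y))).
  apply: measurableT_comp => //; apply: measurableT_comp.
    exact: measurable_tcons.
  exact: pair1_measurable.
case: (unliftP ord0 j) => [k|] ->.
  apply: eq_integral => x _; rewrite (IH k _ (mfc x)); last by move=> y; exact: f0.
  apply: eq_integral => y _; apply: eq_integral => z _.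
  by rewrite upd_tconsS.
under [RHS]eq_integral do under eq_integral do
  under eq_integral do rewrite upd_tcons0 /=.
rewrite [RHS]integral_cst_prob.
apply: (@fubini_tonelli _ _ _ _ _ P (tprob n) (f \o @tcons d T n)).
- exact: (measurableT_comp mf (@measurable_tcons _ _ _)).
- by move=> x; exact: f0.
Qed.

Lemma tprob_prod n (phi : 'I_n -> T -> R) (c : 'I_n -> R) :
  (forall i, measurable_fun setT (phi i)) -> (forall i x, (0 <= phi i x)%R) ->
  (forall i, \int[P]_x (phi i x)%:E = (c i)%:E) ->
  \int[tprob n]_x (\prod_(i < n) phi i (tnth x i))%:E = (\prod_(i < n) c i)%:E.
Proof.
elim: n phi c => [|n IH] phi c mphi phi0 ci.
  rewrite integral_tprob0 ?big_ord0//.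
  apply/measurable_EFinP; under eq_fun do rewrite big_ord0.
  exact: measurable_cst.
rewrite integral_tprobS; last 2 first.
- apply/measurable_EFinP; apply: measurable_prod => i _.
  by apply: (measurableT_comp (mphi i)); exact: measurable_tnth.
- by move=> x; rewrite lee_fin prodr_ge0.
rewrite big_ord_recl.
transitivity (\int[P]_x ((phi ord0 x)%:E *
  (\prod_(i < n) c (lift ord0 i))%:E)).
  apply: eq_integral => x _.
  rewrite -(IH (fun i => phi (lift ord0 i)))//.
  rewrite -ge0_integralZl//; last 3 first.
  - apply/measurable_EFinP; apply: measurable_prod => i _.
    by apply: (measurableT_comp (mphi _)); exact: measurable_tnth.
  - by move=> y _; rewrite lee_fin prodr_ge0.
  - by rewrite lee_fin.
  apply: eq_integral => y _; rewrite big_ord_recl EFinM tnth_tcons0.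
  by under eq_bigr do rewrite tnth_tconsS.
rewrite ge0_integralZr//; last 3 first.
- exact/measurable_EFinP.
- by move=> x _; rewrite lee_fin.
- by rewrite lee_fin prodr_ge0// => i _; rewrite -lee_fin -ci; apply: integral_ge0 => x _; rewrite lee_fin.
by rewrite ci EFinM.
Qed.

Lemma integral_tnth n (j : 'I_n) (g : T -> \bar R) :
  measurable_fun setT g -> (forall x, 0 <= g x) ->
  \int[tprob n]_x g (tnth x j) = \int[P]_y g y.
Proof.
move=> mg g0; rewrite (tprob_resample j)//; last first.
  by apply: measurableT_comp => //; exact: measurable_tnth.
under eq_integral do under eq_integral do rewrite tnth_upd_eq.
by rewrite integral_cst_prob.
Qed.

End tuple_probability.

Section bm_tuple.
Context (R : realType) (d : measure_display) (T : measurableType d).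
Variables (P : probability T R) (n : nat).
Local Notation mu := (tprob P n).
Implicit Types F : n.-tuple T -> R.

Lemma bm_upd2 F j : bm F -> bm (fun p : n.-tuple T * T => F (upd p.1 j p.2)).
Proof. by move=> bF; apply: (bm_comp bF); exact: measurable_upd2. Qed.

Lemma bm_upd F j y : bm F -> bm (fun x => F (upd x j y)).
Proof. by move=> bF; apply: (bm_comp bF); exact: measurable_upd. Qed.

Lemma bm_updr F x j : bm F -> bm (fun y => F (upd x j y)).
Proof. by move=> bF; apply: (bm_comp bF); exact: measurable_updr. Qed.

Lemma bm_tnth (g : T -> R) (j : 'I_n) : bm g -> bm (fun x => g (tnth x j)).
Proof. by move=> bg; apply: (bm_comp bg); exact: measurable_tnth. Qed.

Lemma bm_Ex_upd F j : bm F -> bm (fun x => Ex P (fun y => F (upd x j y))).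
Proof. by move=> bF; exact: (bm_Exr mu P (bm_upd2 j bF)). Qed.

Lemma Ex_resample F j : bm F ->
  Ex mu F = Ex mu (fun x => Ex P (fun y => F (upd x j y))).
Proof.
move=> bF; have [M M0 FM] := bm_bound bF.
(* Adding the bound [M] reduces to the nonnegative case [tprob_resample]; [M] cancels afterwards. *)
have bFM : bm (fun x => F x + M) by apply: bmD => //; exact: bm_cst.
have FM0 x : 0 <= F x + M by have := FM x; rewrite ler_norml => /andP[]; lra.
suff : Ex mu (fun x => F x + M) =
       Ex mu (fun x => Ex P (fun y => F (upd x j y) + M)).
  rewrite ExD; [|exact: bF|exact: bm_cst].
  under [in X in _ = X -> _]eq_fun => x.
    rewrite ExD; [|exact: bm_updr|exact: bm_cst].
    rewrite Ex_cst; over.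
  rewrite ExD; [|exact: bm_Ex_upd|exact: bm_cst].
  by rewrite !Ex_cst => /addIr.
apply: EFin_inj; rewrite !Ex_EFin//; last exact: (bm_Ex_upd j bFM).
rewrite (tprob_resample P j); last 2 first.
- by apply/measurable_EFinP; exact: bFM.1.
- by move=> x; rewrite lee_fin.
apply: eq_integral => x _; rewrite Ex_EFin//.
exact: (bm_updr x j bFM).
Qed.

Lemma Ex_tnth (g : T -> R) (j : 'I_n) : bm g ->
  Ex mu (fun x => g (tnth x j)) = Ex P g.
Proof.
move=> bg; rewrite (Ex_resample j); last exact: bm_tnth.
by under eq_fun do under eq_fun do rewrite tnth_upd_eq; rewrite Ex_cst.
Qed.

End bm_tuple.

Section iprod_tuple.
Context (R : realType) (d : measure_display) (T : measurableType d).
Variable P : probability T R.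
Local Open Scope ereal_scope.

Lemma iprod_ge0 (T0 : Type) (t0 : T0) (I : (T0 -> \bar R) -> \bar R) :
  (forall g, (forall x, 0 <= g x) -> 0 <= I g) ->
  forall k (f : ('I_k -> T0) -> \bar R), (forall x, 0 <= f x) ->
  0 <= iprod t0 I k f.
Proof.
move=> I0; elim=> [|k IH] f f0 /=; first exact: f0.
by apply: I0 => x; exact: IH.
Qed.

(** The iterated integrals of the theorem live on function spaces without a sigma-algebra. The map
    [phi] reads a point of [T] as such a function, and only the pulled back integrand has to be
    measurable. *)
Lemma iprodE (T0 : Type) (t0 : T0) (phi : T -> T0)
    (I : (T0 -> \bar R) -> \bar R) :
  (forall g, (forall x, 0 <= g x) -> 0 <= I g) ->
  (forall g, measurable_fun setT (g \o phi) -> (forall x, 0 <= g x) ->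
     I g = \int[P]_x g (phi x)) ->
  forall k (f : ('I_k -> T0) -> \bar R),
  measurable_fun setT (fun x : k.-tuple T => f (fun i => phi (tnth x i))) ->
  (forall x, 0 <= f x) ->
  iprod t0 I k f = \int[tprob P k]_x f (fun i => phi (tnth x i)).
Proof.
move=> I0 HI; elim=> [|k IH] f mf f0.
  rewrite integral_tprob0//=; congr f; apply/funext => -[]//.
have consE x y : (fun i => phi (tnth (tcons (x, y)) i)) =
    ord_cons (phi x) (fun i => phi (tnth y i)) :> ('I_k.+1 -> T0).
  apply/funext => i; rewrite /ord_cons; case: unliftP => [j|] ->.
  - by rewrite tnth_tconsS.
  - by rewrite tnth_tcons0.
rewrite integral_tprobS//=.
have mfc : measurable_fun setT (fun p : T * k.-tuple T =>
    f (ord_cons (phi p.1) (fun i => phi (tnth p.2 i)))).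
  under eq_fun => p do rewrite -consE.
  by apply: (measurableT_comp mf) => /=; under eq_fun do rewrite -surjective_pairing; exact: measurable_tcons.
have iE x : iprod t0 I k (fun y : 'I_k -> T0 => f (ord_cons (phi x) y)) =
    \int[tprob P k]_y f (ord_cons (phi x) (fun i => phi (tnth y i))).
  rewrite IH; first by [].
  - exact: (measurableT_comp mfc (pair1_measurable x)).
  - by move=> y; exact: f0.
rewrite HI.
- by apply: eq_integral => x _; rewrite iE; apply: eq_integral => y _; rewrite consE.
- rewrite (_ : _ \o _ = fubini_F (tprob P k) (fun p : T * k.-tuple T =>
    f (ord_cons (phi p.1) (fun i => phi (tnth p.2 i)))))//.
    exact: measurable_fun_fubini_tonelli_F.
  by apply/funext => x /=; rewrite iE.
- by move=> x; exact: iprod_ge0.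
Qed.

End iprod_tuple.

(** * Martingale differences and the Efron-Stein inequality *)

Section martingale_decomposition.
Context (R : realType) (d : measure_display) (T : measurableType d).
Variables (P : probability T R) (n : nat) (t0 : T).
Local Notation Om := (n.-tuple T).
Local Notation mu := (tprob P n).
Implicit Types (F G : Om -> R) (x : Om).

Definition mix (j : nat) (x' x : Om) : Om :=
  [tuple if (i < j)%N then tnth x' i else tnth x i | i < n].

Lemma tnth_mix j x' x i :
  tnth (mix j x' x) i = if (i < j)%N then tnth x' i else tnth x i.
Proof. by rewrite tnth_mktuple. Qed.

Lemma measurable_mix j : measurable_fun setT (fun p : Om * Om => mix j p.1 p.2).
Proof.
apply/measurable_fun_tnthP => i.
case: (boolP (i < j)%N) => ij.
  rewrite (_ : _ \o _ = (fun x : Om => tnth x i) \o fst).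
    exact: (measurableT_comp (measurable_tnth i) measurable_fst).
  by apply/funext => p /=; rewrite tnth_mix ij.
rewrite (_ : _ \o _ = (fun x : Om => tnth x i) \o snd).
  exact: (measurableT_comp (measurable_tnth i) measurable_snd).
by apply/funext => p /=; rewrite tnth_mix (negbTE ij).
Qed.

(** Conditional expectation of [F] given the coordinates of index at least [j]: a martingale run
    backwards, from [F] itself at 0 to the mean of [F] at [n]. *)
Definition part j F x := Ex mu (fun x' => F (mix j x' x)).

Lemma bm_mix2 j F : bm F -> bm (fun p : Om * Om => F (mix j p.2 p.1)).
Proof.
move=> bF; apply: (bm_comp bF).
exact: (measurableT_comp (measurable_mix j)
  (measurable_fun_pair measurable_snd measurable_fst)).
Qed.

Lemma bm_mixl j F x : bm F -> bm (fun x' => F (mix j x' x)).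
Proof. by move=> bF; exact: (bm_slicel (bm_mix2 j bF) x). Qed.

Lemma bm_part j F : bm F -> bm (part j F).
Proof. by move=> bF; exact: (bm_Exr mu mu (bm_mix2 j bF)). Qed.

Lemma part0 F x : part 0 F x = F x.
Proof.
rewrite /part (_ : (fun _ => _) = fun=> F x) ?Ex_cst//.
apply/funext => x'; congr F; apply: eq_from_tnth => i.
by rewrite tnth_mix.
Qed.

Lemma part_n F x : part n F x = Ex mu F.
Proof.
rewrite /part (_ : (fun _ => _) = F)//.
apply/funext => x'; congr F; apply: eq_from_tnth => i.
by rewrite tnth_mix ltn_ord.
Qed.

Lemma part_upd j F x (k : 'I_n) y : (k < j)%N -> part j F (upd x k y) = part j F x.
Proof.
move=> kj; rewrite /part; congr Ex; apply/funext => x'; congr F.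
apply: eq_from_tnth => i; rewrite !tnth_mix tnth_upd.
by case: ifPn => // ij; case: eqVneq => // ik; move: ij; rewrite ik kj.
Qed.

Lemma partS (j : 'I_n) F x : bm F ->
  part j.+1 F x = Ex P (fun y => part j F (upd x j y)).
Proof.
move=> bF; rewrite /part (Ex_resample P j); last exact: bm_mixl.
have bF2 : bm (fun p : Om * T => F (mix j p.1 (upd x j p.2))).
  have m : measurable_fun setT (fun p : Om * T => (upd x j p.2, p.1)).
    apply: measurable_fun_pair => //.
    exact: (measurableT_comp (measurable_updr x j) measurable_snd).
  exact: (bm_comp (bm_mix2 j bF) m).
rewrite -(Ex_fubini mu P bF2).
congr Ex; apply/funext => x'; congr Ex; apply/funext => y; congr F.
apply: eq_from_tnth => i; rewrite !tnth_mix !tnth_upd ltnS leq_eqVlt.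
by have [->|ij] := eqVneq i j; rewrite ?eqxx ?ltnn// (negbTE (_ : i != j :> nat)).
Qed.

Lemma Ex_part j F : (j <= n)%N -> bm F -> Ex mu (part j F) = Ex mu F.
Proof.
move=> + bF; elim: j => [_|j IH jn].
  by congr Ex; apply/funext => x; rewrite part0.
rewrite -(IH (ltnW jn)) [RHS](Ex_resample P (Ordinal jn)); last exact: bm_part.
by congr Ex; apply/funext => x; rewrite (partS (Ordinal jn)).
Qed.

Definition mdiff (j : 'I_n) F x := part j F x - part j.+1 F x.

Lemma bm_mdiff j F : bm F -> bm (mdiff j F).
Proof. by move=> bF; apply: bmB; exact: bm_part. Qed.

Lemma Ex_mdiff_upd (j : 'I_n) F x : bm F ->
  Ex P (fun y => mdiff j F (upd x j y)) = 0.
Proof.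
move=> bF; rewrite /mdiff ExB; last 2 first.
- by apply: bm_updr; exact: bm_part.
- by apply: bm_updr; exact: bm_part.
under [X in _ - Ex _ X]eq_fun do rewrite part_upd//.
by rewrite Ex_cst -partS// subrr.
Qed.

Definition indep (j : 'I_n) G := forall x y, G (upd x j y) = G x.

(** The increment already integrates to 0 over coordinate [j] alone, with all other coordinates
    frozen, and [G] is a constant for that integral. *)
Lemma Ex_indep_mdiff (j : 'I_n) F G : bm F -> bm G -> indep j G ->
  Ex mu (fun x => G x * mdiff j F x) = 0.
Proof.
move=> bF bG Gj; rewrite (Ex_resample P j); last first.
  by apply: bmM => //; exact: bm_mdiff.
rewrite (_ : (fun _ => _) = fun=> 0) ?Ex_cst//; apply/funext => x.
under eq_fun do rewrite Gj.
by rewrite ExZ ?Ex_mdiff_upd ?mulr0//; apply: bm_updr; exact: bm_mdiff.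
Qed.

Lemma sum_mdiff F x : \sum_(j < n) mdiff j F x = F x - Ex mu F.
Proof.
rewrite -(part0 F x) -(part_n F x).
transitivity (- \sum_(0 <= j < n) (part j.+1 F x - part j F x)).
  by rewrite big_mkord -sumrN; apply: eq_bigr => j _; rewrite opprB.
by rewrite telescope_sumr// opprB.
Qed.

Definition del (j : 'I_n) x := upd x j t0.
Definition dif (j : 'I_n) F x := F x - F (del j x).

Lemma bm_del j F : bm F -> bm (fun x => F (del j x)).
Proof. exact: bm_upd. Qed.

Lemma bm_dif j F : bm F -> bm (dif j F).
Proof. by move=> bF; apply: bmB => //; exact: bm_del. Qed.

Lemma indep_del j F : indep j (fun x => F (del j x)).
Proof. by move=> x y; rewrite /del upd_upd. Qed.

Lemma dif_del j F x : dif j F (del j x) = 0.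
Proof. by rewrite /dif /del upd_upd subrr. Qed.

(** The centred [F] is the sum of its increments, and against the increment at [j] one may subtract
    from [G] its value after deletion of [j], which ignores that coordinate. *)
Lemma Ex_mul_centered F G : bm F -> bm G ->
  Ex mu (fun x => G x * (F x - Ex mu F)) =
  \sum_(j < n) Ex mu (fun x => dif j G x * mdiff j F x).
Proof.
move=> bF bG; under eq_fun do rewrite -sum_mdiff mulr_sumr.
rewrite Ex_sum; last by move=> j; apply: bmM => //; exact: bm_mdiff.
apply: eq_bigr => j _.
have bd := bm_del j bG; have bm' := bm_mdiff j bF.
rewrite -[LHS]subr0 -[in LHS](Ex_indep_mdiff bF bd (indep_del j G)) -ExB.
- by congr Ex; apply/funext => x; rewrite /dif mulrBl.
- exact: bmM.
- exact: bmM.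
Qed.

(** After deletion of [j] it does not matter whether coordinate [j] was mixed in, so the deleted
    function has no increment at [j]. *)
Lemma mdiff_dif j F x : bm F -> mdiff j F x = mdiff j (dif j F) x.
Proof.
move=> bF; rewrite /mdiff /dif /part.
rewrite ExB; [|exact: bm_mixl|exact: (bm_mixl _ _ (bm_del j bF))].
rewrite ExB; [|exact: bm_mixl|exact: (bm_mixl _ _ (bm_del j bF))].
rewrite (_ : (fun x' => F (del j (mix j.+1 x' x))) =
             (fun x' => F (del j (mix j x' x)))); first by ring.
apply/funext => x'; congr F; apply: eq_from_tnth => i; rewrite !tnth_upd.
case: eqVneq => // ij; rewrite !tnth_mix ltnS leq_eqVlt.
by rewrite (negbTE (_ : i != j :> nat)).
Qed.

(** The increment is an orthogonal projection of [part j (dif j F)], and conditional expectation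
    does not increase the second moment. *)
Lemma Ex_mdiff_sqr j F : bm F ->
  Ex mu (fun x => mdiff j F x ^+ 2) <= Ex mu (fun x => dif j F x ^+ 2).
Proof.
move=> bF; have bD := bm_dif j bF; have bM := bm_mdiff j bF.
have bA := bm_part j bD; have bB := bm_part j.+1 bD.
have indB : indep j (part j.+1 (dif j F)) by move=> x y; rewrite part_upd.
have MA : Ex mu (fun x => mdiff j F x ^+ 2) =
    Ex mu (fun x => part j (dif j F) x * mdiff j F x).
  rewrite -[RHS]subr0 -[in RHS](Ex_indep_mdiff bF bB indB) -ExB.
  - by congr Ex; apply/funext => x; rewrite -mulrBl -[_ - _]mdiff_dif// expr2.
  - exact: bmM.
  - exact: bmM.
have h1 : Ex mu (fun x => mdiff j F x ^+ 2) <=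
    Ex mu (fun x => part j (dif j F) x ^+ 2).
  have : Ex mu (fun x => part j (dif j F) x * mdiff j F x) <=
     Ex mu (fun x => 2^-1 * part j (dif j F) x ^+ 2 + 2^-1 * mdiff j F x ^+ 2).
    apply: Ex_le; first exact: bmM.
    - by apply: bmD; apply: bmZ; exact: bmX.
    - by move=> x; have := sqr_ge0 (part j (dif j F) x - mdiff j F x); lra.
  rewrite -MA ExD; [|by apply: bmZ; exact: bmX|by apply: bmZ; exact: bmX].
  rewrite ExZ; last exact: bmX.
  rewrite ExZ; last exact: bmX.
  by lra.
apply: (le_trans h1).
rewrite -[leRHS](@Ex_part j); [|exact: ltnW|exact: bmX].
apply: Ex_le; [exact: bmX|by apply: bm_part; exact: bmX|].
by move=> x; apply: Ex_sqr; exact: bm_mixl.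
Qed.

Definition var F := Ex mu (fun x => (F x - Ex mu F) ^+ 2).

Lemma bm_center F : bm F -> bm (fun x => F x - Ex mu F).
Proof. by move=> bF; apply: bmB => //; exact: bm_cst. Qed.

Lemma varE F : bm F ->
  var F = \sum_(j < n) Ex mu (fun x => dif j F x * mdiff j F x).
Proof.
move=> bF; rewrite -Ex_mul_centered// /var.
have bc := bm_center bF.
have z : Ex mu (fun x => Ex mu F * (F x - Ex mu F)) = 0.
  rewrite ExZ// ExB//; last exact: bm_cst.
  by rewrite Ex_cst subrr mulr0.
rewrite -[RHS]subr0 -z -ExB; [|exact: bmM|exact: bmZ].
by congr Ex; apply/funext => x; ring.
Qed.

(** In each term of [varE] the inequality 2uv <= u^2 + v^2 separates the two factors, and
    [Ex_mdiff_sqr] turns both into deletion differences. *)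
Lemma efron_stein F : bm F ->
  var F <= \sum_(j < n) Ex mu (fun x => dif j F x ^+ 2).
Proof.
move=> bF; rewrite varE//; apply: ler_sum => j _.
have bD := bm_dif j bF; have bM := bm_mdiff j bF.
have : Ex mu (fun x => dif j F x * mdiff j F x) <=
   Ex mu (fun x => 2^-1 * dif j F x ^+ 2 + 2^-1 * mdiff j F x ^+ 2).
  apply: Ex_le; first exact: bmM.
  - by apply: bmD; apply: bmZ; exact: bmX.
  - by move=> x; have := sqr_ge0 (dif j F x - mdiff j F x); lra.
rewrite ExD; [|by apply: bmZ; exact: bmX|by apply: bmZ; exact: bmX].
rewrite ExZ; last exact: bmX.
rewrite ExZ; last exact: bmX.
have := Ex_mdiff_sqr j bF.
by lra.
Qed.

End martingale_decomposition.

(** * Stein bound and variance lower bound for local functionals *)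

Lemma sum_cst_ord (R : realType) n (c : R) : \sum_(j < n) c = n%:R * c.
Proof. by rewrite sumr_const card_ord mulr_natl. Qed.

Section local_functional.
Context (R : realType) (d : measure_display) (T : measurableType d).
Variables (P : probability T R) (n : nat) (t0 : T).
Local Notation Om := (n.-tuple T).
Local Notation mu := (tprob P n).
(** Intended reading: [s] indicates the shell, [b] indicates a pair of nearby shell points, [delta]
    bounds the influence of one point, and [pi] bounds the chance that a random point interacts with
    a given one. *)
Variables (F : Om -> R) (s : T -> R) (b : T * T -> R) (delta pi : R).
Local Notation q := (Ex P s).
Local Notation D := (dif t0).
Local Notation M := (mdiff P).
Hypothesis bF : bm F.
Hypothesis bs : bm s.
Hypothesis s01 : forall y, 0 <= s y <= 1.
Hypothesis bb : bm b.
Hypothesis b_ge0 : forall p, 0 <= b p.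
Hypothesis bsl : forall y z, b (y, z) <= s y.
Hypothesis bpi : forall z, Ex P (fun y => b (y, z)) <= pi * s z.
Hypothesis d0 : 0 <= delta.
Hypothesis pi0 : 0 <= pi.
Hypothesis locD : forall j x, `|D j F x| <= delta * s (tnth x j).
Hypothesis locDD : forall j k x, j != k ->
  `|D j F x - D j F (del t0 k x)| <= delta * b (tnth x j, tnth x k).

Let s0 y : 0 <= s y. Proof. by case/andP: (s01 y). Qed.
Let s1 y : s y <= 1. Proof. by case/andP: (s01 y). Qed.

Let q0 : 0 <= q. Proof. exact: Ex_ge0. Qed.
Let q1 : q <= 1.
Proof. by rewrite -[leRHS](Ex_cst P); apply: Ex_le => //; exact: bm_cst. Qed.

Let bmst j : bm (fun x : Om => s (tnth x j)). Proof. exact: bm_tnth. Qed.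

Lemma Ex_s j : Ex mu (fun x => s (tnth x j)) = q.
Proof. exact: Ex_tnth. Qed.

(** The increment is a difference of two averages of the deletion difference: in the first,
    coordinate [j] is the sample point itself, in the second it is a fresh copy, which costs only
    [q]. *)
Lemma mdiff_bound j x : `|M j F x| <= delta * (s (tnth x j) + q).
Proof.
rewrite (@mdiff_dif _ _ _ _ _ t0)// /mdiff mulrDr; apply: (le_trans (ler_normB _ _)); apply: lerD.
  have bD : bm (D j F) by exact: bm_dif.
  apply: (le_trans (Ex_norm _ (bm_mixl j x bD))).
  rewrite -[leRHS](Ex_cst mu); apply: Ex_le; [|exact: bm_cst|].
    by apply: bm_norm; exact: bm_mixl.
  by move=> x'; rewrite (le_trans (locD _ _))// tnth_mix ltnn.
have bD : bm (D j F) by exact: bm_dif.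
apply: (le_trans (Ex_norm _ (bm_mixl j.+1 x bD))).
rewrite -(Ex_s j) -ExZ//; apply: Ex_le; last 1 first.
- by move=> x'; rewrite (le_trans (locD _ _))// tnth_mix ltnSn.
- by apply: bm_norm; exact: bm_mixl.
- exact: bmZ.
Qed.

Lemma mdiff_bound2 j x : `|M j F x| <= 2 * delta.
Proof.
apply: (le_trans (mdiff_bound j x)); rewrite mulrC.
by rewrite ler_wpM2r//; have := s1 (tnth x j); have := q1; lra.
Qed.

Let mix_del_lt j (k : 'I_n) (x' x : Om) : (k < j)%N ->
  mix j x' (del t0 k x) = mix j x' x.
Proof.
move=> kj; apply: eq_from_tnth => i; rewrite !tnth_mix tnth_upd.
by case: ifPn => // ij; case: eqVneq => // ik; move: ij; rewrite ik kj.
Qed.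

Let mix_del_ge j (k : 'I_n) (x' x : Om) : (j <= k)%N ->
  mix j x' (del t0 k x) = del t0 k (mix j x' x).
Proof.
move=> jk; apply: eq_from_tnth => i; rewrite !(tnth_mix, tnth_upd).
by case: ifPn => // ij; case: eqVneq => // ik; move: ij; rewrite ik ltnNge jk.
Qed.

(** For k < j the deleted coordinate has been averaged out and nothing changes. For k > j the two
    averages contribute the interaction with the actual x_j and with a fresh copy of it. *)
Lemma mdiff_del j k x : j != k ->
  `|M j F x - M j F (del t0 k x)| <=
  delta * (b (tnth x j, tnth x k) + pi * s (tnth x k)).
Proof.
move=> jk; have bD : bm (D j F) by exact: bm_dif.
have b1 i : bm (fun x' => D j F (mix i x' x)) by exact: bm_mixl.
have b2 i : bm (fun x' => D j F (mix i x' (del t0 k x))) by exact: bm_mixl.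
have rhs0 : 0 <= delta * (b (tnth x j, tnth x k) + pi * s (tnth x k)).
  by rewrite mulr_ge0// addr_ge0// mulr_ge0.
rewrite (mdiff_dif P t0 j x bF) (mdiff_dif P t0 j (del t0 k x) bF) /mdiff /part.
have [kj|] := ltnP k j.
  under [in X in `|_ - (X - _)|]eq_fun do rewrite mix_del_lt//.
  under [in X in `|_ - (_ - X)|]eq_fun do rewrite mix_del_lt ?ltnS 1?ltnW//.
  by rewrite subrr normr0.
rewrite leq_eqVlt (negbTE (_ : j != k :> nat))//= => jk'.
have E4 (u v w z : R) : u - v - (w - z) = (u - w) + (z - v) by ring.
rewrite E4 -!ExB//.
apply: (le_trans (ler_normD _ _)); rewrite mulrDr; apply: lerD.
  apply: (le_trans (Ex_norm _ (bmB (b1 j) (b2 j)))).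
  rewrite -[leRHS](Ex_cst mu); apply: Ex_le; [|exact: bm_cst|].
    by apply: bm_norm; exact: bmB.
  move=> x'; rewrite mix_del_ge ?(ltnW jk')//.
  by apply: (le_trans (locDD _ jk)); rewrite !tnth_mix ltnn ltnNge (ltnW jk').
apply: (le_trans (Ex_norm _ (bmB (b2 j.+1) (b1 j.+1)))).
have bbj : bm (fun y => b (y, tnth x k)) by exact: (bm_slicer bb).
apply: (@le_trans _ _ (Ex mu (fun x' => delta * b (tnth x' j, tnth x k)))).
  apply: Ex_le.
  - by apply: bm_norm; exact: bmB.
  - by apply: bmZ; exact: (bm_tnth j bbj).
  - move=> x'; rewrite distrC mix_del_ge//.
    apply: (le_trans (locDD _ jk)); rewrite !tnth_mix ltnSn.
    by rewrite (ltnNge k) jk'.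
rewrite ExZ; last exact: (bm_tnth j bbj).
by rewrite (Ex_tnth P j bbj) ler_wpM2l.
Qed.

(** By [varE] its mean is the variance of [F]; its fluctuation is the first error term of Stein's
    method. *)
Definition stein_kernel x := \sum_(j < n) D j F x * M j F x.

Lemma bm_stein_kernel : bm stein_kernel.
Proof. by apply: bm_sum => j; apply: bmM; [exact: bm_dif|exact: bm_mdiff]. Qed.

Let A k x := \sum_(j < n | j != k) b (tnth x j, tnth x k).

Let bbt j k : bm (fun x : Om => b (tnth x j, tnth x k)).
Proof.
apply: (bm_comp bb); apply: measurable_fun_pair; exact: measurable_tnth.
Qed.

Let bA k : bm (A k). Proof. exact: bm_sum. Qed.

(** The product rule: the term j = k disappears after deletion, and every other term changes only
    through interactions. The 3 is 2 from [mdiff_bound2] plus 1 from [mdiff_del]; summing its [pi]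
    part over j gives n pi. *)
Lemma dif_stein_kernel k x :
  `|D k stein_kernel x| <=
  delta ^+ 2 * ((2 + n%:R * pi) * s (tnth x k) + 3 * A k x).
Proof.
have -> : D k stein_kernel x =
   \sum_(j < n) (D j F x * M j F x - D j F (del t0 k x) * M j F (del t0 k x)).
  by rewrite [in RHS]sumrB.
apply: (le_trans (ler_norm_sum _ _ _)).
rewrite (bigD1 k)//= dif_del mul0r subr0.
have dd : 0 <= delta ^+ 2 by exact: sqr_ge0.
have h1 : `|D k F x * M k F x| <= delta ^+ 2 * (2 * s (tnth x k)).
  rewrite normrM (_ : _ * _ = (delta * s (tnth x k)) * (2 * delta)); last by ring.
  by apply: ler_pM => //; exact: mdiff_bound2.
have h2 j : j != k ->
    `|D j F x * M j F x - D j F (del t0 k x) * M j F (del t0 k x)| <=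
    delta ^+ 2 * (3 * b (tnth x j, tnth x k) + pi * s (tnth x k)).
  move=> jk; set a := D j F x; set c := D j F (del t0 k x).
  set u := M j F x; set v := M j F (del t0 k x).
  have -> : a * u - c * v = (a - c) * u + c * (u - v) by ring.
  set bjk := b _.
  have e1 : `|(a - c) * u| <= (delta * bjk) * (2 * delta).
    by rewrite normrM ler_pM//; [exact: locDD|exact: mdiff_bound2].
  have e2 : `|c * (u - v)| <= delta * (delta * (bjk + pi * s (tnth x k))).
    rewrite normrM ler_pM//; last exact: mdiff_del.
    apply: (le_trans (locD _ _)).
    by rewrite ler_piMr.
  apply: (le_trans (ler_normD _ _)); apply: (le_trans (lerD e1 e2)).
  by rewrite le_eqVlt; apply/orP; left; apply/eqP; ring.
apply: (@le_trans _ _ (delta ^+ 2 * (2 * s (tnth x k)) + \sum_(j < n | j != k)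
   delta ^+ 2 * (3 * b (tnth x j, tnth x k) + pi * s (tnth x k)))).
  by apply: lerD => //; apply: ler_sum => j; exact: h2.
rewrite -mulr_sumr -mulrDr ler_wpM2l// big_split /= -mulr_sumr -/(A k x).
have : \sum_(j < n | j != k) pi * s (tnth x k) <= n%:R * pi * s (tnth x k).
  apply: (@le_trans _ _ (\sum_(j < n) pi * s (tnth x k))).
    by rewrite [leRHS](bigD1 k)//= lerDr mulr_ge0.
  by rewrite sum_cst_ord mulrA.
by rewrite mulrDl; lra.
Qed.

Let Ex_b j k : j != k -> Ex mu (fun x => b (tnth x j, tnth x k)) <= pi * q.
Proof.
move=> jk; rewrite (Ex_resample P j)// -(Ex_s k) -ExZ//.
apply: Ex_le; [exact: (bm_Ex_upd P j (bbt j k))|exact: bmZ|move=> x].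
under eq_fun do rewrite tnth_upd_eq tnth_upd_neq 1?eq_sym//.
exact: bpi.
Qed.

Let b_le1 p : b p <= 1.
Proof. by case: p => y z; exact: le_trans (bsl y z) (s1 y). Qed.

(** On the diagonal b^2 <= b. Off the diagonal x_i and x_j are independent given x_k, so integrating
    one after the other yields two factors [pi]. *)
Lemma Ex_A_sqr k : Ex mu (fun x => A k x ^+ 2) <=
  q * (n%:R * pi + (n%:R * pi) ^+ 2).
Proof.
under eq_fun do rewrite expr2 /A mulr_suml.
rewrite Ex_sum; last by move=> j; exact: bmM (bbt j k) (bA k).
apply: (@le_trans _ _ (\sum_(j < n | j != k) (pi * q + n%:R * pi ^+ 2 * q))).
  apply: ler_sum => j jk; under eq_fun do rewrite mulr_sumr.
  rewrite Ex_sum; last by move=> i; apply: bmM.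
  rewrite (bigD1 j)//=; apply: lerD.
    apply: (le_trans _ (Ex_b jk)); apply: Ex_le => //; first exact: bmM.
    by move=> x; rewrite ler_piMr.
  apply: (@le_trans _ _ (\sum_(i < n | (i != k) && (i != j)) pi ^+ 2 * q)).
    apply: ler_sum => i /andP[ik ij].
    rewrite (Ex_resample P i); last exact: bmM.
    apply: (@le_trans _ _ (Ex mu (fun x => pi * b (tnth x j, tnth x k)))).
      apply: Ex_le; [by exact: (bm_Ex_upd P i (bmM (bbt j k) (bbt i k)))|exact: bmZ|move=> x].
      under eq_fun do rewrite tnth_upd_eq (tnth_upd_neq _ _ (_ : j != i)) 1?eq_sym//
        (tnth_upd_neq _ _ (_ : k != i)) 1?eq_sym//.
      rewrite ExZ; last exact: (bm_slicer bb).
      rewrite mulrC ler_wpM2r//; apply: (le_trans (bpi _)).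
      by rewrite ler_piMr.
    by rewrite ExZ// expr2 -mulrA ler_wpM2l// Ex_b.
  have -> : n%:R * pi ^+ 2 * q = \sum_(i < n) pi ^+ 2 * q.
    by rewrite sum_cst_ord mulrA.
  rewrite [leRHS](bigID (fun i : 'I_n => (i != k) && (i != j)))/= lerDl.
  by apply: sumr_ge0 => i _; rewrite mulr_ge0// sqr_ge0.
apply: (@le_trans _ _ (\sum_(j < n) (pi * q + n%:R * pi ^+ 2 * q))).
  rewrite [leRHS](bigD1 k)//= lerDr addr_ge0// mulr_ge0//.
  by rewrite mulr_ge0// sqr_ge0.
rewrite sum_cst_ord.
by rewrite le_eqVlt; apply/orP; left; apply/eqP; ring.
Qed.

(** Efron-Stein applied to the kernel itself; 30 is a convenient constant that absorbs 2 (2 + n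
    pi)^2 + 18 (n pi + (n pi)^2). *)
Lemma var_stein_kernel :
  var P stein_kernel <= 30 * (n%:R * q) * delta ^+ 4 * (1 + n%:R * pi) ^+ 2.
Proof.
apply: (le_trans (efron_stein P t0 bm_stein_kernel)).
set Pi := n%:R * pi.
have Pi0 : 0 <= Pi by rewrite mulr_ge0.
apply: (@le_trans _ _ (\sum_(k < n) 30 * q * delta ^+ 4 * (1 + Pi) ^+ 2)); last first.
  rewrite sum_cst_ord.
  by rewrite le_eqVlt; apply/orP; left; apply/eqP; ring.
apply: ler_sum => k _.
apply: (@le_trans _ _ (Ex mu (fun x =>
    delta ^+ 4 * (2 * (2 + Pi) ^+ 2) * s (tnth x k) + 18 * delta ^+ 4 * A k x ^+ 2))).
  apply: Ex_le.
  - by apply: bmX; exact: bm_dif bm_stein_kernel.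
  - by apply: bmD; apply: bmZ => //; exact: bmX.
  move=> x; have := dif_stein_kernel k x; rewrite -/Pi.
  set c := s _; set a := A k x => h.
  have a0 : 0 <= a by apply: sumr_ge0.
  have c0 : 0 <= c by exact: s0.
  have c1 : c <= 1 by exact: s1.
  rewrite -real_normK ?num_real//.
  have : `|dif t0 k stein_kernel x| ^+ 2 <=
      (delta ^+ 2 * ((2 + Pi) * c + 3 * a)) ^+ 2.
    by rewrite ler_sqr ?nnegrE// mulr_ge0 ?sqr_ge0// addr_ge0 ?mulr_ge0// addr_ge0.
  move=> /le_trans; apply.
  have -> : (delta ^+ 2 * ((2 + Pi) * c + 3 * a)) ^+ 2 =
    delta ^+ 4 * ((2 + Pi) * c + 3 * a) ^+ 2 by ring.
  have -> : delta ^+ 4 * (2 * (2 + Pi) ^+ 2) * c + 18 * delta ^+ 4 * a ^+ 2 =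
    delta ^+ 4 * (2 * (2 + Pi) ^+ 2 * c + 18 * a ^+ 2) by ring.
  rewrite ler_wpM2l ?exprn_even_ge0//.
  have := sqr_ge0 ((2 + Pi) * c - 3 * a).
  have : (2 + Pi) ^+ 2 * c ^+ 2 <= (2 + Pi) ^+ 2 * c.
    by rewrite ler_wpM2l ?sqr_ge0// expr2 ler_piMr.
  by lra.
rewrite ExD; [|exact: bmZ|by apply: bmZ; exact: bmX].
rewrite ExZ// ExZ; last exact: bmX.
rewrite Ex_s.
have dd : 0 <= delta ^+ 4 by rewrite exprn_even_ge0.
have := Ex_A_sqr k; rewrite -/Pi => h.
have h' : 18 * delta ^+ 4 * Ex mu (fun x => A k x ^+ 2) <=
   18 * delta ^+ 4 * (q * (Pi + Pi ^+ 2)).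
  by rewrite ler_wpM2l// mulr_ge0.
apply: (le_trans (lerD (lexx _) h')).
have -> : delta ^+ 4 * (2 * (2 + Pi) ^+ 2) * q + 18 * delta ^+ 4 * (q * (Pi + Pi ^+ 2))
  = (delta ^+ 4 * q) * (2 * (2 + Pi) ^+ 2 + 18 * (Pi + Pi ^+ 2)) by ring.
have -> : 30 * q * delta ^+ 4 * (1 + Pi) ^+ 2 = (delta ^+ 4 * q) * (30 * (1 + Pi) ^+ 2).
  by ring.
rewrite ler_wpM2l ?mulr_ge0//.
by nra.
Qed.

Lemma Ex_third k : Ex mu (fun x => D k F x ^+ 2 * `|M k F x|) <= 2 * delta ^+ 3 * q.
Proof.
rewrite -(Ex_s k) -ExZ//; apply: Ex_le.
- apply: bmM; first by apply: bmX; exact: bm_dif.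
  by apply: bm_norm; exact: bm_mdiff.
- exact: bmZ.
move=> x; have -> : 2 * delta ^+ 3 * s (tnth x k) =
   (delta ^+ 2 * s (tnth x k)) * (2 * delta) by ring.
apply: ler_pM => //; first exact: sqr_ge0; last exact: mdiff_bound2.
rewrite -real_normK ?num_real//.
apply: (@le_trans _ _ ((delta * s (tnth x k)) ^+ 2)).
  by rewrite ler_sqr ?nnegrE ?mulr_ge0// locD.
rewrite exprMn ler_wpM2l ?sqr_ge0// expr2.
by rewrite ler_piMr.
Qed.

Definition stdize x := (F x - Ex mu F) / Num.sqrt (var P F).

(** Expanding E g(W) W over increments and linearising each difference of g(W) produces E g'(W)
    times the kernel divided by the variance. The first error is the fluctuation of the kernel
    around its mean, the second is the Taylor remainder, of third order in the influences. *)
Lemma stein_bound (g g' : R -> R) (C1 C2 : R) : 0 < var P F ->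
  bm g -> bm g' -> (forall u, `|g' u| <= C1) -> 0 <= C2 ->
  (forall u v, `|g v - g u - g' u * (v - u)| <= C2 * (v - u) ^+ 2) ->
  `|Ex mu (fun x => g (stdize x) * stdize x) -
    Ex mu (fun x => g' (stdize x))| <=
    C1 * Num.sqrt (30 * (n%:R * q) * delta ^+ 4 * (1 + n%:R * pi) ^+ 2) / var P F
    + C2 * (2 * (n%:R * q) * delta ^+ 3) / (Num.sqrt (var P F)) ^+ 3.
Proof.
move=> v0 bg bg' g'C C20 gT; set W := stdize; set sg := Num.sqrt (var P F).
have sg0 : 0 < sg by rewrite sqrtr_gt0.
have sgE : var P F = sg ^+ 2 by rewrite sqr_sqrtr// ltW.
have sgn0 : sg != 0 by rewrite gt_eqF.
have bW : bm W.
  rewrite (_ : W = fun x => sg^-1 * (F x - Ex mu F)); first exact: bmZ (bm_center _ _).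
  by apply/funext => x; rewrite /W /stdize mulrC.
have bgW : bm (fun x => g (W x)) by exact: (bm_comp bg bW.1).
have bgW' : bm (fun x => g' (W x)) by exact: (bm_comp bg' bW.1).
have WD j x : W (del t0 j x) - W x = - (D j F x / sg).
  by rewrite /W /stdize /dif -mulrBl -mulNr; congr (_ * _); ring.
pose rho j x := dif t0 j (fun x => g (W x)) x - g' (W x) * (D j F x / sg).
have brho j : bm (rho j).
  apply: bmB; first exact: bm_dif.
  apply: bmM => //; under eq_fun do rewrite mulrC.
  by apply: bmZ; exact: bm_dif.
have rho_le j x : `|rho j x| <= C2 * (D j F x ^+ 2 / sg ^+ 2).
  have := gT (W x) (W (del t0 j x)).
  rewrite WD sqrrN exprMn exprVn.
  by rewrite (_ : _ - _ = - rho j x) ?normrN//; rewrite /rho /dif; ring.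
have bDM j : bm (fun x => D j F x * M j F x).
  by apply: bmM; [exact: bm_dif|exact: bm_mdiff].
have E1 : Ex mu (fun x => g (W x) * W x) =
    sg^-1 * \sum_(j < n) Ex mu (fun x => dif t0 j (fun x => g (W x)) x * M j F x).
  rewrite -Ex_mul_centered// -ExZ; last by apply: bmM => //; exact: bm_center.
  by congr Ex; apply/funext => x; rewrite /W /stdize; ring.
have E2 j : Ex mu (fun x => dif t0 j (fun x => g (W x)) x * M j F x) =
    sg^-1 * Ex mu (fun x => g' (W x) * (D j F x * M j F x)) +
    Ex mu (fun x => rho j x * M j F x).
  rewrite -ExZ; last exact: bmM.
  rewrite -ExD; last 2 first.
  - by apply: bmZ; exact: bmM.
  - by apply: bmM => //; exact: bm_mdiff.
  by congr Ex; apply/funext => x; rewrite /rho; ring.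
have E3 : \sum_(j < n) Ex mu (fun x => g' (W x) * (D j F x * M j F x)) =
    Ex mu (fun x => g' (W x) * stein_kernel x).
  rewrite -Ex_sum; last by move=> j; exact: bmM.
  by congr Ex; apply/funext => x; rewrite /stein_kernel mulr_sumr.
have bK := bm_stein_kernel.
have EK : Ex mu stein_kernel = var P F.
  by rewrite (varE P t0 bF) /stein_kernel Ex_sum.
have E4 : Ex mu (fun x => g (W x) * W x) - Ex mu (fun x => g' (W x)) =
   sg^-2 * Ex mu (fun x => g' (W x) * (stein_kernel x - Ex mu stein_kernel)) +
   sg^-1 * \sum_(j < n) Ex mu (fun x => rho j x * M j F x).
  rewrite E1 (eq_bigr _ (fun j _ => E2 j)) big_split/= -mulr_sumr E3 mulrDr.
  rewrite addrAC; congr (_ + _).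
  under [in RHS]eq_fun do rewrite EK mulrBr.
  rewrite [in RHS]ExB; last 2 first.
  - exact: bmM.
  - by apply: bmM => //; exact: bm_cst.
  under [X in _ = _ * (_ - Ex _ X)]eq_fun do rewrite mulrC.
  rewrite [in RHS]ExZ// sgE mulrBr; congr (_ - _).
    by rewrite mulrA -expr2 exprVn.
  by rewrite mulrA mulVf ?mul1r// expf_neq0.
rewrite E4; apply: (le_trans (ler_normD _ _)); apply: lerD.
  have i2 : 0 < sg ^- 2 by rewrite invr_gt0 exprn_gt0.
  have i2E : (var P F)^-1 = sg ^- 2 by rewrite sgE.
  rewrite normrM (gtr0_norm i2) i2E mulrC (ler_pM2r i2).
  have bKc : bm (fun x => stein_kernel x - Ex mu stein_kernel).
    by exact: bm_center.
  apply: (@le_trans _ _ (C1 * Ex mu (fun x => `|stein_kernel x - Ex mu stein_kernel|))).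
    apply: (le_trans (Ex_norm _ (bmM bgW' bKc))).
    rewrite -ExZ; last exact: bm_norm.
    apply: Ex_le.
    - by apply: bm_norm; exact: bmM.
    - by apply: bmZ; exact: bm_norm.
    - by move=> x; rewrite normrM ler_wpM2r.
  rewrite ler_wpM2l//; first by apply: le_trans (g'C 0).
  rewrite -[leLHS]ger0_norm; last by apply: Ex_ge0 => x.
  rewrite -sqrtr_sqr ler_wsqrtr//.
  apply: (le_trans (Ex_sqr _ (bm_norm bKc))).
  apply: (le_trans _ var_stein_kernel).
  by rewrite /var le_eqVlt; apply/orP; left; apply/eqP; congr Ex;
    apply/funext => x; rewrite real_normK ?num_real.
rewrite normrM gtr0_norm ?invr_gt0//.
have -> : C2 * (2 * (n%:R * q) * delta ^+ 3) / sg ^+ 3 =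
   sg^-1 * (C2 / sg ^+ 2 * (2 * (n%:R * q) * delta ^+ 3)) by field.
rewrite ler_pM2l ?invr_gt0//.
apply: (le_trans (ler_norm_sum _ _ _)).
apply: (@le_trans _ _ (\sum_(j < n) C2 / sg ^+ 2 * (2 * delta ^+ 3 * q))); last first.
  rewrite sum_cst_ord.
  by rewrite le_eqVlt; apply/orP; left; apply/eqP; ring.
apply: ler_sum => j _.
have bDM2 : bm (fun x => D j F x ^+ 2 * `|M j F x|).
  apply: bmM; first by apply: bmX; exact: bm_dif.
  by apply: bm_norm; exact: bm_mdiff.
apply: (@le_trans _ _ (C2 / sg ^+ 2 * Ex mu (fun x => D j F x ^+ 2 * `|M j F x|))).
  have brM : bm (fun x => rho j x * M j F x) by apply: bmM => //; exact: bm_mdiff.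
  apply: (le_trans (Ex_norm _ brM)); rewrite -ExZ//.
  apply: Ex_le; [exact: bm_norm|exact: bmZ|move=> x].
  rewrite normrM mulrA ler_wpM2r//.
  by apply: (le_trans (rho_le j x)); rewrite -mulrA [_^-1 * _]mulrC.
by rewrite ler_wpM2l// ?Ex_third// divr_ge0// sqr_ge0.
Qed.

(** Cauchy-Schwarz against the number of points counted by [o], whose variance is at most
    [n * Ex P o] by Efron-Stein. Each point contributes its gain [gam] to the covariance, less a
    centring loss of at most [delta * q]. *)
Lemma var_lower (o : T -> R) (gam : R) : bm o -> (forall y, 0 <= o y <= 1) -> o t0 = 0 ->
  (forall j, gam * Ex P o <= Ex mu (fun x => o (tnth x j) * D j F x)) ->
  delta * q <= gam ->
  n%:R * Ex P o * (gam - delta * q) ^+ 2 <= var P F.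
Proof.
move=> bo o01 ot0 hgam hg; set p := Ex P o.
have o0 y : 0 <= o y by case/andP: (o01 y).
have o1 y : o y <= 1 by case/andP: (o01 y).
have p0 : 0 <= p by exact: Ex_ge0.
have var0 : 0 <= var P F by apply: Ex_ge0 => x; exact: sqr_ge0.
have [->|pn0] := eqVneq (n%:R * p) 0; first by rewrite mul0r.
have np0 : 0 < n%:R * p by rewrite lt_neqAle eq_sym pn0 mulr_ge0.
pose psi (x : Om) := \sum_(j < n) o (tnth x j).
have bot j : bm (fun x : Om => o (tnth x j)) by exact: bm_tnth.
have bpsi : bm psi by exact: bm_sum.
have vpsi : var P psi <= n%:R * p.
  apply: (le_trans (efron_stein P t0 bpsi)).
  apply: (@le_trans _ _ (\sum_(j < n) p)); last first.
    by rewrite sum_cst_ord.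
  apply: ler_sum => k _; rewrite /p -(Ex_tnth P k bo).
  apply: Ex_le => //; first by apply: bmX; exact: bm_dif.
  move=> x; rewrite /dif /psi -sumrB (bigD1 k)//= big1 ?addr0; last first.
    by move=> j jk; rewrite /del tnth_upd_neq// subrr.
  by rewrite /del tnth_upd_eq ot0 subr0 expr2 ler_piMr.
have bFc := bm_center P bF; have bpc := bm_center P bpsi.
have cov : n%:R * p * (gam - delta * q) <=
    Ex mu (fun x => (F x - Ex mu F) * (psi x - Ex mu psi)).
  have -> : Ex mu (fun x => (F x - Ex mu F) * (psi x - Ex mu psi)) =
      \sum_(j < n) Ex mu (fun x => o (tnth x j) * (F x - Ex mu F)).
    rewrite -Ex_sum; last by move=> j; exact: bmM.
    have z : Ex mu (fun x => Ex mu psi * (F x - Ex mu F)) = 0.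
      rewrite ExZ// ExB//; last exact: bm_cst.
      by rewrite Ex_cst subrr mulr0.
    rewrite -[RHS]subr0 -[X in _ = _ - X]z -ExB.
    - by congr Ex; apply/funext => x; rewrite -[in RHS]mulr_suml -/(psi x); ring.
    - by apply: bm_sum => j; exact: bmM.
    - exact: bmZ.
  have -> : n%:R * p * (gam - delta * q) = \sum_(j < n) p * (gam - delta * q).
    by rewrite sum_cst_ord mulrA.
  apply: ler_sum => j _.
  have bd := bm_del t0 j bF.
  (* After deletion of [j] the functional is independent of x_j. *)
  have e1 : Ex mu (fun x => o (tnth x j) * F (del t0 j x)) =
      p * Ex mu (fun x => F (del t0 j x)).
    rewrite (Ex_resample P j); last exact: bmM.
    rewrite -ExZ//; congr Ex; apply/funext => x.
    rewrite mulrC -ExZ//; congr Ex; apply/funext => y.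
    by rewrite tnth_upd_eq indep_del mulrC.
  have e2 : Ex mu (fun x => o (tnth x j) * (F x - Ex mu F)) =
      Ex mu (fun x => o (tnth x j) * D j F x) - p * Ex mu (D j F).
    transitivity (Ex mu (fun x => o (tnth x j) * F x) - p * Ex mu F).
      rewrite /p -(Ex_tnth P j bo) mulrC -ExZ// -ExB; [|exact: bmM|exact: bmZ].
      by congr Ex; apply/funext => x; ring.
    rewrite (_ : Ex mu (fun x => o (tnth x j) * D j F x) =
      Ex mu (fun x => o (tnth x j) * F x) - p * Ex mu (fun x => F (del t0 j x))).
      by rewrite ExB//; ring.
    rewrite -e1 -ExB; [|exact: bmM|exact: bmM].
    by congr Ex; apply/funext => x; rewrite mulrBr.
  rewrite e2 mulrBr lerB//; first by rewrite mulrC hgam.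
  rewrite ler_wpM2l// -(Ex_s j) -ExZ//.
  apply: Ex_le; [exact: bm_dif|exact: bmZ|move=> x].
  exact: le_trans (ler_norm _) (locD j x).
have cs := Ex_CS mu bFc bpc.
have h : (n%:R * p * (gam - delta * q)) ^+ 2 <= var P F * (n%:R * p).
  have m0 : 0 <= n%:R * p * (gam - delta * q).
    by rewrite mulr_ge0 ?subr_ge0// ltW.
  apply: (@le_trans _ _ (var P F * var P psi)); last exact: (ler_wpM2l var0 vpsi).
  apply: le_trans cs; move: m0 cov.
  move: (n%:R * p * _) (Ex mu _) => u v u0 uv.
  by rewrite !expr2; apply: ler_pM.
rewrite -(ler_pM2r np0); apply: (le_trans _ h).
by rewrite le_eqVlt; apply/orP; left; apply/eqP; ring.
Qed.

End local_functional.

(** * The normal law *)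

Section integral_normal.
Context (R : realType) (m s : R).
Local Notation leb := (@lebesgue_measure R).
Local Notation N := (@normal_prob R m s).
Local Notation pdf := (normal_pdf m s).
Local Open Scope ereal_scope.
Import HBNNSimple.

Let pdf_ge0 x : 0 <= (pdf x)%:E.
Proof. by rewrite lee_fin normal_pdf_ge0. Qed.

Let mpdf : measurable_fun setT (fun x => (pdf x)%:E).
Proof. by apply/measurable_EFinP; exact: measurable_normal_pdf. Qed.

Let integral_normal_indic E : measurable E ->
  \int[N]_x (\1_E x)%:E = \int[leb]_x ((\1_E x)%:E * (pdf x)%:E).
Proof.
move=> mE; rewrite integral_indic// setIT [LHS]integral_mkcond.
apply: eq_integral => x _; rewrite patchE indicE.
by case: (x \in E); rewrite ?mul1e ?mul0e.
Qed.

Let integral_normal_nnsfun (f : {nnsfun measurableTypeR R >-> R}) :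
  \int[N]_x (f x)%:E = \int[leb]_x ((f x)%:E * (pdf x)%:E).
Proof.
under [LHS]eq_integral do rewrite fimfunE -fsumEFin//.
rewrite [LHS]ge0_integral_fsum//; last 2 first.
  - by move=> r; exact/measurable_EFinP/measurableT_comp.
  - by move=> n x _; rewrite EFinM nnfun_muleindic_ge0.
under [RHS]eq_integral.
  move=> x xD; rewrite fimfunE -fsumEFin// muleC ge0_mule_fsumr; last first.
    by move=> r; rewrite EFinM nnfun_muleindic_ge0.
  over.
rewrite [RHS]ge0_integral_fsum//; last 2 first.
  - move=> r; apply: emeasurable_funM => //.
    by apply/measurable_EFinP; exact: measurableT_comp.
  - by move=> n x _; rewrite mule_ge0// EFinM nnfun_muleindic_ge0.
apply: eq_fsbigr => r _; rewrite integralZl_indic_nnsfun//= integral_normal_indic//.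
have [r0|r0] := ltP r 0%R.
  rewrite preimage_nnfun0//; under eq_integral do rewrite indic0 mul0e.
  rewrite integral0 mule0; under eq_integral do rewrite indic0 mulr0 mule0.
  by rewrite integral0.
rewrite -ge0_integralZl//.
- by apply: eq_integral => x _; rewrite EFinM muleA muleC.
- apply: emeasurable_funM => //.
  by apply/measurable_EFinP; exact: measurable_indic.
- by move=> x _; rewrite mule_ge0// lee_fin.
Qed.

Lemma integral_normal_prob (f : measurableTypeR R -> \bar R) :
  measurable_fun setT f -> (forall x, 0 <= f x) ->
  \int[N]_x f x = \int[leb]_x (f x * (pdf x)%:E).
Proof.
move=> mf f0; pose f_ := nnsfun_approx measurableT mf.
transitivity (limn (fun n => \int[N]_x (f_ n x)%:E)).
  rewrite -monotone_convergence//=.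
  - apply: eq_integral => ? /[!inE] xD; apply/esym/cvg_lim => //=.
    exact: cvg_nnsfun_approx.
  - by move=> n; apply/measurable_EFinP; exact: measurable_funPT.
  - by move=> n ? _; rewrite lee_fin.
  - by move=> ? _ ? ? mn; rewrite lee_fin; exact/lefP/nd_nnsfun_approx.
transitivity (limn (fun n => \int[leb]_x ((f_ n x)%:E * (pdf x)%:E))).
  by apply: congr_lim; apply/funext => n /=; exact: integral_normal_nnsfun.
rewrite -monotone_convergence//=.
- apply: eq_integral => x _; apply/cvg_lim => //.
  by apply: cvgeZr => //; exact: cvg_nnsfun_approx.
- move=> n; apply: emeasurable_funM => //.
  exact/measurable_EFinP/measurable_funTS.
- by move=> n x _; rewrite mule_ge0// lee_fin.
- move=> x _ a b ab; rewrite lee_wpmul2r// lee_fin.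
  exact/lefP/nd_nnsfun_approx.
Qed.

End integral_normal.

(** * Ramp functions and Lipschitz tools *)

Section ramp.
Context (R : realType).
Implicit Types x y z : R.

Definition ramp z : R := Num.min 1 (Num.max 0 z).

Lemma ramp_ge0 z : 0 <= ramp z.
Proof. by rewrite /ramp le_min ler01 le_max lexx. Qed.

Lemma ramp_le1 z : ramp z <= 1.
Proof. by rewrite /ramp ge_min lexx. Qed.

Lemma ramp1 z : 1 <= z -> ramp z = 1.
Proof. by move=> z1; apply/min_idPl; rewrite le_max z1 orbT. Qed.

Lemma ramp0 z : z <= 0 -> ramp z = 0.
Proof. by move=> z0; rewrite /ramp (max_idPl z0); apply/min_idPr. Qed.

Lemma ramp_id z : 0 <= z <= 1 -> ramp z = z.
Proof. by move=> /andP[z0 z1]; rewrite /ramp (max_idPr z0); apply/min_idPr. Qed.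

Lemma ramp_cases z : [\/ z <= 0 /\ ramp z = 0, 1 <= z /\ ramp z = 1 |
  0 <= z <= 1 /\ ramp z = z].
Proof.
have [z0|/ltW z0] := leP z 0; first by constructor 1; rewrite ramp0.
have [z1|/ltW z1] := leP 1 z; first by constructor 2; rewrite ramp1.
by constructor 3; rewrite ramp_id ?z0.
Qed.

Lemma ramp_le x y : x <= y -> ramp x <= ramp y.
Proof.
by move=> xy; case: (ramp_cases x) (ramp_cases y) => -[hx ->] [] [hy ->]; lra.
Qed.

Lemma ramp_lip x y : `|ramp x - ramp y| <= `|x - y|.
Proof.
wlog xy : x y / x <= y => [h|].
  by have [/h//|/ltW/h] := leP x y; rewrite distrC (distrC y).
rewrite distrC (distrC x) !ger0_norm ?subr_ge0// ?ramp_le//.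
by case: (ramp_cases x) (ramp_cases y) => -[hx ->] [] [hy ->]; lra.
Qed.

End ramp.

Section lipschitz.
Context (R : realType).

Lemma lipschitz_continuous (f : R -> R) (L : R) :
  (forall x y, `|f x - f y| <= L * `|x - y|) -> continuous f.
Proof.
move=> fL x; apply/cvgrPdist_le => e e0; near=> y.
apply: (le_trans (fL x y)).
apply: (@le_trans _ _ ((`|L| + 1) * `|x - y|)).
  by rewrite ler_wpM2r// (le_trans (ler_norm _))// lerDl.
rewrite mulrC -ler_pdivlMr; last by rewrite ltr_wpDl.
near: y; apply: cvgr_dist_le; first exact: cvg_id.
by rewrite divr_gt0// ltr_wpDl.
Unshelve. all: by end_near. Qed.

Lemma continuous_bm (f : R -> R) (M : R) :
  continuous f -> (forall x, `|f x| <= M) -> bm f.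
Proof. by move=> cf fM; split; [exact: continuous_measurable_fun|exists M]. Qed.

Lemma derive_lipschitz (f f' : R -> R) (L : R) :
  (forall x, is_derive x (1 : R) f (f' x)) -> (forall x, `|f' x| <= L) ->
  forall x y, `|f x - f y| <= L * `|x - y|.
Proof.
move=> df f'L x y; wlog xy : x y / x <= y => [h|].
  by have [/h//|/ltW/h] := leP x y; rewrite distrC (distrC y).
have fc : {within `[x, y], continuous f}.
  apply: derivable_within_continuous => z _.
  exact: (@ex_derive _ _ _ _ _ _ _ (df z)).
have [c _ fE] := MVT_segment xy (fun z _ => df z) fc.
by rewrite distrC fE (distrC x) normrM ler_wpM2r.
Qed.

End lipschitz.

(** * The standard normal distribution function *)

Section normal01.
Context (R : realType).
Local Notation leb := (@lebesgue_measure R).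
Local Notation N := (@normal_prob R 0 1).
Local Notation pdf := (@normal_pdf R 0 1).

Lemma normal_pdf01E x : pdf x = normal_peak 1 * expR (- (x ^+ 2 / 2)).
Proof.
rewrite normal_pdfE ?oner_neq0// /normal_fun subr0 expr1n.
by rewrite mulNr.
Qed.

Lemma normal_peak1_gt0 : 0 < normal_peak (1 : R).
Proof. by rewrite normal_peak_gt0 ?oner_neq0. Qed.

Lemma normal_pdf01_le1 x : pdf x <= 1.
Proof.
apply: (le_trans (normal_pdf_ub _ _ _)); first by rewrite oner_neq0.
rewrite /normal_peak expr1n mul1r invf_le1 ?sqrtr_gt0; last first.
  by rewrite pmulrn_lgt0// pi_gt0.
rewrite -[leLHS]sqrtr1 ler_wsqrtr//.
by rewrite mulr2n (le_trans _ (lerD (pi_ge2 R) (pi_ge0 R)))//; lra.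
Qed.

Lemma integrable_mul_pdf (f : R -> R) : bm f ->
  leb.-integrable setT (EFin \o (fun x => f x * pdf x)).
Proof.
move=> bf; have [M M0 fM] := bm_bound bf.
have mpdf := @measurable_normal_pdf R 0 1.
apply: (@le_integrable _ _ _ leb _ measurableT _ (fun x => M%:E * (pdf x)%:E)%E) => //.
- by apply/measurable_EFinP; apply: measurable_funM => //; exact: bf.1.
- move=> x _ /=; rewrite lee_fin !normrM ler_pM//.
  by rewrite (le_trans (fM x)) ?ler_norm.
- by apply: integrableZl => //; exact: integrable_normal_pdf.
Qed.

Lemma Ex_normal (f : R -> R) : bm f ->
  Ex N f = Rintegral leb setT (fun x => f x * pdf x).
Proof.
move=> bf; have [M M0 fM] := bm_bound bf.
have fM0 x : 0 <= f x + M by have := fM x; rewrite ler_norml => /andP[]; lra.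
have bM : bm (fun _ : R => M) by exact: bm_cst.
have e : Ex N (fun x => f x + M) = Rintegral leb setT (fun x => (f x + M) * pdf x).
  rewrite /Ex /Rintegral; congr fine; rewrite integral_normal_prob//.
  by apply/measurable_EFinP; exact: (bmD bf bM).1.
have e2 : Rintegral leb setT (fun x => (f x + M) * pdf x) =
    Rintegral leb setT (fun x => f x * pdf x) + Rintegral leb setT (fun x => M * pdf x).
  rewrite -RintegralD//; try exact: integrable_mul_pdf.
  by apply: eq_Rintegral => x _; rewrite mulrDl.
move: e; rewrite e2 ExD//.
rewrite Ex_cst RintegralZl//; last exact: integrable_normal_pdf.
rewrite [X in _ = _ + M * X -> _](_ : _ = 1) ?mulr1; last first.
  by rewrite /Rintegral integral_normal_pdf.
exact: addIr.
Qed.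

Lemma Phi_Ex t : Phi t = Ex N (\1_[set u | u <= t]).
Proof.
rewrite Ex_indic// (_ : [set u | u <= t] = `]-oo, t]%classic)//.
Qed.

Lemma bm_le (t : R) : bm (\1_[set u | u <= t] : R -> R).
Proof.
apply: bm_indic; rewrite (_ : [set u | u <= t] = `]-oo, t]%classic)//.
Qed.

Lemma indic_leE (t x : R) : \1_[set u : R | u <= t] x = (x <= t)%R%:R :> R.
Proof. rewrite indicE; have -> // : (x \in [set u | u <= t]) = (x <= t).
by apply/idP/idP; rewrite inE. Qed.

Lemma Phi_lip (s t : R) : s <= t -> Phi t <= Phi s + (t - s).
Proof.
move=> st; rewrite !Phi_Ex -lerBlDl -ExB; [|exact: bm_le|exact: bm_le].
have bd : bm (fun x : R => (\1_[set u | u <= t] x - \1_[set u | u <= s] x) : R).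
  by apply: bmB; exact: bm_le.
rewrite Ex_normal//.
have -> : t - s = Rintegral leb setT (fun x => \1_`]s, t]%classic x).
  rewrite /Rintegral integral_indic// setIT.
  have /= -> := lebesgue_measure_itv (`]s, t] : interval R); rewrite lte_fin.
  by case: ltP => // ts; have -> : s = t; [apply/le_anti; rewrite st ts|rewrite subrr].
apply: le_Rintegral => //.
- exact: integrable_mul_pdf.
- apply/integrableP; split; first exact/measurable_EFinP/measurable_indic.
  under eq_integral do rewrite /= ger0_norm//.
  rewrite integral_indic// setIT.
  by have /= -> := lebesgue_measure_itv (`]s, t] : interval R); case: ifP => _; exact: ltry.
move=> x _; rewrite !indic_leE indicE.
have -> : (x \in `]s, t]%classic) = (s < x <= t).
  by apply/idP/idP; rewrite inE/= in_itv.
have := normal_pdf01_le1 x; have := normal_pdf_ge0 0 1 x.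
by case: (leP x s) => xs; case: (leP x t) => xt /=; lra.
Qed.

Lemma Phi_mono (s t : R) : s <= t -> Phi s <= Phi t.
Proof.
move=> st; rewrite !Phi_Ex; apply: Ex_le; [exact: bm_le|exact: bm_le|move=> x].
by rewrite !indic_leE ler_nat; case: (leP x s) => // xs; rewrite (le_trans xs st).
Qed.

(** The identity as a random variable under the normal law: its distribution function is [Phi],
    whose limits at both ends are then known. *)
Let idR : measurableTypeR R -> R := idfun.

#[local] HB.instance Definition _ :=
  @isMeasurableFun.Build _ _ _ _ idR (@measurable_id _ _ setT).

Let cdfE r : fine (cdf (idR : {RV N >-> R}) r) = Phi r.
Proof.
rewrite /cdf /distribution /pushforward preimage_id /Phi; congr (fine (_ _)).
Qed.

Lemma normal_tail (e : R) : 0 < e -> exists2 B, 1 <= B &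
  Phi (- B) <= e /\ 1 - Phi B <= e.
Proof.
move=> e0.
have h0 : (fine \o cdf (idR : {RV N >-> R})) x @[x --> -oo] --> 0.
  by apply: fine_cvg; exact: cvg_cdfNy0.
have h1 : (fine \o cdf (idR : {RV N >-> R})) x @[x --> +oo] --> (1 : R).
  by apply: fine_cvg; exact: cvg_cdfy1.
have [r0 [_ hr0]] := cvgr_le _ h0 e e0.
have e1 : 1 - e < 1 by lra.
have [r1 [_ hr1]] := cvgr_ge _ h1 (1 - e) e1.
exists (1 + `|r0| + `|r1|); first by rewrite -addrA lerDl addr_ge0.
have n0 := normr_ge0 r0; have n1 := normr_ge0 r1.
have m0 := ler_norm (- r0); have m1 := ler_norm r1; rewrite normrN in m0.
split.
  by rewrite -cdfE; apply: hr0; lra.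
rewrite -cdfE; have /= := hr1 (1 + `|r0| + `|r1|).
set c := fine _; move=> h; have : 1 - e <= c by apply: h; lra.
by lra.
Qed.

End normal01.

Section psi.
Context (R : realType).

(** Reciprocal of the standard normal density. It serves twice: as integrating factor of the Stein
    equation, and as density of Lebesgue measure with respect to the normal law. *)
Definition psi (w : R) := (normal_peak (1 : R))^-1 * expR (w ^+ 2 / 2).

Lemma psi_ge0 w : 0 <= psi w.
Proof. by rewrite /psi mulr_ge0 ?expR_ge0// invr_ge0 normal_peak_ge0. Qed.

Lemma psi_le (A w : R) : `|w| <= A -> psi w <= psi A.
Proof.
move=> wA; rewrite /psi ler_wpM2l ?invr_ge0 ?normal_peak_ge0// ler_expR.
have A0 : 0 <= A by exact: le_trans wA.
by rewrite ler_pM2r ?invr_gt0// -real_normK ?num_real// ler_sqr ?nnegrE.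
Qed.

End psi.

(** * The Stein equation for a recentred smoothed indicator *)

Section test_function.
Context (R : realType).
Local Notation leb := (@lebesgue_measure R).
Local Notation N := (@normal_prob R 0 1).
Local Notation pdf := (@normal_pdf R 0 1).
Variables (eta : R).
Hypothesis eta0 : 0 < eta.

Definition smooth_le (c w : R) := ramp ((c + eta - w) / eta).

Lemma smooth_le_lip c u v :
  `|smooth_le c u - smooth_le c v| <= eta^-1 * `|u - v|.
Proof.
apply: (le_trans (ramp_lip _ _)).
rewrite -mulrBl normrM mulrC gtr0_norm ?invr_gt0// ler_pM2l ?invr_gt0//.
by rewrite le_eqVlt; apply/orP; left; apply/eqP; rewrite distrC; congr `|_|; ring.
Qed.

Lemma smooth_le1 c w : w <= c -> smooth_le c w = 1.
Proof.
by move=> wc; apply: ramp1; rewrite ler_pdivlMr// mul1r; lra.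
Qed.

Lemma smooth_le0 c w : c + eta <= w -> smooth_le c w = 0.
Proof.
by move=> wc; apply: ramp0; rewrite ler_pdivrMr// mul0r; lra.
Qed.

Lemma smooth_le_mono c c' w : c <= c' -> smooth_le c w <= smooth_le c' w.
Proof. by move=> cc; apply: ramp_le; rewrite ler_pM2r ?invr_gt0//; lra. Qed.

Lemma smooth_le_ge0 c w : 0 <= smooth_le c w. Proof. exact: ramp_ge0. Qed.
Lemma smooth_le_le1 c w : smooth_le c w <= 1. Proof. exact: ramp_le1. Qed.

Lemma continuous_smooth_le c : continuous (smooth_le c).
Proof. exact: (lipschitz_continuous (@smooth_le_lip c)). Qed.

Lemma bm_smooth_le c : bm (smooth_le c).
Proof.
apply: (@continuous_bm _ _ 1); first exact: continuous_smooth_le.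
by move=> w; rewrite ger0_norm ?smooth_le_ge0 ?smooth_le_le1.
Qed.

Variables (c0 t c1 A : R).
Hypothesis c0t : c0 <= t.
Hypothesis tc1 : t <= c1.
Hypothesis Ac0 : - A <= c0.
Hypothesis c1A : c1 + eta <= A.
Local Notation m c := (Ex N (smooth_le c)).
Hypothesis m01 : m c0 < m c1.

Let A0 : 0 <= A. Proof. by move: eta0 c0t tc1 Ac0 c1A; lra. Qed.

(** The coefficient that gives [hfun] mean 0 under the normal law; it lies in [0, 1] because t lies
    between c0 and c1. *)
Definition kap := (m t - m c0) / (m c1 - m c0).

Lemma m_mono c c' : c <= c' -> m c <= m c'.
Proof.
move=> cc; apply: Ex_le; [exact: bm_smooth_le|exact: bm_smooth_le|move=> w].
exact: smooth_le_mono.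
Qed.

Lemma kap_ge0 : 0 <= kap.
Proof. by apply: divr_ge0; rewrite subr_ge0; [exact: m_mono|exact: ltW]. Qed.

Lemma kap_le1 : kap <= 1.
Proof. by rewrite /kap ler_pdivrMr ?subr_gt0// mul1r lerB// m_mono. Qed.

Definition hfun w :=
  smooth_le t w - smooth_le c0 w - kap * (smooth_le c1 w - smooth_le c0 w).

Lemma hfun_norm w : `|hfun w| <= 1.
Proof.
have k0 := kap_ge0; have k1 := kap_le1; rewrite /hfun.
have h0 := smooth_le_mono w c0t; have h1 := smooth_le_mono w tc1.
have a0 := smooth_le_ge0 c0 w; have b1 := smooth_le_le1 c1 w.
have e1 : 0 <= kap * (smooth_le c1 w - smooth_le c0 w).
  by rewrite mulr_ge0//; lra.
have e2 : kap * (smooth_le c1 w - smooth_le c0 w) <= 1.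
  by rewrite -[leRHS]mulr1 ler_pM//; lra.
by rewrite ler_norml; lra.
Qed.

(** Grouped by ramps, the three slopes carry the weights 1, kap and 1 - kap, which add up to 2. *)
Lemma hfun_lip u v : `|hfun u - hfun v| <= (2 / eta) * `|u - v|.
Proof.
have k0 := kap_ge0; have k1 := kap_le1.
have -> : hfun u - hfun v = (smooth_le t u - smooth_le t v) -
   kap * (smooth_le c1 u - smooth_le c1 v) - (1 - kap) * (smooth_le c0 u - smooth_le c0 v).
  by rewrite /hfun; ring.
have l0 := smooth_le_lip c0 u v; have l1 := smooth_le_lip c1 u v.
have lt := smooth_le_lip t u v.
apply: (le_trans (ler_normB _ _)); apply: (le_trans (lerD (ler_normB _ _) (lexx _))).
have nM (a b : R) : 0 <= a -> `|a * b| = a * `|b| by move=> a0; rewrite normrM ger0_norm.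
rewrite (nM _ _ k0) nM ?subr_ge0//.
have l1' : kap * `|smooth_le c1 u - smooth_le c1 v| <= kap * (eta^-1 * `|u - v|).
  exact: ler_wpM2l.
have l0' : (1 - kap) * `|smooth_le c0 u - smooth_le c0 v| <= (1 - kap) * (eta^-1 * `|u - v|).
  by apply: ler_wpM2l => //; lra.
by lra.
Qed.

Lemma continuous_hfun : continuous hfun.
Proof. exact: (lipschitz_continuous hfun_lip). Qed.

Lemma bm_hfun : bm hfun.
Proof. exact: continuous_bm continuous_hfun hfun_norm. Qed.

Lemma hfun_out w : (w <= c0) || (c1 + eta <= w) -> hfun w = 0.
Proof.
move=> /orP[wc|wc]; rewrite /hfun.
  rewrite (smooth_le1 wc) (smooth_le1 (le_trans wc c0t)).
  by rewrite (smooth_le1 (le_trans wc (le_trans c0t tc1))); ring.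
have [e0 et] : c0 + eta <= w /\ t + eta <= w.
  by move: c0t tc1 wc; lra.
by rewrite (smooth_le0 wc) (smooth_le0 e0) (smooth_le0 et); ring.
Qed.

Lemma Ex_hfun : Ex N hfun = 0.
Proof.
have b0 := bm_smooth_le c0; have b1 := bm_smooth_le c1; have bt := bm_smooth_le t.
rewrite /hfun ExB; [|exact: bmB|by apply: bmZ; exact: bmB].
rewrite ExB// ExZ; last exact: bmB.
by rewrite ExB// /kap divfK ?subrr// gt_eqF// subr_gt0.
Qed.

Definition Hfun (w : R) := Rintegral leb `]-oo, w]%classic (fun x => hfun x * pdf x).

Let ih : leb.-integrable setT (EFin \o (fun x => hfun x * pdf x)).
Proof. exact: integrable_mul_pdf bm_hfun. Qed.

Let ih' w : leb.-integrable `]-oo, w]%classic (EFin \o (fun x => hfun x * pdf x)).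
Proof. exact: integrableS ih. Qed.

Lemma Hfun_derive w : is_derive w (1 : R) Hfun (hfun w * pdf w).
Proof.
have cont : {for w, continuous (fun x => hfun x * pdf x)}.
  apply: cvgM; first exact: continuous_hfun.
  by apply: continuous_normal_pdf; rewrite oner_neq0.
have w1 : w < w + 1 by lra.
have [||h1 h2] := @continuous_FTC1 R _ -oo%O w (w + 1) w1 (ih' (w + 1)).
- by rewrite ltNyr.
- exact: cont.
rewrite -[X in is_derive _ _ _ X]h2 derive1E; exact: derivableP h1.
Qed.

Lemma Hfun_left w : w <= c0 -> Hfun w = 0.
Proof.
move=> wc; rewrite /Hfun (_ : Rintegral _ _ _ = Rintegral leb `]-oo, w]%classic (fun=> 0)).
  by rewrite Rintegral_cst// mul0r.
apply: eq_Rintegral => x; rewrite inE/= in_itv/= => xw.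
by rewrite hfun_out ?mul0r// (le_trans xw wc).
Qed.

(** Beyond the support the partial integral is the whole one, which is 0. Thus the Stein solution
    has compact support and the growth of [psi] is harmless. *)
Lemma Hfun_right w : c1 + eta <= w -> Hfun w = 0.
Proof.
move=> wc; rewrite -Ex_hfun (Ex_normal bm_hfun) /Hfun Rintegral_mkcond.
apply: eq_Rintegral => x _; rewrite patchE; case: ifPn => //.
rewrite notin_setE/= in_itv/= => /negP; rewrite -ltNge => wx.
by rewrite hfun_out ?mul0r// (le_trans wc (ltW wx)) orbT.
Qed.

Lemma Hfun_norm w : `|Hfun w| <= 1.
Proof.
rewrite /Hfun; apply: (le_trans (le_normr_Rintegral _ (ih' w))) => //.
have ipdf := @integrable_normal_pdf R 0 1.
have n0 : 0 <= Rintegral leb setT pdf by apply: Rintegral_ge0 => x _; exact: normal_pdf_ge0.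
have n1 : Rintegral leb setT pdf = 1 by rewrite /Rintegral integral_normal_pdf.
rewrite -[leRHS]n1 Rintegral_mkcond; apply: le_Rintegral => //.
  rewrite (_ : _ \o _ = ((EFin \o (fun x => `|hfun x * pdf x|)) \_ `]-oo, w]%classic)).
    rewrite -integrable_mkcond//.
    by have := integrable_abse (ih' w).
  by apply/funext => x; rewrite /= !patchE; case: ifP.
move=> x _; rewrite patchE; case: ifP => _; last exact: normal_pdf_ge0.
rewrite normrM (ger0_norm (normal_pdf_ge0 _ _ _)).
by rewrite ler_piMl ?normal_pdf_ge0// hfun_norm.
Qed.

Lemma pdf_psi w : pdf w * psi w = 1.
Proof.
have np := @normal_peak1_gt0 R.
rewrite normal_pdf01E /psi mulrACA mulfV ?gt_eqF// mul1r -expRD addNr.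
exact: expR0.
Qed.

Lemma psi_derive w : is_derive w (1 : R) (@psi R) (w * psi w).
Proof.
have e : is_derive w (1 : R) (fun x : R => expR (x ^+ 2 / 2)) (w * expR (w ^+ 2 / 2)).
  have -> : (fun x : R => expR (x ^+ 2 / 2)) = expR \o (fun x => x ^+ 2 / 2) by [].
  have d1 : is_derive w (1 : R) (fun x : R => x ^+ 2 / 2) w.
    have -> : (fun x : R => x ^+ 2 / 2) = 2^-1 \*: (fun x : R => x ^+ 2).
      by apply/funext => x; rewrite /= mulrC.
    apply: is_derive_eq; rewrite /GRing.scale/= /GRing.scale/=.
    by field.
  have d2 := is_derive_expR (w ^+ 2 / 2).
  have d3 := @is_derive1_comp R expR (fun x : R => x ^+ 2 / 2) w _ _ d2 d1.
  by apply: (is_derive_eq d3); exact: mulrC.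
have -> : @psi R = (normal_peak (1 : R))^-1 \*: (fun x : R => expR (x ^+ 2 / 2)) by [].
apply: is_derive_eq; rewrite /psi /GRing.scale/= /GRing.scale/=.
by ring.
Qed.

(** Solution of the Stein equation g'(w) - w g(w) = h(w); [gfun'] is read off from the equation and
    [gfun_derive] identifies it with the derivative. *)
Definition gfun w := Hfun w * psi w.
Definition gfun' w := hfun w + w * gfun w.

Lemma gfun_derive w : is_derive w (1 : R) gfun (gfun' w).
Proof.
have h1 := Hfun_derive w; have h2 := psi_derive w.
have -> : gfun = Hfun * @psi R by [].
apply: is_derive_eq; rewrite /gfun' /gfun /GRing.scale/=.
have := pdf_psi w => e.
rewrite mulrC -addrC; congr (_ + _); last by ring.
by rewrite mulrC -mulrA e mulr1.
Qed.

Lemma gfun_out w : A < `|w| -> gfun w = 0.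
Proof.
rewrite ltr_normr => /orP[Aw|Aw]; rewrite /gfun.
  by rewrite Hfun_right ?mul0r//; move: Aw c1A; lra.
by rewrite Hfun_left ?mul0r//; move: Aw Ac0; lra.
Qed.

Definition C1 := 1 + A * psi A.
Definition C2 := 2 / eta + psi A + A * C1.

Lemma gfun_norm w : `|gfun w| <= psi A.
Proof.
have [wA|wA] := leP `|w| A; last by rewrite gfun_out// normr0 psi_ge0.
rewrite /gfun normrM -[leRHS]mul1r ler_pM// ?Hfun_norm//.
by rewrite ger0_norm ?psi_ge0// psi_le.
Qed.

Lemma gfun'_norm w : `|gfun' w| <= C1.
Proof.
apply: (le_trans (ler_normD _ _)); apply: lerD; first exact: hfun_norm.
have [wA|wA] := leP `|w| A.
  by rewrite normrM ler_pM// gfun_norm.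
by rewrite gfun_out// mulr0 normr0 mulr_ge0// psi_ge0.
Qed.

Lemma gfun_lip u v : `|gfun u - gfun v| <= C1 * `|u - v|.
Proof. exact: derive_lipschitz gfun_derive gfun'_norm u v. Qed.

Let C1_ge0 : 0 <= C1.
Proof. by rewrite addr_ge0// mulr_ge0// psi_ge0. Qed.

Lemma gfun'_lip u v : `|gfun' u - gfun' v| <= C2 * `|u - v|.
Proof.
have -> : gfun' u - gfun' v = (hfun u - hfun v) + (u * gfun u - v * gfun v).
  by rewrite /gfun'; ring.
apply: (le_trans (ler_normD _ _)).
have -> : C2 * `|u - v| = 2 / eta * `|u - v| + (psi A + A * C1) * `|u - v|.
  by rewrite /C2; ring.
apply: lerD; first exact: hfun_lip.
have g0 := psi_ge0 A.
have [vA|vA] := leP `|v| A.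
  have -> : u * gfun u - v * gfun v = (u - v) * gfun u + v * (gfun u - gfun v) by ring.
  apply: (le_trans (ler_normD _ _)); rewrite [leRHS]mulrDl; apply: lerD.
    by rewrite normrM mulrC ler_wpM2r// gfun_norm.
  by rewrite normrM -mulrA ler_pM// gfun_lip.
have [uA|uA] := leP `|u| A; last first.
  by rewrite !gfun_out// !mulr0 subrr normr0 mulr_ge0// addr_ge0// mulr_ge0.
have -> : u * gfun u - v * gfun v = u * (gfun u - gfun v).
  by rewrite (gfun_out vA); ring.
rewrite normrM [leRHS]mulrDl -[leLHS]add0r; apply: lerD; first by rewrite mulr_ge0.
by rewrite -mulrA ler_pM// gfun_lip.
Qed.

Let C2_ge0 : 0 <= C2.
Proof. by rewrite !addr_ge0 ?psi_ge0// ?mulr_ge0// ?invr_ge0 ltW. Qed.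

Lemma gfun_taylor u v : `|gfun v - gfun u - gfun' u * (v - u)| <= C2 * (v - u) ^+ 2.
Proof.
have fc a b : {within `[a, b], continuous gfun}.
  apply: derivable_within_continuous => z _.
  exact: (@ex_derive _ _ _ _ _ _ _ (gfun_derive z)).
have key c : gfun v - gfun u = gfun' c * (v - u) -> `|c - u| <= `|v - u| ->
    `|gfun v - gfun u - gfun' u * (v - u)| <= C2 * (v - u) ^+ 2.
  move=> -> cu; rewrite -mulrBl normrM -[(v - u) ^+ 2]real_normK ?num_real//.
  rewrite expr2 mulrA ler_wpM2r//.
  by apply: (le_trans (gfun'_lip _ _)); rewrite ler_wpM2l.
have [uv|/ltW vu] := leP u v.
  have [c + gE] := MVT_segment uv (fun z _ => gfun_derive z) (fc u v).
  rewrite in_itv/= => /andP[uc cv]; apply: (key c) => //.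
  by rewrite !ger0_norm ?subr_ge0//; lra.
have [c + gE] := MVT_segment vu (fun z _ => gfun_derive z) (fc v u).
rewrite in_itv/= => /andP[uc cv]; apply: (key c).
  by rewrite -[LHS]opprB gE; ring.
by rewrite !ler0_norm ?subr_le0//; lra.
Qed.

Lemma bm_gfun : bm gfun.
Proof. exact: continuous_bm (lipschitz_continuous gfun_lip) gfun_norm. Qed.

Lemma bm_gfun' : bm gfun'.
Proof. exact: continuous_bm (lipschitz_continuous gfun'_lip) gfun'_norm. Qed.

End test_function.

(** * From the Stein equation to the Kolmogorov distance *)

Section kolmogorov.
Context (R : realType).
Local Notation N := (@normal_prob R 0 1).

Lemma sqr_ge_ratio (B w : R) : 0 < B -> B <= `|w| -> 1 <= w ^+ 2 / B ^+ 2.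
Proof.
move=> B0 Bw; rewrite ler_pdivlMr ?exprn_gt0// mul1r.
by rewrite -[w ^+ 2]real_normK ?num_real// ler_sqr ?nnegrE// ltW.
Qed.

(* Stein's method is only needed for compactly supported test functions: [hfun]
   is a smoothed indicator of [[c0, t]] recentred by a multiple of a smoothed
   indicator of a large interval, and Chebyshev controls the two tails. *)
Lemma kolmogorov_stein (e : R) : 0 < e -> exists2 K : R, 0 < K &
  forall d (T : measurableType d) (mu : probability T R) (W : T -> R),
  bm W -> Ex mu (fun x => W x ^+ 2) <= 1 ->
  (forall g g' : R -> R, bm g -> bm g' -> (forall u, `|g' u| <= K) ->
    (forall u v, `|g v - g u - g' u * (v - u)| <= K * (v - u) ^+ 2) ->
    `|Ex mu (fun x => g (W x) * W x) - Ex mu (fun x => g' (W x))| <= K^-1) ->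
  forall t, `|Ex mu (fun x => \1_[set u | u <= t] (W x)) - Phi t| <= e.
Proof.
move=> e0.
have [th [th0 the th8]] : exists th : R, [/\ 0 < th, th <= e / 16 & th <= 1 / 8].
  exists (Num.min (e / 16) (1 / 8)).
  by rewrite lt_min !divr_gt0// !ge_min !lexx orbT.
have [B1 B11 [PB1 PB1']] := normal_tail th0.
have thi : 0 < th^-1 by rewrite invr_gt0.
(* The summand [B1] controls the normal tails; the summand 1/th makes 1/B^2 <= th, the Chebyshev
   bound for W. *)
have [B BE] : exists B, B = B1 + th^-1 by exists (B1 + th^-1).
have B1B : B1 <= B by rewrite BE lerDl ltW.
have B0 : 0 < B by apply: lt_le_trans B1B; lra.
have B2 : (B ^+ 2)^-1 <= th.
  rewrite invf_ple ?posrE ?exprn_gt0//.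
  apply: (@le_trans _ _ B); first by rewrite BE lerDr; lra.
  by rewrite expr2 ler_pMr//; lra.
have PB : Phi (- B) <= th by apply: (le_trans _ PB1); apply: Phi_mono; lra.
have PB' : 1 - Phi B <= th.
  by apply: (le_trans _ PB1'); rewrite lerB// Phi_mono.
have [eta etaE] : exists eta, eta = e / 4 by exists (e / 4).
have eta0 : 0 < eta by rewrite etaE divr_gt0.
have [c0 c0E] : exists c0, c0 = - B - eta by exists (- B - eta).
have [c1 c1E] : exists c1, c1 = B by exists B.
have [A AE] : exists A, A = B + eta by exists (B + eta).
have bsl c : bm (smooth_le eta c) by exact: bm_smooth_le.
have [m mE] : exists m : R -> R, forall c, m c = Ex N (smooth_le eta c).
  by exists (fun c => Ex N (smooth_le eta c)).
have Nm c : Phi c <= m c <= Phi (c + eta).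
  rewrite mE !Phi_Ex; apply/andP; split; (apply: Ex_le; [ | |move=> w]);
    try exact: bm_le; try exact: bsl.
    rewrite indic_leE; have [wc|_] := leP w c; last exact: smooth_le_ge0.
    by rewrite smooth_le1.
  rewrite indic_leE; have [wc|/ltW wc] := leP w (c + eta); first exact: smooth_le_le1.
  by rewrite smooth_le0.
have m0 : m c0 <= th.
  by have /andP[_] := Nm c0; rewrite c0E subrK => /le_trans; apply.
have m1 : 1 - th <= m c1.
  by have /andP[+ _] := Nm c1; apply: le_trans; move: PB'; rewrite c1E; lra.
have m01 : m c0 < m c1.
  by apply: (le_lt_trans m0); apply: (lt_le_trans _ m1); lra.
have m01' : Ex N (smooth_le eta c0) < Ex N (smooth_le eta c1) by rewrite -!mE.
have mge0 c : 0 <= m c by rewrite mE; apply: Ex_ge0 => w; exact: smooth_le_ge0.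
have mle1 c : m c <= 1.
  rewrite mE -[leRHS](Ex_cst N); apply: Ex_le; [exact: bsl|exact: bm_cst|].
  by move=> w; exact: smooth_le_le1.
have mmono c c' : c <= c' -> m c <= m c'.
  by move=> cc; rewrite !mE; apply: Ex_le; [exact: bsl|exact: bsl|move=> x; exact: smooth_le_mono].
have A0 : 0 <= A by rewrite AE addr_ge0 ?ltW.
have psi0 : 0 <= psi A by exact: psi_ge0.
have [k1 k1E] : exists k1, k1 = C1 A by exists (C1 A).
have [k2 k2E] : exists k2, k2 = C2 eta A by exists (C2 eta A).
have k10 : 0 <= k1 by rewrite k1E /C1 addr_ge0// mulr_ge0.
have k20 : 0 <= k2.
  rewrite k2E /C2 -k1E; apply: addr_ge0; last exact: mulr_ge0.
  by apply: addr_ge0 => //; apply: divr_ge0 => //; exact: ltW.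
(* Dominates the bounds on g' and on its Taylor remainder, and its inverse is at most [th]. *)
exists (k1 + k2 + th^-1); first by rewrite ltr_wpDl// addr_ge0.
move=> d T mu W bW W2 stein t.
have bsW c : bm (fun x => smooth_le eta c (W x)) by exact: (bm_comp (bsl c) bW.1).
have bW2 : bm (fun x => (B ^+ 2)^-1 * W x ^+ 2) by apply: bmZ; exact: bmX.
have EW2 : Ex mu (fun x => (B ^+ 2)^-1 * W x ^+ 2) <= th.
  rewrite ExZ; last exact: bmX.
  by apply: (le_trans _ B2); rewrite ler_piMr// invr_ge0 sqr_ge0.
have [p pE] : exists p : R -> R, forall c, p c = Ex mu (fun x => smooth_le eta c (W x)).
  by exists (fun c => Ex mu (fun x => smooth_le eta c (W x))).
have pge0 c : 0 <= p c by rewrite pE; apply: Ex_ge0 => x; exact: smooth_le_ge0.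
have ple1 c : p c <= 1.
  rewrite pE -[leRHS](Ex_cst mu); apply: Ex_le => //; first exact: bm_cst.
  by move=> w; exact: smooth_le_le1.
have pmono c c' : c <= c' -> p c <= p c'.
  by move=> cc; rewrite !pE; apply: Ex_le => // x; exact: smooth_le_mono.
have q0 : p c0 <= th.
  rewrite pE; apply: (le_trans _ EW2); apply: Ex_le => // x.
  have [h|h] := leP (- B) (W x).
    rewrite smooth_le0; first by rewrite mulr_ge0 ?sqr_ge0// invr_ge0 sqr_ge0.
    by [].
    by rewrite c0E subrK.
  rewrite mulrC; apply: (le_trans (smooth_le_le1 _ _ _)); apply: sqr_ge_ratio => //.
  by rewrite ler_normr; apply/orP; right; rewrite lerNr ltW.
have q1 : 1 - th <= p c1.
  suff : 1 - Ex mu (fun x => (B ^+ 2)^-1 * W x ^+ 2) <= p c1.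
    by apply: le_trans; rewrite lerB.
  rewrite pE -[X in X - _](Ex_cst mu 1) -ExB//; last exact: bm_cst.
  apply: Ex_le => //; first by apply: bmB => //; exact: bm_cst.
  move=> x; have [h|h] := leP (W x) B.
    by rewrite smooth_le1 ?c1E// gerBl mulr_ge0 ?sqr_ge0// invr_ge0 sqr_ge0.
  apply: (@le_trans _ _ 0); last exact: smooth_le_ge0.
  rewrite subr_le0 mulrC; apply: sqr_ge_ratio => //.
  by rewrite ler_normr (ltW h).
(* Outside [c0, c1] monotonicity and the tail bounds suffice. Inside, the Stein equation bounds E
   h(W) by [th], and undoing the recentring costs a few more [th]. *)
have main s : `|p s - m s| <= 6 * th.
  have [sc|sc] := leP s c0.
    have a1 := pmono _ _ sc; have a2 := mmono _ _ sc.
    have a3 := pge0 s; have a4 := mge0 s.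
    rewrite ler_norml; lra.
  have [sc'|/ltW sc'] := leP c1 s.
    have a1 := pmono _ _ sc'; have a2 := mmono _ _ sc'.
    have a3 := ple1 s; have a4 := mle1 s.
    rewrite ler_norml; lra.
  move/ltW in sc.
  have Ac0 : - A <= c0 by rewrite AE c0E opprD.
  have c1A : c1 + eta <= A by rewrite AE c1E.
  have bg := bm_gfun eta0 sc sc' Ac0 c1A m01'.
  have bg' := bm_gfun' eta0 sc sc' Ac0 c1A m01'.
  have bh := bm_hfun eta0 sc sc' m01'.
  have [g'K gT] : (forall u, `|gfun' eta c0 s c1 u| <= k1 + k2 + th^-1) /\
      (forall u v, `|gfun eta c0 s c1 v - gfun eta c0 s c1 u -
         gfun' eta c0 s c1 u * (v - u)| <= (k1 + k2 + th^-1) * (v - u) ^+ 2).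
    split=> [u|u v].
      apply: (le_trans (gfun'_norm eta0 sc sc' Ac0 c1A m01' u)).
      by rewrite -k1E -addrA lerDl addr_ge0// ltW.
    apply: (le_trans (gfun_taylor eta0 sc sc' Ac0 c1A m01' u v)).
    by rewrite ler_wpM2r ?sqr_ge0// -k2E (addrC k1) -addrA lerDl addr_ge0// ltW.
  have := stein _ _ bg bg' g'K gT.
  have bgW : bm (fun x => gfun eta c0 s c1 (W x) * W x).
    by apply: bmM => //; exact: (bm_comp bg bW.1).
  have bgW' : bm (fun x => gfun' eta c0 s c1 (W x)) by exact: (bm_comp bg' bW.1).
  have bhW : bm (fun x => hfun eta c0 s c1 (W x)) by exact: (bm_comp bh bW.1).
  rewrite -ExB//.
  rewrite (_ : (fun x => _ - _) = fun x => - hfun eta c0 s c1 (W x)); last first.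
    by apply/funext => x; rewrite /gfun'; ring.
  rewrite ExN// normrN.
  have Kth : (k1 + k2 + th^-1)^-1 <= th.
    rewrite invf_ple ?posrE//; first by rewrite lerDr addr_ge0.
    by rewrite ltr_wpDl// addr_ge0.
  move=> /le_trans/(_ Kth).
  have [k kdef] : exists k, k = kap eta c0 s c1 by exists (kap eta c0 s c1).
  have k0 : 0 <= k by rewrite kdef; exact: kap_ge0.
  have k1' : k <= 1 by rewrite kdef; exact: kap_le1.
  have -> : Ex mu (fun x => hfun eta c0 s c1 (W x)) = p s - p c0 - k * (p c1 - p c0).
    rewrite kdef /hfun !pE ExB; [|exact: bmB|by apply: bmZ; exact: bmB].
    by rewrite ExB// ExZ ?ExB//; exact: bmB.
  have kE : k * (m c1 - m c0) = m s - m c0.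
    by rewrite kdef /kap -!mE divfK// gt_eqF// subr_gt0.
  have := pge0 c0; have := ple1 c1; have := mge0 c0; have := mle1 c1.
  move=> m1' m0' p1' p0'.
  have hk : `|k * ((p c1 - p c0) - (m c1 - m c0))| <= 2 * th.
    by rewrite normrM (ger0_norm k0) -[leRHS]mul1r ler_pM// ler_norml; lra.
  move: hk; rewrite mulrBr kE !ler_norml; lra.
have t1 : Ex mu (fun x => \1_[set u | u <= t] (W x)) <= p t.
  rewrite pE; apply: Ex_le => //; first exact: (bm_comp (bm_le t) bW.1).
  move=> x; rewrite indic_leE; have [wc|_] := leP (W x) t; last exact: smooth_le_ge0.
  by rewrite smooth_le1.
have t2 : p (t - eta) <= Ex mu (fun x => \1_[set u | u <= t] (W x)).
  rewrite pE; apply: Ex_le => //; first exact: (bm_comp (bm_le t) bW.1).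
  move=> x; rewrite indic_leE; have [wc|/ltW wc] := leP (W x) t; first exact: smooth_le_le1.
  by rewrite smooth_le0// subrK.
have h1 := main t; have h2 := main (t - eta).
have /andP[_ n1] := Nm t; have /andP[n2 _] := Nm (t - eta).
have l1 : Phi (t + eta) <= Phi t + eta.
  have := @Phi_lip R t (t + eta); rewrite addrAC subrr add0r; apply.
  by rewrite lerDl ltW.
have l2 : Phi t <= Phi (t - eta) + eta.
  have := @Phi_lip R (t - eta) t; rewrite subKr; apply.
  by rewrite gerBl ltW.
move: t1 t2; move: (Ex mu _) => P0 t1 t2.
rewrite !ler_norml in h1 h2 *; case/andP: h1 => h1 h1'; case/andP: h2 => h2 h2'.
apply/andP; split.
  by move: n2 l2 h2 t2 etaE the e0; clear; lra.
by move: n1 l1 h1' t1 etaE the e0; clear; lra.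
Qed.

End kolmogorov.

(** * Lebesgue volume as a weighted Gaussian expectation *)

Section weights.
Context (R : realType).
Local Notation B := (measurableTypeR R).
Local Notation leb := (@lebesgue_measure R).
Local Notation N := (@normal_prob R 0 1).
Local Notation pdf := (@normal_pdf R 0 1).

Lemma measurable_psi : measurable_fun setT (@psi R : B -> R).
Proof.
apply: measurable_funM => //; apply: measurableT_comp => //.
by apply: measurable_funM => //; apply: measurable_funX.
Qed.

Lemma integral_psi (f : B -> \bar R) : measurable_fun setT f ->
  (forall x, 0 <= f x)%E ->
  (\int[leb]_x f x = \int[N]_x (f x * (psi x)%:E))%E.
Proof.
move=> mf f0; rewrite integral_normal_prob; last 2 first.
- by apply: emeasurable_funM => //; apply/measurable_EFinP; exact: measurable_psi.
- by move=> x; rewrite mule_ge0// lee_fin psi_ge0.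
by apply: eq_integral => x _; rewrite -muleA -EFinM mulrC pdf_psi mule1.
Qed.

Lemma integral_itv_psi (a b : R) : a <= b ->
  (\int[N]_x (\1_`[a, b]%classic x * psi x)%:E = (b - a)%:E)%E.
Proof.
move=> ab; under eq_integral do rewrite EFinM.
rewrite -integral_psi; last 2 first.
- by apply/measurable_EFinP; exact: measurable_indic.
- by move=> x; rewrite lee_fin.
rewrite integral_indic// setIT.
have /= -> := lebesgue_measure_itv (`[a, b] : interval R).
rewrite lte_fin; case: ltP => // ba; have -> : a = b by apply/le_anti; rewrite ab ba.
by rewrite subrr.
Qed.

Lemma bm_itv_psi (a b : R) : bm (fun x : B => \1_`[a, b]%classic x * psi x).
Proof.
split.
  by apply: measurable_funM; [exact: measurable_indic|exact: measurable_psi].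
exists (psi (Num.max `|a| `|b|)) => x; rewrite indicE.
have [|] := boolP (x \in `[a, b]%classic); last by rewrite mul0r normr0 psi_ge0.
rewrite inE/= in_itv/= => /andP[ax xb].
rewrite mul1r ger0_norm ?psi_ge0//; apply: psi_le.
rewrite le_max; have [x0|x0] := leP 0 x; apply/orP.
  by right; rewrite ger0_norm// (le_trans xb)// ler_norm.
by left; rewrite ltr0_norm// -(normrN a) (le_trans _ (ler_norm _))// lerN2.
Qed.

Lemma Ex_itv_psi (a b : R) : a <= b ->
  Ex N (fun x => \1_`[a, b]%classic x * psi x) = b - a.
Proof.
by move=> ab; apply: EFin_inj; rewrite Ex_EFin ?integral_itv_psi//; exact: bm_itv_psi.
Qed.

Variable d : nat.
Local Notation Pt := (d.-tuple B).
Local Notation Pd := (tprob N d).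

Definition vec (y : Pt) (i : 'I_d) : R := tnth y i.

Lemma measurable_vec i : measurable_fun setT (fun y : Pt => vec y i).
Proof. exact: measurable_tnth. Qed.

Lemma vec_upd y i t j : vec (upd y i t) j = if j == i then t else vec y j.
Proof. by rewrite /vec tnth_upd. Qed.

Definition sqn (v : 'I_d -> R) := \sum_i v i ^+ 2.

Lemma sqn_ge0 v : 0 <= sqn v.
Proof. by apply: sumr_ge0 => i _; exact: sqr_ge0. Qed.

Lemma sqn_coord v i : v i ^+ 2 <= sqn v.
Proof. by rewrite /sqn (bigD1 i)//= lerDl; apply: sumr_ge0 => j _; exact: sqr_ge0. Qed.

Lemma measurable_sqn : measurable_fun setT (fun y : Pt => sqn (vec y)).
Proof.
by apply: measurable_sum => i; apply: measurable_funX; exact: measurable_vec.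
Qed.

(** Density of d-dimensional Lebesgue measure with respect to the standard Gaussian law. *)
Definition wgt (y : Pt) := \prod_i psi (vec y i).

Lemma wgt_ge0 y : 0 <= wgt y.
Proof. by apply: prodr_ge0 => i _; exact: psi_ge0. Qed.

Lemma measurable_wgt : measurable_fun setT wgt.
Proof.
apply: measurable_prod => i _.
exact: (measurableT_comp measurable_psi (measurable_vec i)).
Qed.

Lemma wgtE y : wgt y = ((normal_peak (1 : R))^-1) ^+ d * expR (sqn (vec y) / 2).
Proof.
rewrite /wgt /psi big_split/= prodr_const card_ord; congr (_ * _).
by rewrite -expR_sum /sqn mulr_suml.
Qed.

Definition sqn_bounded (A : set Pt) := exists rho : R, forall y, A y -> sqn (vec y) <= rho.

Lemma bm_indic_wgt A : measurable A -> sqn_bounded A -> bm (fun y => \1_A y * wgt y).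
Proof.
move=> mA [rho Arho]; split.
  by apply: measurable_funM; [exact: measurable_indic|exact: measurable_wgt].
exists (((normal_peak (1 : R))^-1) ^+ d * expR (rho / 2)) => y; rewrite indicE.
have p0 : 0 <= ((normal_peak (1 : R))^-1) ^+ d.
  by rewrite exprn_ge0// invr_ge0 normal_peak_ge0.
have [|] := boolP (y \in A); last by rewrite mul0r normr0 mulr_ge0// expR_ge0.
rewrite inE => /Arho yr; rewrite mul1r ger0_norm ?wgt_ge0// wgtE.
by rewrite ler_wpM2l// ler_expR ler_pM2r.
Qed.

(** Lebesgue measure of [A]. On bounded sets the weight is bounded, so the calculus of bounded
    measurable functions applies. *)
Definition vol (A : set Pt) := Ex Pd (fun y => \1_A y * wgt y).

Lemma bounded_subset A A' : A `<=` A' -> sqn_bounded A' -> sqn_bounded A.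
Proof. by move=> AA [rho h]; exists rho => y /AA; exact: h. Qed.

Lemma vol_ge0 A : 0 <= vol A.
Proof. by apply: Ex_ge0 => y; rewrite mulr_ge0// wgt_ge0. Qed.

Lemma indic_le (T : Type) (A A' : set T) (x : T) : (A x -> A' x) ->
  (\1_A x : R) <= \1_A' x.
Proof.
move=> AA; rewrite !indicE; have [|//] := boolP (x \in A).
by rewrite inE => /AA h; rewrite mem_set.
Qed.

Lemma le_vol A A' : measurable A -> measurable A' -> sqn_bounded A' ->
  A `<=` A' -> vol A <= vol A'.
Proof.
move=> mA mA' bA' AA; apply: Ex_le.
- by apply: bm_indic_wgt => //; exact: bounded_subset bA'.
- exact: bm_indic_wgt.
- by move=> y; rewrite ler_wpM2r ?wgt_ge0//; apply: indic_le; exact: AA.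
Qed.

Lemma vol_cover (I : finType) A (A' : I -> set Pt) : measurable A -> sqn_bounded A ->
  (forall i, measurable (A' i)) -> (forall i, sqn_bounded (A' i)) ->
  (forall y, A y -> exists i, A' i y) -> vol A <= \sum_i vol (A' i).
Proof.
move=> mA bA mA' bA' cov; rewrite -Ex_sum; last by move=> i; exact: bm_indic_wgt.
apply: Ex_le.
- exact: bm_indic_wgt.
- by apply: bm_sum => i; exact: bm_indic_wgt.
move=> y; rewrite -mulr_suml ler_wpM2r ?wgt_ge0// indicE.
have [|_] := boolP (y \in A); last by apply: sumr_ge0.
rewrite inE => /cov[i Ai]; rewrite (bigD1 i)//= indicE mem_set// lerDl.
by apply: sumr_ge0.
Qed.

Definition wgt_off i (y : Pt) := \prod_(j | j != i) psi (vec y j).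

Lemma wgt_upd i y t : wgt (upd y i t) = psi t * wgt_off i y.
Proof.
rewrite /wgt (bigD1 i)//= vec_upd eqxx; congr (_ * _).
by apply: eq_bigr => j ji; rewrite vec_upd (negbTE ji).
Qed.

Lemma wgt_off_ge0 i y : 0 <= wgt_off i y.
Proof. by apply: prodr_ge0 => j _; exact: psi_ge0. Qed.

Definition box_off i (c : 'I_d -> R) (rho : R) (y : Pt) : R :=
  \prod_(j | j != i) \1_`[c j - rho, c j + rho]%classic (vec y j).

Lemma box_off1 i c rho y : (forall j, j != i -> `|vec y j - c j| <= rho) ->
  box_off i c rho y = 1.
Proof.
move=> h; apply: big1 => j /h; rewrite ler_norml => /andP[h1 h2].
by rewrite indicE mem_set//= in_itv/=; apply/andP; split; lra.
Qed.

Lemma box_off0 i c rho y j : j != i -> rho < `|vec y j - c j| ->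
  box_off i c rho y = 0.
Proof.
move=> ji h; rewrite /box_off (bigD1 j)//= indicE memNset ?mul0r//=.
rewrite in_itv/= => /andP[h1 h2]; move: h; rewrite ltNge => /negP; apply.
by rewrite ler_norml; lra.
Qed.

Lemma box_off_ge0 i c rho y : 0 <= box_off i c rho y.
Proof. by apply: prodr_ge0 => j _. Qed.

Lemma bm_box_wgt i c rho : bm (fun y => box_off i c rho y * wgt_off i y).
Proof.
rewrite (_ : (fun _ => _) = fun y : Pt => \prod_(j | j != i)
   (fun t : B => \1_`[c j - rho, c j + rho]%classic t * psi t) (tnth y j)).
  elim: (index_enum _) => [|j s IH].
    by under eq_fun do rewrite big_nil; exact: bm_cst.
  under eq_fun do rewrite big_cons; case: (j != i) => //.
  by apply: bmM => //; exact: (bm_tnth j (bm_itv_psi (c j - rho) (c j + rho))).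
by apply/funext => y; rewrite -big_split.
Qed.

Lemma Ex_box_wgt i c rho : 0 <= rho ->
  Ex Pd (fun y => box_off i c rho y * wgt_off i y) = (2 * rho) ^+ d.-1.
Proof.
move=> rho0; apply: EFin_inj; rewrite Ex_EFin; last exact: bm_box_wgt.
pose phi j (t : B) := if j == i then 1 else \1_`[c j - rho, c j + rho]%classic t * psi t.
transitivity (\int[Pd]_y (\prod_j phi j (tnth y j))%:E)%E.
  apply: eq_integral => y _; congr EFin.
  rewrite [RHS](bigD1 i)//= {1}/phi eqxx mul1r -big_split/=.
  by apply: eq_bigr => j ji; rewrite /phi (negbTE ji).
rewrite (@tprob_prod _ _ _ N d phi (fun j => if j == i then 1 else 2 * rho)).
- rewrite (bigD1 i)//= eqxx mul1r; congr EFin.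
  rewrite (eq_bigr (fun=> 2 * rho)) => [|j /negbTE ->//].
  by rewrite prodr_const; congr (_ ^+ _); rewrite cardC1 card_ord.
- move=> j; rewrite /phi; case: (j == i); first exact: measurable_cst.
  exact: (bm_itv_psi _ _).1.
- by move=> j t; rewrite /phi; case: (j == i) => //; rewrite mulr_ge0// psi_ge0.
move=> j; rewrite /phi; case: (j == i); first exact: integral_cst_prob.
by rewrite integral_itv_psi; [congr EFin; ring|lra].
Qed.

(** Fubini with the i-th coordinate innermost. Two intervals are allowed because a line may meet a
    shell in two pieces. *)
Lemma vol_slice_le A i c (rho k : R) : measurable A -> sqn_bounded A -> 0 <= rho ->
  (forall y, exists a1 b1 a2 b2, [/\ a1 <= b1, a2 <= b2, (b1 - a1) + (b2 - a2) <= k &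
    forall t, A (upd y i t) -> (forall j, j != i -> `|vec y j - c j| <= rho) /\
      ((a1 <= t <= b1) || (a2 <= t <= b2))]) ->
  vol A <= (2 * rho) ^+ d.-1 * k.
Proof.
move=> mA bA rho0 H.
have bAw := bm_indic_wgt mA bA.
rewrite /vol (Ex_resample N i bAw) -(Ex_box_wgt i c rho0) mulrC -ExZ; last exact: bm_box_wgt.
apply: Ex_le; [exact: bm_Ex_upd bAw|by apply: bmZ; exact: bm_box_wgt|move=> y].
have [a1 [b1 [a2 [b2 [ab1 ab2 kE Hy]]]]] := H y.
have i1 := bm_itv_psi a1 b1; have i2 := bm_itv_psi a2 b2.
set bw := box_off i c rho y * wgt_off i y.
have bw0 : 0 <= bw by rewrite mulr_ge0 ?box_off_ge0 ?wgt_off_ge0.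
apply: (@le_trans _ _ (Ex N (fun t => bw * (\1_`[a1, b1]%classic t * psi t +
    \1_`[a2, b2]%classic t * psi t)))).
  apply: Ex_le; [exact: (bm_updr y i bAw)|by apply: bmZ; exact: bmD|move=> t].
  rewrite wgt_upd indicE; have [|_] := boolP (_ \in A); last first.
    by rewrite mul0r mulr_ge0// addr_ge0// mulr_ge0// psi_ge0.
  rewrite inE => /Hy[hb ht]; rewrite mul1r /bw box_off1// mul1r mulrC.
  rewrite ler_wpM2l ?wgt_off_ge0// -mulrDl -[leLHS]mul1r ler_wpM2r ?psi_ge0//.
  rewrite !indicE; case/orP: ht => ht.
    by rewrite mem_set ?lerDl//= in_itv.
  by rewrite [t \in `[a2, b2]%classic]mem_set ?lerDr//= in_itv.
rewrite ExZ; last exact: bmD.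
by rewrite ExD// !Ex_itv_psi// mulrC ler_wpM2r.
Qed.

Lemma vol_slice_ge A i c (rho k : R) : measurable A -> sqn_bounded A -> 0 <= rho ->
  (forall y, (forall j, j != i -> `|vec y j - c j| <= rho) ->
    exists a b, [/\ a <= b, k <= b - a & forall t, a <= t <= b -> A (upd y i t)]) ->
  (2 * rho) ^+ d.-1 * k <= vol A.
Proof.
move=> mA bA rho0 H.
have bAw := bm_indic_wgt mA bA.
rewrite /vol (Ex_resample N i bAw) -(Ex_box_wgt i c rho0) mulrC -ExZ; last exact: bm_box_wgt.
apply: Ex_le; [by apply: bmZ; exact: bm_box_wgt|exact: bm_Ex_upd bAw|move=> y].
have [hb|] := pselect (forall j, j != i -> `|vec y j - c j| <= rho); last first.
  move=> /existsNP[j /not_implyP[ji /negP]]; rewrite -ltNge => hj.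
  rewrite (box_off0 ji hj) mul0r mulr0; apply: Ex_ge0 => t.
  by rewrite mulr_ge0// wgt_ge0.
have [a [b [ab kab Hy]]] := H y hb.
have i1 := bm_itv_psi a b.
rewrite box_off1// mul1r.
apply: (@le_trans _ _ (Ex N (fun t => wgt_off i y * (\1_`[a, b]%classic t * psi t)))).
  by rewrite ExZ// Ex_itv_psi// mulrC ler_wpM2l ?wgt_off_ge0.
apply: Ex_le; [exact: bmZ|exact: (bm_updr y i bAw)|move=> t].
rewrite wgt_upd mulrC -mulrA ler_wpM2r ?mulr_ge0 ?psi_ge0 ?wgt_off_ge0//.
  by rewrite invr_ge0 normal_peak_ge0.
rewrite indicE; have [|_ //] := boolP (t \in `[a, b]%classic).
by rewrite inE/= in_itv/= => /Hy Ay; rewrite indicE mem_set.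
Qed.

(** At distance at least r from the origin the Gaussian density is at most exp(- r^2 / 2), since its
    constant factor is at most 1. *)
Lemma prob_le_vol A (r : R) : measurable A -> sqn_bounded A ->
  (forall y, A y -> r ^+ 2 <= sqn (vec y)) ->
  Ex Pd (\1_A) <= expR (- (r ^+ 2 / 2)) * vol A.
Proof.
move=> mA bA Ar; rewrite /vol -ExZ; last exact: bm_indic_wgt.
apply: Ex_le; [exact: bm_indic|by apply: bmZ; exact: bm_indic_wgt|move=> y].
rewrite indicE; have [|] := boolP (y \in A); last by rewrite mul0r mulr0.
rewrite inE => /Ar ry; rewrite mul1r wgtE mulrCA -expRD.
have p1 : 1 <= ((normal_peak (1 : R))^-1) ^+ d.
  rewrite exprn_ege1// invf_ge1 ?normal_peak1_gt0//.
  by have := normal_pdf01_le1 (0 : R); rewrite normal_pdf01E expr0n mul0r oppr0 expR0 mulr1.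
apply: (@le_trans _ _ (1 * 1)); first by rewrite mul1r.
by apply: ler_pM => //; rewrite -[leLHS]expR0 ler_expR; lra.
Qed.

Lemma prob_ge_vol A (s : R) : measurable A -> sqn_bounded A ->
  (forall y, A y -> sqn (vec y) <= s ^+ 2) ->
  normal_peak (1 : R) ^+ d * expR (- (s ^+ 2 / 2)) * vol A <= Ex Pd (\1_A).
Proof.
move=> mA bA Ar; rewrite /vol -ExZ; last exact: bm_indic_wgt.
apply: Ex_le; [by apply: bmZ; exact: bm_indic_wgt|exact: bm_indic|move=> y].
rewrite indicE; have [|] := boolP (y \in A); last by rewrite mul0r mulr0.
rewrite inE => /Ar ry; rewrite mul1r wgtE mulrACA -exprMn mulfV ?gt_eqF ?normal_peak1_gt0//.
by rewrite expr1n mul1r -expRD -[leRHS]expR0 ler_expR; lra.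
Qed.

End weights.

(** * The iterated integrals of the theorem as integrals over tuples *)

Section iterated_integrals.
Context (R : realType).
Local Notation B := (measurableTypeR R).
Local Notation leb := (@lebesgue_measure R).
Local Notation N := (@normal_prob R 0 1).

Lemma vec_tcons k x (y : k.-tuple B) : vec (tcons (x, y)) = ord_cons (x : R) (vec y).
Proof.
apply/funext => i; rewrite /vec /ord_cons; case: unliftP => [j|] ->.
- by rewrite tnth_tconsS.
- by rewrite tnth_tcons0.
Qed.

Lemma wgt_tcons k x (y : k.-tuple B) : wgt (tcons (x, y)) = psi (x : R) * wgt y.
Proof.
rewrite /wgt big_ord_recl; congr (psi _ * _).
by apply: eq_bigr => i _; rewrite vec_tcons /ord_cons liftK.
Qed.

Local Open Scope ereal_scope.

(** Each Lebesgue integration is a normal integration with weight [psi], and the one-coordinate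
    weights multiply to [wgt]. *)
Lemma iprod_lebesgue k (f : ('I_k -> R) -> \bar R) :
  measurable_fun setT (fun y : k.-tuple B => f (vec y)) -> (forall x, 0 <= f x) ->
  iprod (0%R : R) (fun g => \int[leb]_x g x) k f =
  \int[tprob N k]_y (f (vec y) * (wgt y)%:E).
Proof.
elim: k f => [|k IH] f mf f0.
  rewrite integral_tprob0/=; last first.
    by apply: emeasurable_funM => //; apply/measurable_EFinP; exact: measurable_wgt.
  rewrite /wgt big_ord0 mule1; congr f; apply/funext => -[]//.
have mfc : measurable_fun setT (fun p : B * k.-tuple B => f (ord_cons p.1 (vec p.2))).
  under eq_fun => p do rewrite -vec_tcons.
  apply: (measurableT_comp mf) => /=.
  by under eq_fun do rewrite -surjective_pairing; exact: measurable_tcons.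
have mw (d : nat) : measurable_fun setT (fun y : d.-tuple B => (wgt y)%:E).
  by apply/measurable_EFinP; exact: measurable_wgt.
have mfw : measurable_fun setT
    (fun p : B * k.-tuple B => f (ord_cons p.1 (vec p.2)) * (wgt p.2)%:E).
  by apply: emeasurable_funM => //; exact: (measurableT_comp (mw k) measurable_snd).
have w0 (d : nat) (y : d.-tuple B) : 0 <= (wgt y)%:E by rewrite lee_fin wgt_ge0.
have mfF : measurable_fun setT (fubini_F (tprob N k)
    (fun p : B * k.-tuple B => f (ord_cons p.1 (vec p.2)) * (wgt p.2)%:E)).
  by apply: measurable_fun_fubini_tonelli_F => // p; rewrite mule_ge0.
rewrite integral_tprobS; last 2 first.
- exact: (emeasurable_funM mf (mw k.+1)).
- by move=> y; rewrite mule_ge0.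
rewrite /=.
under eq_integral => x _.
  rewrite IH; last 2 first.
  - exact: (measurableT_comp mfc (pair1_measurable x)).
  - by move=> y; exact: f0.
  over.
rewrite integral_psi; last 2 first.
- exact: mfF.
- by move=> x; apply: integral_ge0 => y _; rewrite mule_ge0.
apply: eq_integral => x _; rewrite -ge0_integralZr//; last 3 first.
- exact: (measurableT_comp mfw (pair1_measurable x)).
- by move=> y _; rewrite mule_ge0.
- by rewrite lee_fin psi_ge0.
apply: eq_integral => y _; rewrite vec_tcons wgt_tcons EFinM -muleA; congr (_ * _).
by rewrite muleC.
Qed.

Lemma lebesgue_dE d (A : set ('I_d -> R)) : measurable (@vec R d @^-1` A) ->
  lebesgue_d A = \int[tprob N d]_y ((\1_(@vec R d @^-1` A) y)%:E * (wgt y)%:E).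
Proof.
move=> mA; rewrite /lebesgue_d iprod_lebesgue//.
by apply/measurable_EFinP; exact: measurable_indic.
Qed.

Lemma VolE d (A : set ('I_d -> R)) : measurable (@vec R d @^-1` A) ->
  Vol A = vol (@vec R d @^-1` A).
Proof. by move=> mA; rewrite /Vol lebesgue_dE// /vol. Qed.

Lemma gauss_intE d (f : ('I_d -> R) -> \bar R) :
  measurable_fun setT (fun y : d.-tuple B => f (vec y)) -> (forall x, 0 <= f x) ->
  gauss_int f = \int[tprob N d]_y f (vec y).
Proof.
move=> mf f0; rewrite /gauss_int.
by apply: (@iprodE _ _ _ N R 0%R id) => // g g0; apply: integral_ge0 => x _.
Qed.

Definition cfg d n (x : n.-tuple (d.-tuple B)) (i : 'I_n) : 'I_d -> R := vec (tnth x i).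

Lemma gauss_sample_intE d n (f : ('I_n -> 'I_d -> R) -> \bar R) :
  measurable_fun setT (fun x : n.-tuple (d.-tuple B) => f (cfg x)) ->
  (forall x, 0 <= f x) ->
  gauss_sample_int f = \int[tprob (tprob N d) n]_x f (cfg x).
Proof.
move=> mf f0; rewrite /gauss_sample_int.
apply: (@iprodE _ _ _ (tprob N d) _ (fun=> 0%R) (@vec R d)) => //.
- move=> g g0; rewrite /gauss_int; apply: iprod_ge0 => // h h0.
  by apply: integral_ge0 => x _.
- exact: gauss_intE.
Qed.

End iterated_integrals.

(** * Support bodies *)

Lemma quadratic_form_ge0 (R : realFieldType) (a b c : R) : 0 <= a -> 0 <= c ->
  (forall s t, 0 <= s ^+ 2 * a + s * t * 2 * b + t ^+ 2 * c) -> b ^+ 2 <= a * c.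
Proof.
move=> a0 c0 q.
have [c00|c00] := eqVneq c 0.
  rewrite c00 mulr0; have [->|b0] := eqVneq b 0; first by rewrite expr0n.
  have := q b (- (a + 1)); rewrite c00 => h.
  have b2 : 0 < b ^+ 2 by rewrite exprn_even_gt0.
  exfalso; nra.
have c1 : 0 < c by rewrite lt_neqAle eq_sym c00.
have := q c (- b) => h.
have : 0 <= c * (a * c - b ^+ 2) by nra.
by rewrite pmulr_rge0// subr_ge0.
Qed.

Section dot_product.
Context (R : realType) (d : nat).
Implicit Types u v w y z : 'I_d -> R.

Definition dot u v := \sum_i u i * v i.
Definition nrm u := Num.sqrt (sqn u).

Lemma dotC u v : dot u v = dot v u.
Proof. by apply: eq_bigr => i _; rewrite mulrC. Qed.

Lemma dot_sqn u : dot u u = sqn u.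
Proof. by apply: eq_bigr => i _; rewrite expr2. Qed.

Lemma dot_lin u v w a b :
  dot u (fun i => a * v i + b * w i) = a * dot u v + b * dot u w.
Proof.
by rewrite /dot !mulr_sumr -big_split/=; apply: eq_bigr => i _; ring.
Qed.

Lemma dotB u v w : dot u (fun i => v i - w i) = dot u v - dot u w.
Proof. by rewrite /dot -sumrB; apply: eq_bigr => i _; ring. Qed.

Lemma dotD u v w : dot u (fun i => v i + w i) = dot u v + dot u w.
Proof. by rewrite /dot -big_split; apply: eq_bigr => i _ /=; ring. Qed.

Lemma dotZ u v a : dot u (fun i => a * v i) = a * dot u v.
Proof. by rewrite /dot mulr_sumr; apply: eq_bigr => i _; ring. Qed.

Lemma sqn_lin u v a b : sqn (fun i => a * u i + b * v i) =
  a ^+ 2 * sqn u + a * b * 2 * dot u v + b ^+ 2 * sqn v.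
Proof.
by rewrite /sqn /dot !mulr_sumr -!big_split/=; apply: eq_bigr => i _; ring.
Qed.

Lemma sqnB u v : sqn (fun i => u i - v i) = sqn u - 2 * dot u v + sqn v.
Proof.
rewrite /sqn /dot mulr_sumr -sumrB -big_split/=.
by apply: eq_bigr => i _; ring.
Qed.

Lemma sqnD u v : sqn (fun i => u i + v i) = sqn u + 2 * dot u v + sqn v.
Proof.
rewrite /sqn /dot mulr_sumr -!big_split/=.
by apply: eq_bigr => i _; ring.
Qed.

Lemma sqnZ u a : sqn (fun i => a * u i) = a ^+ 2 * sqn u.
Proof. by rewrite /sqn mulr_sumr; apply: eq_bigr => i _; ring. Qed.

Lemma dot_CS u v : dot u v ^+ 2 <= sqn u * sqn v.
Proof.
apply: quadratic_form_ge0; rewrite ?sqn_ge0// => s t.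
by rewrite -sqn_lin sqn_ge0.
Qed.

Lemma nrm_ge0 u : 0 <= nrm u. Proof. exact: sqrtr_ge0. Qed.

Lemma sqr_nrm u : nrm u ^+ 2 = sqn u. Proof. by rewrite sqr_sqrtr ?sqn_ge0. Qed.

Lemma nrm_le u a : 0 <= a -> (nrm u <= a) = (sqn u <= a ^+ 2).
Proof. by move=> a0; rewrite -sqr_nrm ler_sqr ?nnegrE// nrm_ge0. Qed.

Lemma nrm_gt u a : 0 <= a -> (a < nrm u) = (a ^+ 2 < sqn u).
Proof. by move=> a0; rewrite !ltNge nrm_le. Qed.

Lemma nrm_ge u a : 0 <= a -> (a <= nrm u) = (a ^+ 2 <= sqn u).
Proof. by move=> a0; rewrite -sqr_nrm ler_sqr ?nnegrE// nrm_ge0. Qed.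

Lemma dot_le_nrm u v : dot u v <= nrm u * nrm v.
Proof.
have [h|h] := leP (dot u v) 0; first by rewrite (le_trans h)// mulr_ge0// nrm_ge0.
rewrite -ler_sqr ?nnegrE ?(ltW h)// ?mulr_ge0 ?nrm_ge0//.
by rewrite exprMn !sqr_nrm dot_CS.
Qed.

Lemma nrm_triangle u v : nrm (fun i => u i + v i) <= nrm u + nrm v.
Proof.
rewrite nrm_le ?addr_ge0 ?nrm_ge0// sqnD -!sqr_nrm.
by have := dot_le_nrm u v; lra.
Qed.

Lemma nrmZ u a : 0 <= a -> nrm (fun i => a * u i) = a * nrm u.
Proof. by move=> a0; rewrite /nrm sqnZ sqrtrM ?sqr_ge0// sqrtr_sqr ger0_norm. Qed.

Lemma dot_norm_le u v : (forall i, `|u i| <= 1) -> `|dot u v| <= \sum_i `|v i|.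
Proof.
move=> u1; apply: (le_trans (ler_norm_sum _ _ _)); apply: ler_sum => i _.
by rewrite normrM ler_piMl.
Qed.

Lemma nrm_le_dim u : (forall i, `|u i| <= 1) -> nrm u <= d%:R.
Proof.
move=> u1; rewrite nrm_le//; apply: (@le_trans _ _ d%:R); last first.
  by case: d => [|k]; rewrite ?expr0n// expr2 ler_peMr// ler1n.
apply: (@le_trans _ _ (\sum_(i < d) 1)); last by rewrite sumr_const card_ord.
apply: ler_sum => i _; rewrite -real_normK ?num_real//.
by rewrite exprn_ile1.
Qed.

Lemma sqn_eq0 u : sqn u = 0 -> u = fun=> 0.
Proof.
move=> u0; apply/funext => i; apply/eqP; rewrite -sqrf_eq0 eq_le sqr_ge0 andbT.
by rewrite -u0 sqn_coord.
Qed.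

End dot_product.

Section support_body.
Context (R : realType) (d n : nat).
Implicit Types (u v w y z : 'I_d -> R) (x : 'I_n -> 'I_d -> R).

(* The closed convex set with support function the maximum of [r * nrm u] (if
   [b]) and of the [dot u (x i)] over the points [x i] satisfying [G]. *)
Definition gbody (b : bool) (G : ('I_d -> R) -> Prop) (r : R) x : set ('I_d -> R) :=
  [set y | forall u, (b /\ dot u y <= r * nrm u) \/
     exists i, G (x i) /\ dot u y <= dot u (x i)].

Lemma large_nat (g e : R) : 0 < g -> exists M : nat, forall m, (M <= m)%N -> e < m%:R * g.
Proof.
move=> g0; exists (Num.truncn (`|e| / g)).+1 => m Mm.
rewrite -ltr_pdivrMr//; apply: (@le_lt_trans _ _ (`|e| / g)).
  by rewrite ler_pM2r ?invr_gt0// ler_norm.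
apply: (lt_le_trans (truncnS_gt _)).
by rewrite ler_nat.
Qed.

(** Reduction to countably many directions, for measurability. A direction u violated by y remains
    violated after scaling by a large m and rounding to integers: the strict gaps grow like m, while
    rounding costs a bounded amount. *)
Lemma gbody_int b G r x y : 0 <= r -> gbody b G r x y <->
  forall k : {ffun 'I_d -> int}, let u := (fun j => (k j)%:~R) in
    (b /\ dot u y <= r * nrm u) \/ exists i, G (x i) /\ dot u y <= dot u (x i).
Proof.
move=> r0; split=> [H k|H u]; first exact: H.
apply: contrapT => /not_orP[nb ni].
have hb : exists M : nat, forall m, (M <= m)%N ->
   ~~ b \/ \sum_j `|y j| + r * d%:R < m%:R * (dot u y - r * nrm u).
  have [bt|bf] := boolP b; last by exists 0%N => m _; left.
  have g0 : 0 < dot u y - r * nrm u.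
    by rewrite subr_gt0 ltNge; apply/negP => h; apply: nb.
  have [M HM] := large_nat (\sum_j `|y j| + r * d%:R) g0.
  by exists M => m /HM; right.
have hi i : exists M : nat, forall m, (M <= m)%N ->
   ~ G (x i) \/ \sum_j `|y j - x i j| < m%:R * (dot u y - dot u (x i)).
  have [Gi|nG] := pselect (G (x i)); last by exists 0%N => m _; left.
  have g0 : 0 < dot u y - dot u (x i).
    by rewrite subr_gt0 ltNge; apply/negP => h; apply: ni; exists i.
  have [M HM] := large_nat (\sum_j `|y j - x i j|) g0.
  by exists M => m /HM; right.
have [M0 HM0] := hb.
have [M HM] := choice hi.
pose m := (M0 + \sum_i M i)%N.
pose k := [ffun j => Num.floor (m%:R * u j)].
pose u' (j : 'I_d) : R := (k j)%:~R.
pose e j := u' j - m%:R * u j.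
have e1 j : `|e j| <= 1.
  rewrite /e /u' ffunE.
  have := floor_itv (m%:R * u j) => /andP[h1 h2].
  by rewrite intrD in h2; rewrite ler_norml; lra.
have u'E : u' = fun j => m%:R * u j + e j.
  by apply/funext => j; rewrite /e; ring.
have dE v : dot u' v = m%:R * dot u v + dot e v.
  by rewrite u'E dotC dotD dotZ dotC (dotC v e).
have := H k; rewrite -/u' => -[[bt]|[i [Gi]]].
  case: (HM0 m (leq_addr _ _)) => [|h]; first by rewrite bt.
  rewrite dE => h2.
  have h3 : nrm u' <= m%:R * nrm u + d%:R.
    rewrite u'E; apply: (le_trans (nrm_triangle _ _)).
    by rewrite nrmZ// lerD2l nrm_le_dim.
  have h4 := dot_norm_le y e1; rewrite ler_norml in h4.
  have h5 : r * nrm u' <= r * (m%:R * nrm u + d%:R) by rewrite ler_wpM2l.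
  case/andP: h4 => h4 _.
  by nra.
have Mm : (M i <= m)%N.
  by rewrite /m (bigD1 i)//= addnCA leq_addr.
case: (HM i m Mm) => [//|h]; rewrite !dE.
have := dot_norm_le (fun j => y j - x i j) e1; rewrite dotB ler_norml => /andP[h4 _] h2.
by nra.
Qed.

Definition body (r R0 : R) := gbody true (fun v => sqn v <= R0 ^+ 2) r.
Definition hull := gbody false (fun=> True) 0.

(** Test the support condition in the direction u = y. *)
Lemma body_sub_ball r R0 x y : 0 <= r <= R0 -> body r R0 x y -> sqn y <= R0 ^+ 2.
Proof.
move=> /andP[r0 rR] H; have R00 : 0 <= R0 by exact: le_trans rR.
rewrite -nrm_le//.
have : nrm y ^+ 2 <= R0 * nrm y.
  rewrite sqr_nrm -dot_sqn; case: (H y) => [[_ h]|[i [Gi h]]].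
    by rewrite (le_trans h)// ler_wpM2r// nrm_ge0.
  rewrite (le_trans h)// (le_trans (dot_le_nrm _ _))// mulrC ler_wpM2r ?nrm_ge0//.
  by rewrite nrm_le.
have := nrm_ge0 y; rewrite le_eqVlt => /predU1P[<-//|n0].
by rewrite expr2 ler_pM2r.
Qed.

(** In a direction where y leaves the body of x', the ball and the common points fail for x as well,
    so the changed point x_j must be what supports y. *)
Lemma body_diff r R0 x x' y j : (forall i, i != j -> x i = x' i) ->
  body r R0 x y -> ~ body r R0 x' y ->
  exists u, [/\ r * nrm u < dot u y, dot u y <= dot u (x j) & sqn (x j) <= R0 ^+ 2].
Proof.
move=> xx' H /existsNP[u /not_orP[nb ni]]; exists u.
have h1 : r * nrm u < dot u y by rewrite ltNge; apply/negP => h; apply: nb.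
case: (H u) => [[_]|[i [Gi hi]]]; first by rewrite leNgt h1.
have [ij|ij] := eqVneq i j; first by rewrite -ij.
by exfalso; apply: ni; exists i; rewrite -xx'.
Qed.

(** A point at the origin supports only the value 0, which the ball already covers in every
    direction. *)
Lemma body_del r R0 x x' j : 0 <= r -> (forall i, i != j -> x i = x' i) ->
  x' j = (fun=> 0) -> body r R0 x' `<=` body r R0 x.
Proof.
move=> r0 xx' xj y H u; case: (H u) => [|[i [Gi hi]]]; first by left.
have [ij|ij] := eqVneq i j; last by right; exists i; rewrite xx'.
left; split=> //; apply: (le_trans hi); rewrite ij xj.
by rewrite /dot big1 ?mulr_ge0 ?nrm_ge0// => i' _; rewrite mulr0.
Qed.

(** Parallelogram identity: both points lie beyond height r in the direction u, so |y + z| >= 2 r,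
    while |y|, |z| <= R0. *)
Lemma cap_close r R0 u y z : 0 <= r -> r * nrm u < dot u y -> r * nrm u < dot u z ->
  sqn y <= R0 ^+ 2 -> sqn z <= R0 ^+ 2 ->
  sqn (fun i => y i - z i) <= 4 * (R0 ^+ 2 - r ^+ 2).
Proof.
move=> r0 uy uz yR zR.
have hD : 4 * r ^+ 2 <= sqn (fun i => y i + z i).
  have n0 : 0 < nrm u.
    rewrite lt_neqAle nrm_ge0 andbT eq_sym; apply/negP => /eqP n0.
    have /sqn_eq0 u0 : sqn u = 0 by rewrite -sqr_nrm n0 expr0n.
    by move: uy; rewrite n0 u0 /dot big1 ?mulr0 ?ltxx// => i _; rewrite mul0r.
  have -> : 4 * r ^+ 2 = (2 * r) ^+ 2 by ring.
  rewrite -nrm_ge ?mulr_ge0// -(ler_pM2r n0).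
  have := dot_le_nrm u (fun i => y i + z i); rewrite dotD; lra.
by move: hD; rewrite sqnB sqnD; lra.
Qed.

Lemma cap_outside r u y : 0 <= r -> r * nrm u < dot u y -> r ^+ 2 < sqn y.
Proof.
move=> r0 uy; rewrite -nrm_gt//.
have h := lt_le_trans uy (dot_le_nrm u y).
rewrite ltNge; apply/negP => yr; move: h; rewrite ltNge => /negP; apply.
by rewrite mulrC ler_wpM2r ?nrm_ge0.
Qed.

End support_body.

(** * The support description of the convex hull *)

Section separation.
Context (R : realType) (d n : nat).
Implicit Types (u y : 'I_d -> R) (x : 'I_n -> 'I_d -> R).

Lemma continuous_sum (T : topologicalType) (I : Type) (s : seq I) (F : I -> T -> R) :
  (forall i, continuous (F i)) -> continuous (fun M => \sum_(i <- s) F i M).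
Proof.
move=> cF M; rewrite /continuous_at; elim: s => [|i s IH].
  by under eq_cvg do rewrite big_nil; rewrite big_nil; exact: cvg_cst.
under eq_cvg do rewrite big_cons; rewrite big_cons.
by apply: cvgD => //; exact: cF.
Qed.

Lemma continuous_row_sum (f : 'I_n -> R) :
  continuous (fun M : 'rV[R]_n => \sum_i M ord0 i * f i).
Proof.
apply: continuous_sum => i M.
apply: (@cvgM _ _ (nbhs M) _ (fun M : 'rV[R]_n => M ord0 i) (fun=> f i)).
  exact: coord_continuous.
exact: cst_continuous.
Qed.

Definition simplex : set 'rV[R]_n :=
  [set M | (forall i, M ord0 i \in `[0, 1]) /\ \sum_i M ord0 i * 1 = 1].

Lemma compact_simplex : compact simplex.
Proof.
have -> : simplex = [set M : 'rV[R]_n | forall i, `[0, 1]%classic (M ord0 i)] `&`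
    ((fun M : 'rV[R]_n => \sum_i M ord0 i * 1) @^-1` [set x | x = 1]) by [].
apply: compact_closedI.
  exact: (@rV_compact R n (fun=> `[0, 1]%classic) (fun=> @segment_compact _ _ _)).
apply: preimage_closed; first by move=> M _; exact: continuous_row_sum.
exact: closed_eq.
Qed.

(** A convex combination cannot strictly exceed all its points in some direction. Conversely, if y
    is not in the hull, the vector from its nearest hull point to y is a direction in which y
    exceeds every point. *)
Lemma hullE x y : hull x y <-> conv_hull x y.
Proof.
split; last first.
  move=> [lam [lam0 [lam1 yE]]] u; right; apply: contrapT => H.
  have Hi i : dot u (x i) < dot u y.
    by rewrite ltNge; apply/negP => h; apply: H; exists i.
  have : dot u y = \sum_i lam i * dot u (x i).
    rewrite /dot; under [RHS]eq_bigr do rewrite mulr_sumr.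
    rewrite exchange_big/=; apply: eq_bigr => j _; rewrite yE mulr_sumr.
    by apply: eq_bigr => i _; ring.
  suff : \sum_i lam i * dot u (x i) < dot u y by move=> /[swap] <-; rewrite ltxx.
  have -> : dot u y = \sum_i lam i * dot u y by rewrite -mulr_suml lam1 mul1r.
  have [i li] : exists i, 0 < lam i.
    apply: contrapT => H0; have : \sum_i lam i = 0.
      apply: big1 => i _; apply/eqP; rewrite eq_le lam0 andbT leNgt.
      by apply/negP => h; apply: H0; exists i.
    by rewrite lam1 => /eqP; rewrite oner_eq0.
  rewrite (bigD1 i)//= [ltRHS](bigD1 i)//=; apply: ltr_leD.
    by rewrite ltr_pM2l.
  by apply: ler_sum => j _; rewrite ler_wpM2l// ltW.
move=> H.
(* Squared distance from y to the combination with coefficients M, minimised over the compact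
   simplex. *)
pose g (M : 'rV[R]_n) := sqn (fun j => y j - \sum_i M ord0 i * x i j).
have cg : continuous g.
  apply: continuous_sum => j M.
  have h : (fun M : 'rV[R]_n => y j - \sum_i M ord0 i * x i j) @ M -->
      y j - \sum_i M ord0 i * x i j.
    apply: (@cvgB _ _ _ (nbhs M) _ (fun=> y j)); first exact: cst_continuous.
    exact: continuous_row_sum.
  rewrite /continuous_at; under eq_cvg do rewrite expr2; rewrite expr2.
  exact: (@cvgM _ _ (nbhs M) _ (fun M : 'rV[R]_n => y j - \sum_i M ord0 i * x i j) _ _ _ h h).
have [i0 _] : exists i : 'I_n, True.
  by case: (H (fun=> 0)) => [[]//|[i _]]; exists i.
have s0 : simplex !=set0.
  exists (\row_i (i == i0)%:R); split=> [i|].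
    by rewrite mxE in_itv/=; case: (i == i0); rewrite ?lexx ?ler01.
  rewrite (bigD1 i0)//= big1 ?mxE ?eqxx ?mulr1 ?addr0//.
  by move=> i /negbTE ii; rewrite mxE ii mul0r.
have [M0 + Mmin] := EVT_min_rV s0 compact_simplex (continuous_subspaceT cg).
rewrite inE => -[M01 M0s].
pose z j := \sum_i M0 ord0 i * x i j.
pose w j := y j - z j.
have M0i i : 0 <= M0 ord0 i <= 1 by have := M01 i; rewrite in_itv.
have M0s' : \sum_i M0 ord0 i = 1 by rewrite -M0s; apply: eq_bigr => i _; rewrite mulr1.
have [w0|w0] := eqVneq (sqn w) 0.
  exists (fun i => M0 ord0 i); split; first by move=> i; case/andP: (M0i i).
  split=> // j; have := congr1 (fun f => f j) (sqn_eq0 w0).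
  by rewrite /w => /eqP; rewrite subr_eq0 => /eqP.
have wgt0 : 0 < sqn w by rewrite lt_neqAle eq_sym w0 sqn_ge0.
have key i : dot w (x i) <= dot w z.
  rewrite leNgt; apply/negP => hi.
  pose e k := x i k - z k.
  have de : 0 < dot w e by rewrite /e dotB subr_gt0.
  (* A step of length t from z towards x_i stays in the hull and changes the squared distance by - t
     (2 w.e - t |e|^2) < 0. *)
  pose t := Num.min 1 (dot w e / (sqn e + 1)).
  have e1 : 0 < sqn e + 1 by rewrite ltr_wpDl// sqn_ge0.
  have t0 : 0 < t by rewrite lt_min ltr01 divr_gt0.
  have t1 : t <= 1 by rewrite ge_min lexx.
  have t2 : t * (sqn e + 1) <= dot w e.
    by rewrite -ler_pdivlMr// ge_min lexx orbT.
  pose M1 : 'rV[R]_n := \row_k ((1 - t) * M0 ord0 k + t * (k == i)%:R).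
  have M1s : simplex M1.
    split=> [k|].
      rewrite mxE in_itv/=; have := M0i k => /andP[a b].
      by case: (k == i) => /=; apply/andP; split; nra.
    transitivity ((1 - t) * (\sum_k M0 ord0 k) + t * (\sum_k (k == i)%:R)).
      rewrite !mulr_sumr -big_split/=; apply: eq_bigr => k _; rewrite mxE; ring.
    rewrite M0s' (bigD1 i)//= eqxx big1 ?addr0; last by move=> k /negbTE ->.
    by rewrite /= !mulr1 subrK.
  have gM1 : g M1 = sqn (fun k => w k - t * e k).
    rewrite /g; congr sqn; apply/funext => k; rewrite /w.
    have -> : \sum_j M1 ord0 j * x j k = (1 - t) * z k + t * x i k.
      transitivity ((1 - t) * (\sum_j M0 ord0 j * x j k) +
          t * (\sum_j (j == i)%:R * x j k)).
        rewrite !mulr_sumr -big_split/=; apply: eq_bigr => j _; rewrite mxE; ring.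
      rewrite [X in _ + t * X](bigD1 i)//= eqxx mul1r [X in x i k + X]big1 ?addr0//.
      by move=> j /negbTE ->; rewrite mul0r.
    by rewrite /e; ring.
  have := Mmin M1 (mem_set M1s).
  rewrite gM1 -/(sqn w) leNgt => /negP; apply.
  have -> : sqn (fun k => w k - t * e k) = sqn w - t * (2 * dot w e - t * sqn e).
    by rewrite sqnB dotZ sqnZ; ring.
  have se := sqn_ge0 e.
  rewrite gtrBl mulr_gt0// subr_gt0.
  by nra.
exfalso; case: (H w) => [[]//|[i [_]]].
apply/negP; rewrite -ltNge; apply: (le_lt_trans (key i)).
rewrite -subr_gt0 -dotB -/w.
by rewrite (_ : dot w _ = sqn w)// -dot_sqn.
Qed.

End separation.

(** * Measurability of the support bodies *)

Section measurable_body.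
Context (R : realType) (d n : nat).
Local Notation B := (measurableTypeR R).
Local Notation Pt := (d.-tuple B).
Local Notation Om := (n.-tuple Pt).
Variables (b : bool) (G : ('I_d -> R) -> Prop) (r : R).
Hypothesis r0 : 0 <= r.
Hypothesis mG : measurable [set y : Pt | G (vec y)].

Lemma measurable_dot d' (T : measurableType d') (u : 'I_d -> R) (f : T -> Pt) :
  measurable_fun setT f -> measurable_fun setT (fun p => dot u (vec (f p))).
Proof.
move=> mf; apply: measurable_sum => i; apply: measurable_funM => //.
exact: (measurableT_comp (measurable_vec i) mf).
Qed.

Lemma measurable_gbody :
  measurable [set p : Om * Pt | gbody b G r (cfg p.1) (vec p.2)].
Proof.
pose S (k : {ffun 'I_d -> int}) : set (Om * Pt) :=
  let u := (fun j => (k j)%:~R) in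
  [set p | b /\ dot u (vec p.2) <= r * nrm u] `|`
  \bigcup_(i in [set: 'I_n]) ([set p | G (vec (tnth p.1 i))] `&`
     [set p | dot u (vec p.2) <= dot u (vec (tnth p.1 i))]).
have mS k : measurable (S k).
  have m2 := measurable_dot (fun j => (k j)%:~R) (@measurable_snd _ _ Om Pt).
  have m1 i := measurable_dot (fun j => (k j)%:~R)
    (measurableT_comp (measurable_tnth i) (@measurable_fst _ _ Om Pt)).
  apply: measurableU.
    case: b; last first.
      rewrite (_ : [set p | _] = set0)//.
      by apply/seteqP; split => p //= [].
    have := @measurable_fun_ler _ _ _ setT _ _ m2
      (@measurable_cst _ _ _ _ setT (r * nrm (fun j => (k j)%:~R))).
    move=> /(_ measurableT [set true] I); rewrite setTI.
    by congr measurable; apply/seteqP; split => p /=; [split|case].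
  apply: fin_bigcup_measurable => [|i _]; first exact: finite_finset.
  apply: measurableI.
    have := measurableT_comp (measurable_tnth i) (@measurable_fst _ _ Om Pt).
    by move=> /(_ measurableT _ mG); rewrite setTI.
  have := @measurable_fun_ler _ _ _ setT _ _ m2 (m1 i).
  move=> /(_ measurableT [set true] I); rewrite setTI.
  by congr measurable; apply/seteqP; split.
(* By [gbody_int] a countable intersection over integer directions; numbers coding no direction
   contribute the whole space. *)
rewrite (_ : [set p | _] = \bigcap_m
   (if @unpickle {ffun 'I_d -> int} m is Some k then S k else setT)).
  by apply: bigcapT_measurable => m; case: unpickle.
apply/seteqP; split => p /=.
  move=> /(gbody_int _ _ _ _ r0) H m _; case: unpickle => // k.
  by case: (H k) => [h|[i [h1 h2]]]; [left|right; exists i].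
move=> H; apply/(gbody_int _ _ _ _ r0) => k.
have := H (pickle k) I; rewrite pickleK => -[h|[i _ [h1 h2]]]; first by left.
by right; exists i.
Qed.

Lemma measurable_gbody_slice (x : Om) : measurable [set y : Pt | gbody b G r (cfg x) (vec y)].
Proof.
have := measurable_xsection x measurable_gbody.
by congr measurable; apply/seteqP; split => y; rewrite /xsection/= inE.
Qed.

End measurable_body.

(** * Volumes of shells, slabs and caps *)

Lemma le_of_sqr (R : realDomainType) (a b : R) : 0 <= b -> a ^+ 2 <= b ^+ 2 -> a <= b.
Proof. by move=> b0; rewrite leNgt => h; apply/negP => ba; move: h; nra. Qed.

Section region_volumes.
Context (R : realType) (d : nat).
Hypothesis d_gt0 : (0 < d)%N.
Local Notation B := (measurableTypeR R).
Local Notation Pt := (d.-tuple B).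

Let d1 : 1 <= d%:R :> R. Proof. by rewrite ler1n. Qed.
Let d0 : 0 < d%:R :> R. Proof. by rewrite ltr0n. Qed.

Lemma measurable_le_fun d' (T : measurableType d') (f g : T -> R) :
  measurable_fun setT f -> measurable_fun setT g -> measurable [set x | f x <= g x].
Proof.
move=> mf mg; have := @measurable_fun_ler _ _ _ setT _ _ mf mg.
by move=> /(_ measurableT [set true] I); rewrite setTI.
Qed.

Lemma measurable_lt_fun d' (T : measurableType d') (f g : T -> R) :
  measurable_fun setT f -> measurable_fun setT g -> measurable [set x | f x < g x].
Proof.
move=> mf mg; have := @measurable_fun_ltr _ _ _ setT _ _ mf mg.
by move=> /(_ measurableT [set true] I); rewrite setTI.
Qed.

Definition shell (r R0 : R) : set Pt := [set y | r ^+ 2 < sqn (vec y) <= R0 ^+ 2].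

Lemma measurable_shell r R0 : measurable (shell r R0).
Proof.
rewrite (_ : shell r R0 = [set y | r ^+ 2 < sqn (vec y)] `&`
   [set y | sqn (vec y) <= R0 ^+ 2]); last first.
  by apply/seteqP; split => y /=; rewrite /shell/= => /andP.
apply: measurableI; [apply: measurable_lt_fun|apply: measurable_le_fun] => //;
  exact: measurable_sqn.
Qed.

Definition cube (c : 'I_d -> R) (rho : R) : set Pt :=
  [set y | forall i, `|vec y i - c i| <= rho].

Lemma measurable_cube c rho : measurable (cube c rho).
Proof.
rewrite (_ : cube c rho = \bigcap_(i in [set: 'I_d]) [set y | `|vec y i - c i| <= rho]).
  apply: fin_bigcap_measurable => [|i _]; first exact: finite_finset.
  apply: measurable_le_fun => //; apply: measurableT_comp => //.
  by apply: measurable_funB => //; exact: measurable_vec.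
by apply/seteqP; split => y /= h i; [move=> _|]; exact: h.
Qed.

Lemma sqn_upd (y : Pt) i t :
  sqn (vec (upd y i t)) = t ^+ 2 + \sum_(j | j != i) vec y j ^+ 2.
Proof.
rewrite /sqn (bigD1 i)//= vec_upd eqxx; congr (_ + _).
by apply: eq_bigr => j ji; rewrite vec_upd (negbTE ji).
Qed.

Lemma large_coord (v : 'I_d -> R) : exists i, sqn v <= d%:R * v i ^+ 2.
Proof.
apply: contrapT => H.
have H' i : d%:R * v i ^+ 2 < sqn v.
  by rewrite ltNge; apply/negP => h; apply: H; exists i.
have : \sum_(i < d) d%:R * v i ^+ 2 < \sum_(i < d) sqn v.
  rewrite (bigD1 (Ordinal d_gt0))//= [ltRHS](bigD1 (Ordinal d_gt0))//=.
  by apply: ltr_leD => //; apply: ler_sum => j _; exact: ltW.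
by rewrite -mulr_sumr sum_cst_ord ltxx.
Qed.

(** Split by a coordinate with |t| >= r / d. Along it t^2 ranges over an interval of length at most
    R0^2 - r^2, so t lies in two intervals, each of length at most d (R0^2 - r^2) / r. *)
Lemma shell_cube_vol c (r R0 rho : R) : 0 < r -> r <= R0 -> 0 <= rho ->
  vol (shell r R0 `&` cube c rho) <=
  d%:R * ((2 * rho) ^+ d.-1 * (2 * d%:R * (R0 ^+ 2 - r ^+ 2) / r)).
Proof.
move=> r0 rR rho0.
have R00 : 0 <= R0 by apply: le_trans rR; exact: ltW.
have RR : 0 <= R0 ^+ 2 - r ^+ 2 by rewrite subr_ge0 ler_sqr ?nnegrE// ltW.
pose A := shell r R0 `&` cube c rho.
pose A' i := A `&` [set y : Pt | sqn (vec y) <= d%:R * vec y i ^+ 2].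
have mA : measurable A.
  by apply: measurableI; [exact: measurable_shell|exact: measurable_cube].
have mA' i : measurable (A' i).
  apply: measurableI => //; apply: measurable_le_fun; first exact: measurable_sqn.
  by apply: measurable_funM => //; apply: measurable_funX; exact: measurable_vec.
have bA : sqn_bounded A by exists (R0 ^+ 2) => y [/andP[]].
have bA' i : sqn_bounded (A' i) by apply: bounded_subset bA; exact: subIsetl.
apply: (le_trans (vol_cover mA bA mA' bA' _)).
  by move=> y Ay; have [i hi] := large_coord (vec y); exists i.
rewrite -sum_cst_ord; apply: ler_sum => i _.
apply: (@vol_slice_le _ _ (A' i) i c rho) => // y.
pose S := \sum_(j | j != i) vec y j ^+ 2.
have box t : A' i (upd y i t) -> forall j, j != i -> `|vec y j - c j| <= rho.
  by move=> [[_ h] _] j ji; have := h j; rewrite vec_upd (negbTE ji).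
(* Lower bound for t^2: the first entry comes from the shell, the second keeps t away from 0. If it
   exceeds R0^2 - S the section is empty. *)
pose m := Num.max (r ^+ 2 - S) ((r / d%:R) ^+ 2).
have k0 : 0 <= 2 * d%:R * (R0 ^+ 2 - r ^+ 2) / r.
  by rewrite !mulr_ge0// invr_ge0 ltW.
have mt t : A' i (upd y i t) -> m <= t ^+ 2 <= R0 ^+ 2 - S.
  move=> [[/andP[h1 h2] _]] /=; rewrite sqn_upd vec_upd eqxx -/S in h1 h2 *.
  move=> h3; rewrite /m ge_max; apply/andP; split; last by lra.
  apply/andP; split; first by lra.
  have h4 : r ^+ 2 <= d%:R * t ^+ 2 by lra.
  rewrite exprMn exprVn ler_pdivrMr ?exprn_gt0//.
  apply: (le_trans h4); rewrite mulrC ler_wpM2l ?sqr_ge0// expr2.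
  by rewrite ler_peMr// ltW.
have m0 : 0 < m by rewrite lt_max exprn_gt0 ?divr_gt0// orbT.
have [le_m|lt_m] := leP m (R0 ^+ 2 - S); last first.
  exists 0, 0, 0, 0; split; rewrite ?subrr ?addr0// => t At; exfalso.
  by have /andP[h1 h2] := mt t At; have := le_lt_trans (le_trans h1 h2) lt_m; rewrite ltxx.
have R1 : 0 <= R0 ^+ 2 - S by exact: le_trans (ltW m0) le_m.
pose al := Num.sqrt m; pose be := Num.sqrt (R0 ^+ 2 - S).
have al0 : 0 < al by rewrite sqrtr_gt0.
have be0 : 0 <= be by exact: sqrtr_ge0.
have al2 : al ^+ 2 = m by rewrite sqr_sqrtr// ltW.
have be2 : be ^+ 2 = R0 ^+ 2 - S by rewrite sqr_sqrtr.
have ab : al <= be by apply: le_of_sqr => //; rewrite al2 be2.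
exists al, be, (- be), (- al); split => //; first by rewrite lerN2.
  have ald : r / d%:R <= al.
    by apply: le_of_sqr; [exact: ltW|rewrite al2 le_max lexx orbT].
  have d2 : be ^+ 2 - al ^+ 2 <= R0 ^+ 2 - r ^+ 2.
    have : r ^+ 2 - S <= al ^+ 2 by rewrite al2 le_max lexx.
    by rewrite be2; lra.
  rewrite ler_pdivlMr//.
  have h : (be - al) * (r / d%:R) <= R0 ^+ 2 - r ^+ 2.
    apply: (le_trans _ d2); rewrite subr_sqr ler_wpM2l ?subr_ge0//.
    by rewrite (le_trans ald)// lerDr.
  rewrite mulrA ler_pdivrMr// in h.
  have -> : (be - al + (- al - - be)) * r = 2 * ((be - al) * r) by ring.
  have -> : 2 * d%:R * (R0 ^+ 2 - r ^+ 2) = 2 * ((R0 ^+ 2 - r ^+ 2) * d%:R) by ring.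
  by rewrite ler_wpM2l.
move=> t At; split; first exact: box At.
have /andP[h1 h2] := mt t At.
have [t0|t0] := leP 0 t.
  apply/orP; left; apply/andP; split.
    by rewrite -ler_sqr ?nnegrE ?(ltW al0)// al2.
  by rewrite -ler_sqr ?nnegrE// be2.
apply/orP; right; apply/andP; split.
  by rewrite lerNl; apply: le_of_sqr => //; rewrite sqrrN be2.
rewrite lerNr; apply: le_of_sqr; first by rewrite oppr_ge0 ltW.
by rewrite sqrrN al2.
Qed.

Lemma measurable_dot_vec (u : 'I_d -> R) : measurable_fun setT (fun y : Pt => dot u (vec y)).
Proof.
by apply: measurable_sum => i; apply: measurable_funM => //; exact: measurable_vec.
Qed.

Definition slab (u : 'I_d -> R) (h k rho : R) : set Pt :=
  [set z | h <= dot u (vec z) <= h + k /\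
     sqn (fun j => vec z j - h * u j) <= rho ^+ 2].

Lemma measurable_slab u h k rho : measurable (slab u h k rho).
Proof.
rewrite (_ : slab u h k rho = [set z | h <= dot u (vec z)] `&`
   [set z | dot u (vec z) <= h + k] `&`
   [set z | sqn (fun j => vec z j - h * u j) <= rho ^+ 2]); last first.
  apply/seteqP; split => z /=; first by move=> [/andP[h1 h2] h3]; split.
  by move=> [[h1 h2] h3]; split => //; apply/andP.
apply: measurableI; first apply: measurableI.
- by apply: measurable_le_fun => //; exact: measurable_dot_vec.
- by apply: measurable_le_fun => //; exact: measurable_dot_vec.
apply: measurable_le_fun => //; apply: measurable_sum => i; apply: measurable_funX.
by apply: measurable_funB => //; exact: measurable_vec.
Qed.

Lemma bounded_slab u h k rho : sqn u = 1 -> sqn_bounded (slab u h k rho).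
Proof.
move=> u1; exists (2 * rho ^+ 2 + 2 * h ^+ 2) => z [_ hz].
set v := (fun j => vec z j - h * u j) in hz.
have -> : vec z = (fun j => v j + h * u j).
  by apply/funext => j; rewrite /v subrK.
have := sqn_ge0 (fun j => v j - h * u j).
by rewrite sqnB sqnD sqnZ u1; lra.
Qed.

(** Slice along a coordinate with |u_i| >= 1/d. The displacement there is solved from the height,
    which gives d (1 + d) rho; one more factor d passes from coordinates to the norm. *)
Lemma slab_vol u (h k rho : R) : sqn u = 1 -> 0 <= k -> k <= rho ->
  (2 * rho) ^+ d.-1 * k <= vol (slab u h k (d%:R ^+ 2 * (1 + d%:R) * rho)).
Proof.
move=> u1 k0 krho; have rho0 : 0 <= rho by exact: le_trans krho.
have [i hi] := large_coord u; rewrite u1 in hi.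
have uj j : `|u j| <= 1.
  rewrite -(@expr_le1 _ 2)// real_normK ?num_real// -u1; exact: sqn_coord.
have ui : 1 <= d%:R * `|u i|.
  apply: le_of_sqr; first by rewrite mulr_ge0// ltW.
  rewrite expr1n exprMn real_normK ?num_real//.
  apply: (le_trans hi); rewrite ler_wpM2r ?sqr_ge0// expr2.
  by rewrite ler_peMr// ltW.
have ui0 : u i != 0.
  by apply/eqP => u0; move: ui; rewrite u0 normr0 mulr0 ler10.
apply: (@vol_slice_ge _ _ _ i (fun j => h * u j)) => //.
- exact: measurable_slab.
- exact: bounded_slab.
move=> y hb; pose s := \sum_(j | j != i) u j * vec y j.
have dU t : dot u (vec (upd y i t)) = u i * t + s.
  rewrite /dot (bigD1 i)//= vec_upd eqxx; congr (_ + _).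
  by apply: eq_bigr => j ji; rewrite vec_upd (negbTE ji).
(* The value of the i-th coordinate at which the height is in the middle of the slab. *)
pose c := (h + k / 2 - s) / u i.
exists (c - k / 2), (c + k / 2); split; [by lra|by lra|].
move=> t ht; have tc : `|t - c| <= k / 2 by rewrite ler_norml; lra.
have h1 : `|dot u (vec (upd y i t)) - (h + k / 2)| <= k / 2.
  have -> : dot u (vec (upd y i t)) - (h + k / 2) = u i * (t - c).
    by rewrite dU /c mulrBr (mulrC (u i) (_ / _)) divfK//; ring.
  by rewrite normrM; apply: (le_trans _ tc); rewrite ler_piMl.
have h2 : h <= dot u (vec (upd y i t)) <= h + k.
  by move: h1; rewrite ler_norml; lra.
split=> //.
set v := fun j => _.
have dv : dot u v = dot u (vec (upd y i t)) - h.
  by rewrite /v dotB dotZ dot_sqn u1 mulr1.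
have vj j : j != i -> `|v j| <= rho.
  by move=> ji; rewrite /v vec_upd (negbTE ji); exact: hb.
have vi : `|v i| <= d%:R * (1 + d%:R) * rho.
  have e : u i * v i = dot u v - \sum_(j | j != i) u j * v j.
    by rewrite /dot (bigD1 i)//= addrK.
  have n1 : `|u i * v i| <= (1 + d%:R) * rho.
    rewrite e mulrDl mul1r; apply: (le_trans (ler_normB _ _)); apply: lerD.
      by rewrite dv ler_norml; move: h2; lra.
    apply: (le_trans (ler_norm_sum _ _ _)).
    apply: (@le_trans _ _ (\sum_(j < d) rho)); last by rewrite sum_cst_ord.
    rewrite [leRHS](bigD1 i)//= ler_wpDl//.
    apply: ler_sum => j ji; rewrite normrM -[leRHS]mul1r.
    by apply: ler_pM => //; exact: vj.
  rewrite normrM in n1.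
  apply: (@le_trans _ _ (d%:R * `|u i| * `|v i|)); first by rewrite ler_peMl.
  by rewrite -!mulrA ler_wpM2l// ?mulrA// ltW.
have vall j : `|v j| <= d%:R * (1 + d%:R) * rho.
  have [->//|ji] := eqVneq j i.
  apply: (le_trans (vj _ ji)); rewrite -[leLHS]mul1r; apply: ler_wpM2r => //.
  by move: d1; generalize (d%:R : R) => D D1; nra.
rewrite /sqn; apply: (@le_trans _ _ (\sum_(j < d) (d%:R * (1 + d%:R) * rho) ^+ 2)).
  apply: ler_sum => j _; rewrite -real_normK ?num_real// ler_sqr ?nnegrE//.
  by rewrite !mulr_ge0// ?addr_ge0// ltW.
rewrite sum_cst_ord.
have -> : (d%:R ^+ 2 * (1 + d%:R) * rho) ^+ 2 =
   d%:R ^+ 2 * (d%:R * (1 + d%:R) * rho) ^+ 2 :> R by ring.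
by rewrite ler_wpM2r ?sqr_ge0// expr2 ler_peMr// ltW.
Qed.

(** Thickness 1/a is the scale on which exp(- |y|^2 / 2) changes by a bounded factor; the distance
    1/a from radius a leaves room for a cone above height a. *)
Definition outer (a : R) : set Pt :=
  [set y | (a + a^-1) ^+ 2 <= sqn (vec y) <= (a + 2 / a) ^+ 2].

Lemma measurable_outer a : measurable (outer a).
Proof.
rewrite (_ : outer a = [set y | (a + a^-1) ^+ 2 <= sqn (vec y)] `&`
   [set y | sqn (vec y) <= (a + 2 / a) ^+ 2]); last first.
  by apply/seteqP; split => y /=; rewrite /outer/= => /andP.
apply: measurableI; apply: measurable_le_fun => //; exact: measurable_sqn.
Qed.

Lemma outer_vol a : 2 <= a -> (a / d%:R) ^+ d.-1 * (2 * a)^-1 <= vol (outer a).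
Proof.
move=> a2; have a0 : 0 < a by lra.
have ai : a * a^-1 = 1 by rewrite divff// gt_eqF.
have ai0 : 0 < a^-1 by rewrite invr_gt0.
have ai1 : a^-1 <= 2^-1 by rewrite lef_pV2 ?posrE.
(* Makes the other coordinates contribute at most a^2 / 4, so that the section runs between square
   roots of positive numbers. *)
pose rho := a / (2 * d%:R).
have -> : a / d%:R = 2 * rho.
  by rewrite /rho; field; rewrite gt_eqF.
have rho0 : 0 <= rho by rewrite /rho divr_ge0// ?ltW// mulr_gt0.
apply: (@vol_slice_ge _ _ _ (Ordinal d_gt0) (fun=> 0)) => //.
- exact: measurable_outer.
- by exists ((a + 2 / a) ^+ 2) => y /andP[].
move=> y hb; pose S := \sum_(j | j != Ordinal d_gt0) vec y j ^+ 2.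
have S0 : 0 <= S by apply: sumr_ge0 => j _; exact: sqr_ge0.
have Sa : S <= a ^+ 2 / 4.
  apply: (@le_trans _ _ (\sum_(j < d) rho ^+ 2)).
    rewrite [leRHS](bigD1 (Ordinal d_gt0))//= ler_wpDl ?sqr_ge0//.
    apply: ler_sum => j ji; rewrite -real_normK ?num_real// ler_sqr ?nnegrE//.
    by have := hb j ji; rewrite subr0.
  rewrite sum_cst_ord /rho.
  have -> : d%:R * (a / (2 * d%:R)) ^+ 2 = a ^+ 2 / 4 * d%:R^-1 :> R.
    by field; rewrite gt_eqF.
  by rewrite ler_piMr ?divr_ge0 ?sqr_ge0// invf_le1.
pose al := Num.sqrt ((a + a^-1) ^+ 2 - S); pose be := Num.sqrt ((a + 2 / a) ^+ 2 - S).
have e1 : (a + a^-1) ^+ 2 = a ^+ 2 + 2 + a^-1 ^+ 2.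
  by rewrite sqrrD -mulrnAl -mulr_natl; rewrite -mulrA ai; ring.
have e2 : (a + 2 / a) ^+ 2 = a ^+ 2 + 4 + 4 * a^-1 ^+ 2.
  have -> : (a + 2 / a) ^+ 2 = a ^+ 2 + 4 * (a * a^-1) + 4 * a^-1 ^+ 2 by ring.
  by rewrite ai; ring.
have q0 := sqr_ge0 a^-1; have q1 := sqr_ge0 a.
have al2 : al ^+ 2 = (a + a^-1) ^+ 2 - S by rewrite sqr_sqrtr// e1; lra.
have be2 : be ^+ 2 = (a + 2 / a) ^+ 2 - S by rewrite sqr_sqrtr// e2; lra.
have al0 : 0 <= al by exact: sqrtr_ge0.
have be0 : 0 <= be by exact: sqrtr_ge0.
have ab : al <= be by apply: le_of_sqr => //; rewrite al2 be2 e1 e2; lra.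
have bu : be <= 2 * a.
  apply: le_of_sqr; first by lra.
  have : 4 <= a ^+ 2 by nra.
  have : a^-1 ^+ 2 <= 1 by nra.
  by rewrite be2 e2 exprMn; lra.
exists al, be; split=> //.
  have h : 2 <= (be - al) * (be + al) by rewrite -subr_sqr al2 be2 e1 e2; lra.
  have h' : 2 <= (be - al) * (4 * a).
    by apply: (le_trans h); rewrite ler_wpM2l ?subr_ge0//; lra.
  rewrite -[leLHS]mul1r ler_pdivrMr ?mulr_gt0//; lra.
move=> t /andP[t1 t2]; rewrite /outer /= sqn_upd -/S.
have t0 : 0 <= t by exact: le_trans t1.
have : al ^+ 2 <= t ^+ 2 by rewrite ler_sqr ?nnegrE.
have : t ^+ 2 <= be ^+ 2 by rewrite ler_sqr ?nnegrE.
by rewrite al2 be2; lra.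
Qed.

End region_volumes.

(** * The volume of the truncated body *)

(** For sets monotone under deletion the second difference is nonzero only if the point is lost by
    each single deletion, or by the double one alone. *)
Lemma second_diff_le (R : realType) (T : Type) (A A1 A2 A3 : set T) (y : T) (c : R) :
  0 <= c -> (A1 y -> A y) -> (A2 y -> A y) -> (A3 y -> A2 y) -> (A3 y -> A1 y) ->
  (A y -> ~ A1 y -> ~ A2 y -> 1 <= c) -> (A1 y -> A2 y -> ~ A3 y -> 1 <= c) ->
  `|\1_A y - \1_A1 y - (\1_A2 y - \1_A3 y)| <= c.
Proof.
move=> c0 h1 h2 h3 h4 n1 n2.
have iT (X : set T) : X y -> \1_X y = 1 :> R by move=> Xy; rewrite indicE mem_set.
have iF (X : set T) : ~ X y -> \1_X y = 0 :> R by move=> Xy; rewrite indicE memNset.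
have [a|a] := pselect (A y); last first.
  have a1 : ~ A1 y by move=> /h1. have a2 : ~ A2 y by move=> /h2.
  have a3 : ~ A3 y by move=> /h3.
  by rewrite !iF// !subrr normr0.
have [a3|a3] := pselect (A3 y).
  by rewrite !iT// ?subrr ?normr0; auto.
have [a1|a1] := pselect (A1 y); have [a2|a2] := pselect (A2 y).
- by rewrite (iT _ a) (iT _ a1) (iT _ a2) (iF _ a3) subrr sub0r subr0 normrN normr1 n2.
- by rewrite (iT _ a) (iT _ a1) (iF _ a2) (iF _ a3) !subrr normr0.
- by rewrite (iT _ a) (iF _ a1) (iT _ a2) (iF _ a3) !subr0 subrr normr0.
- by rewrite (iT _ a) (iF _ a1) (iF _ a2) (iF _ a3) !subr0 normr1 n1.
Qed.

Section volume_functional.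
Context (R : realType) (d n : nat).
Hypothesis d_gt0 : (0 < d)%N.
Local Notation B := (measurableTypeR R).
Local Notation N := (@normal_prob R 0 1).
Local Notation Pt := (d.-tuple B).
Local Notation Pd := (tprob N d).
Local Notation Om := (n.-tuple Pt).
Local Notation mu := (tprob Pd n).
Variables r R0 rho : R.
Hypothesis r_gt0 : 0 < r.
Hypothesis rR : r <= R0.
Hypothesis rho0 : 0 <= rho.
Hypothesis rhoE : 16 * (R0 ^+ 2 - r ^+ 2) <= rho ^+ 2.
Implicit Types (x : Om) (y z : Pt).

Let r_ge0 : 0 <= r. Proof. exact: ltW. Qed.

Definition origin : Pt := [tuple (0 : R) | i < d].

Lemma vec_origin : vec origin = fun=> 0.
Proof. by apply/funext => i; rewrite /vec tnth_mktuple. Qed.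

Definition bset x : set Pt := [set y | body r R0 (cfg x) (vec y)].

Lemma measurable_ball (s : R) : measurable [set y : Pt | sqn (vec y) <= s].
Proof. by apply: measurable_le_fun => //; exact: measurable_sqn. Qed.

Lemma measurable_bset x : measurable (bset x).
Proof. by apply: measurable_gbody_slice => //; exact: measurable_ball. Qed.

Lemma bset_ball x y : bset x y -> sqn (vec y) <= R0 ^+ 2.
Proof. by apply: body_sub_ball; rewrite r_ge0 rR. Qed.

Lemma bounded_bset x : sqn_bounded (bset x).
Proof. by exists (R0 ^+ 2) => y; exact: bset_ball. Qed.

Definition fvol x := vol (bset x).

Lemma fvol_ge0 x : 0 <= fvol x. Proof. exact: vol_ge0. Qed.

Lemma bm_bset2 : bm (fun p : Om * Pt => \1_(bset p.1) p.2 * wgt p.2).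
Proof.
pose S : set (Om * Pt) := [set p | body r R0 (cfg p.1) (vec p.2)].
have mS : measurable S by apply: measurable_gbody => //; exact: measurable_ball.
(* The body lies in the ball of radius R0; cutting the weight off there makes it bounded. *)
pose b (y : Pt) := \1_[set y : Pt | sqn (vec y) <= R0 ^+ 2] y * wgt y.
have bb : bm b.
  by apply: bm_indic_wgt; [exact: measurable_ball|exists (R0 ^+ 2)].
rewrite (_ : (fun _ => _) = fun p : Om * Pt => \1_S p * b p.2); last first.
  apply/funext => -[x y] /=; rewrite /b mulrA; congr (_ * _).
  rewrite !indicE; have [h|h] := pselect (bset x y).
    by rewrite !mem_set ?mulr1//; exact: bset_ball h.
  rewrite (memNset h) (_ : (x, y) \in S = false) ?mul0r//.
  exact: (@memNset _ S (x, y) h).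
by apply: bmM; [exact: bm_indic|apply: (bm_comp bb); exact: measurable_snd].
Qed.

Lemma bm_fvol : bm fvol.
Proof. exact: (bm_Exr mu Pd bm_bset2). Qed.

Lemma cfg_del j x i : cfg (del origin j x) i = if i == j then (fun=> 0) else cfg x i.
Proof. by rewrite /cfg /del tnth_upd; case: eqP => // _; rewrite vec_origin. Qed.

Lemma bset_del j x : bset (del origin j x) `<=` bset x.
Proof.
move=> y; apply: (@body_del _ _ _ _ _ _ _ j) => //.
  by move=> i ij; rewrite cfg_del (negbTE ij).
by rewrite cfg_del eqxx.
Qed.

Local Notation h := (R0 ^+ 2 - r ^+ 2).

(** If y is lost, then y and x_j share a cap beyond height r; hence both are in the shell and
    [cap_close] bounds their distance. *)
Lemma bset_near j x x' y : (forall i, i != j -> cfg x i = cfg x' i) ->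
  bset x y -> ~ bset x' y ->
  [/\ shell r R0 (tnth x j), shell r R0 y &
      sqn (fun i => vec y i - vec (tnth x j) i) <= 4 * h].
Proof.
move=> xx' xy x'y; have [u [u1 u2 u3]] := body_diff xx' xy x'y.
have u4 := bset_ball xy; have u5 := lt_le_trans u1 u2.
split.
- by rewrite /shell/= (cap_outside r_ge0 u5).
- by rewrite /shell/= (cap_outside r_ge0 u1).
- by apply: (cap_close r_ge0 u1 _ u4 u3).
Qed.

Lemma near_cube y z : sqn (fun i => vec y i - vec z i) <= 16 * h ->
  cube (vec z) rho y.
Proof.
move=> yz i; apply: le_of_sqr => //; rewrite real_normK ?num_real//.
apply: le_trans rhoE; apply: le_trans yz.
exact: (sqn_coord (fun i => vec y i - vec z i)).
Qed.

(** Bound for the volume of the shell near a given point; it plays the part of [delta] in the Stein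
    estimate. *)
Definition loc_size : R := d%:R * ((2 * rho) ^+ d.-1 * (2 * d%:R * h / r)).

Lemma h_ge0 : 0 <= h.
Proof. by rewrite subr_ge0 ler_sqr ?nnegrE// (le_trans r_ge0). Qed.

Lemma loc_size_ge0 : 0 <= loc_size.
Proof.
rewrite /loc_size !mulr_ge0// ?exprn_ge0 ?invr_ge0 ?mulr_ge0//; exact: h_ge0.
Qed.

Lemma loc_vol z : vol (shell r R0 `&` cube (vec z) rho) <= loc_size.
Proof. exact: shell_cube_vol. Qed.

Lemma measurable_loc z : measurable (shell r R0 `&` cube (vec z) rho).
Proof. by apply: measurableI; [exact: measurable_shell|exact: measurable_cube]. Qed.

Lemma bounded_shell : sqn_bounded (shell r R0 : set Pt).
Proof. by exists (R0 ^+ 2) => y /andP[]. Qed.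

Lemma bounded_loc z : sqn_bounded (shell r R0 `&` cube (vec z) rho).
Proof. by apply: bounded_subset bounded_shell; exact: subIsetl. Qed.

Lemma signed_vol (phi : Pt -> R) (c : R) z : bm (fun y => phi y * wgt y) -> 0 <= c ->
  (forall y, `|phi y| <= \1_(shell r R0 `&` cube (vec z) rho) y * c) ->
  `|Ex Pd (fun y => phi y * wgt y)| <= loc_size * c.
Proof.
move=> bphi c0 H; apply: (le_trans (Ex_norm _ bphi)).
have bl := bm_indic_wgt (measurable_loc z) (bounded_loc z).
apply: (@le_trans _ _ (vol (shell r R0 `&` cube (vec z) rho) * c)); last first.
  by rewrite ler_wpM2r// loc_vol.
rewrite mulrC /vol -ExZ//; apply: Ex_le; [exact: bm_norm|exact: bmZ|move=> y].
rewrite normrM (ger0_norm (wgt_ge0 _)) mulrA ler_wpM2r ?wgt_ge0// mulrC.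
exact: H.
Qed.

Definition sind : Pt -> R := \1_(shell r R0).

(** Interacting points have a common y within squared distance 4h of each, so their own squared
    distance is at most 16h. *)
Definition bind (p : Pt * Pt) : R := sind p.1 * sind p.2 *
  \1_[set p : Pt * Pt | sqn (fun i => vec p.1 i - vec p.2 i) <= 16 * h] p.

Lemma bm_sind : bm sind. Proof. by apply: bm_indic; exact: measurable_shell. Qed.

Lemma sind01 y : 0 <= sind y <= 1.
Proof. by rewrite /sind indicE; case: (_ \in _); rewrite ?lexx ?ler01. Qed.

Lemma bm_bind : bm bind.
Proof.
apply: bmM; first apply: bmM.
- by apply: (bm_comp bm_sind); exact: measurable_fst.
- by apply: (bm_comp bm_sind); exact: measurable_snd.
apply: bm_indic; apply: measurable_le_fun => //.
apply: measurable_sum => i; apply: measurable_funX; apply: measurable_funB.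
- exact: (measurableT_comp (measurable_vec i) measurable_fst).
- exact: (measurableT_comp (measurable_vec i) measurable_snd).
Qed.

Lemma bind_ge0 p : 0 <= bind p.
Proof. by rewrite /bind !mulr_ge0// /sind indicE. Qed.

Lemma indic01 (T : Type) (A : set T) (x : T) : 0 <= (\1_A x : R) <= 1.
Proof. by rewrite indicE; case: (_ \in _); rewrite ?lexx ?ler01. Qed.

Lemma bind_le_l y z : bind (y, z) <= sind y.
Proof.
have /andP[y0 y1] := sind01 y; have /andP[z0 z1] := sind01 z.
rewrite /bind/=; set w := \1__ _; have /andP[w0 w1] : 0 <= w <= 1 by exact: indic01.
by rewrite -mulrA ler_piMr//; nra.
Qed.

Lemma prob_loc z : Ex Pd (\1_(shell r R0 `&` cube (vec z) rho)) <=
  expR (- (r ^+ 2 / 2)) * loc_size.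
Proof.
apply: (le_trans (prob_le_vol (r := r) (measurable_loc z) (bounded_loc z) _)).
  by move=> y [/andP[/ltW]].
by rewrite ler_wpM2l ?expR_ge0// loc_vol.
Qed.

Lemma Ex_bind z : Ex Pd (fun y => bind (y, z)) <=
  expR (- (r ^+ 2 / 2)) * loc_size * sind z.
Proof.
have /andP[z0 z1] := sind01 z.
apply: (@le_trans _ _ (sind z * Ex Pd (\1_(shell r R0 `&` cube (vec z) rho)))); last first.
  by rewrite mulrC ler_wpM2r// prob_loc.
have bl : bm (\1_(shell r R0 `&` cube (vec z) rho) : Pt -> R).
  by apply: bm_indic; exact: measurable_loc.
rewrite -ExZ//; apply: Ex_le; [exact: (bm_slicer bm_bind)|exact: bmZ|move=> y].
rewrite /bind /= mulrAC mulrC ler_wpM2l// /sind !indicE.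
have [/set_mem ys|] := boolP (y \in shell r R0); last by rewrite mul0r.
rewrite mul1r; have [/set_mem yz|] := boolP ((y, z) \in _); last by [].
by rewrite mem_set//; split => //; exact: near_cube.
Qed.

Lemma fvol_difE j x : dif origin j fvol x =
  Ex Pd (fun y => (\1_(bset x) y - \1_(bset (del origin j x)) y) * wgt y).
Proof.
rewrite /dif /fvol /vol -ExB; last 2 first.
- by apply: bm_indic_wgt; [exact: measurable_bset|exact: bounded_bset].
- by apply: bm_indic_wgt; [exact: measurable_bset|exact: bounded_bset].
by congr Ex; apply/funext => y; rewrite mulrBl.
Qed.

Lemma bm_bset x : bm (fun y => \1_(bset x) y * wgt y).
Proof. by apply: bm_indic_wgt; [exact: measurable_bset|exact: bounded_bset]. Qed.

Lemma cfg_del_off j x i : i != j -> cfg x i = cfg (del origin j x) i.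
Proof. by move=> ij; rewrite cfg_del (negbTE ij). Qed.

Lemma fvol_locD j x : `|dif origin j fvol x| <= loc_size * sind (tnth x j).
Proof.
have /andP[z0 z1] := sind01 (tnth x j).
rewrite fvol_difE; apply: (@signed_vol _ _ (tnth x j)) => //.
  by under eq_fun do rewrite mulrBl; apply: bmB; exact: bm_bset.
move=> y; rewrite !indicE.
have [/set_mem xy|/negP xy] := boolP (y \in bset x); last first.
  have [/set_mem/bset_del xy'|_] := boolP (y \in bset (del origin j x)).
    by exfalso; apply: xy; apply/mem_set.
  by rewrite subrr normr0 mulr_ge0.
have [/set_mem|/negP xy'] := boolP (y \in bset (del origin j x)).
  by rewrite subrr normr0 mulr_ge0.
have [|h1 h2 h3] := bset_near (@cfg_del_off j x) xy.
  by move=> h; apply: xy'; apply/mem_set; exact: h.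
rewrite subr0 normr1 /sind indicE !mem_set ?mul1r//.
split=> //; apply: near_cube; apply: (le_trans h3).
by have := h_ge0; lra.
Qed.

(** By [second_diff_le] only points y lost through both deletions count; by [bset_near] such y is
    close to x_j and to x_k, which are therefore close to each other. *)
Lemma fvol_locDD j k x : j != k ->
  `|dif origin j fvol x - dif origin j fvol (del origin k x)| <=
  loc_size * bind (tnth x j, tnth x k).
Proof.
move=> jk; have kj : k != j by rewrite eq_sym.
have h0 := h_ge0.
rewrite !fvol_difE -ExB; last 2 first.
- by under eq_fun do rewrite mulrBl; apply: bmB; exact: bm_bset.
- by under eq_fun do rewrite mulrBl; apply: bmB; exact: bm_bset.
under eq_fun do rewrite -mulrBl.
set xj := del origin j x; set xk := del origin k x; set xjk := del origin j xk.
have e : xjk = del origin k xj by rewrite /xjk /xj /xk /del updC.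
have tj : tnth xk j = tnth x j by rewrite /xk /del tnth_upd_neq.
have tk : tnth xj k = tnth x k by rewrite /xj /del tnth_upd_neq.
apply: (@signed_vol _ _ (tnth x j)); [|exact: bind_ge0|].
  under eq_fun do rewrite !mulrBl.
  by apply: bmB; apply: bmB; exact: bm_bset.
move=> y.
have close : shell r R0 (tnth x j) -> shell r R0 (tnth x k) -> shell r R0 y ->
    sqn (fun i => vec y i - vec (tnth x j) i) <= 4 * h ->
    sqn (fun i => vec y i - vec (tnth x k) i) <= 4 * h ->
    1 <= (\1_(shell r R0 `&` cube (vec (tnth x j)) rho) y : R) * bind (tnth x j, tnth x k).
  move=> sj sk sy hj hk.
  rewrite /bind /sind /= !indicE !mem_set ?mulr1//.
    rewrite /= (_ : (fun i => vec (tnth x j) i - vec (tnth x k) i) =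
       (fun i => (vec y i - vec (tnth x k) i) - (vec y i - vec (tnth x j) i))); last first.
      by apply/funext => i; ring.
    have := sqn_ge0 (fun i => (vec y i - vec (tnth x k) i) + (vec y i - vec (tnth x j) i)).
    by rewrite /= sqnB sqnD; lra.
  by split=> //; apply: near_cube; apply: (le_trans hj); lra.
have rhs0 : 0 <= (\1_(shell r R0 `&` cube (vec (tnth x j)) rho) y : R) * bind (tnth x j, tnth x k).
  by rewrite mulr_ge0// ?bind_ge0.
have i1 : bset xj y -> bset x y by exact: bset_del.
have i2 : bset xk y -> bset x y by exact: bset_del.
have i3 : bset xjk y -> bset xk y by exact: bset_del.
have i4 : bset xjk y -> bset xj y by rewrite e; exact: bset_del.
have n1 : bset x y -> ~ bset xj y -> ~ bset xk y ->
    1 <= (\1_(shell r R0 `&` cube (vec (tnth x j)) rho) y : R) * bind (tnth x j, tnth x k).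
  move=> a1 a2 a3.
  have [b1 b2 b3] := bset_near (@cfg_del_off j x) a1 a2.
  by have [c1 c2 c3] := bset_near (@cfg_del_off k x) a1 a3; exact: close.
have n2 : bset xj y -> bset xk y -> ~ bset xjk y ->
    1 <= (\1_(shell r R0 `&` cube (vec (tnth x j)) rho) y : R) * bind (tnth x j, tnth x k).
  move=> a1 a2 a3.
  have [b1 b2 b3] := bset_near (@cfg_del_off j xk) a2 a3.
  rewrite e in a3; have [c1 c2 c3] := bset_near (@cfg_del_off k xj) a1 a3.
  by rewrite tj in b1 b3; rewrite tk in c1 c3; exact: close.
exact: second_diff_le.
Qed.

Lemma prob_shell : Ex Pd sind <=
  expR (- (r ^+ 2 / 2)) * (d%:R * ((2 * R0) ^+ d.-1 * (2 * d%:R * h / r))).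
Proof.
have mS : measurable (shell r R0 : set Pt) by exact: measurable_shell.
apply: (le_trans (prob_le_vol (r := r) mS bounded_shell _)).
  by move=> y /andP[/ltW].
rewrite ler_wpM2l ?expR_ge0//.
have R00 : 0 <= R0 by exact: le_trans rR.
apply: le_trans (@shell_cube_vol _ _ d_gt0 (fun=> 0) r R0 R0 r_gt0 rR R00).
apply: le_vol.
- exact: measurable_shell.
- by apply: measurableI; [exact: measurable_shell|exact: measurable_cube].
- by apply: bounded_subset bounded_shell; exact: subIsetl.
move=> y ys; split => // i; rewrite subr0.
case/andP: ys => _ ys; apply: le_of_sqr => //; rewrite real_normK ?num_real//.
by apply: le_trans ys; exact: sqn_coord.
Qed.

End volume_functional.

(** * Expected gain from a point just beyond the typical radius *)

Section outer_influence.
Context (R : realType) (d n : nat).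
Hypothesis d_gt0 : (0 < d)%N.
Local Notation B := (measurableTypeR R).
Local Notation N := (@normal_prob R 0 1).
Local Notation Pt := (d.-tuple B).
Local Notation Pd := (tprob N d).
Local Notation Om := (n.-tuple Pt).
Local Notation mu := (tprob Pd n).

Definition cap (u : 'I_d -> R) (a R0 : R) : set Pt :=
  [set z | a < dot u (vec z) /\ sqn (vec z) <= R0 ^+ 2].

Lemma measurable_cap u a R0 : measurable (cap u a R0).
Proof.
rewrite (_ : cap u a R0 = [set z | a < dot u (vec z)] `&` [set z | sqn (vec z) <= R0 ^+ 2])//.
apply: measurableI; [apply: measurable_lt_fun|apply: measurable_le_fun] => //.
- exact: measurable_dot_vec.
- exact: measurable_sqn.
Qed.

Lemma bounded_cap u a R0 : sqn_bounded (cap u a R0).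
Proof. by exists (R0 ^+ 2) => z []. Qed.

Lemma nrm1 (u : 'I_d -> R) : sqn u = 1 -> nrm u = 1.
Proof. by move=> u1; rewrite /nrm u1 sqrtr1. Qed.

Definition cap_size (a R0 rho : R) : R :=
  expR (- (a ^+ 2 / 2)) * (d%:R * ((2 * rho) ^+ d.-1 * (2 * d%:R * (R0 ^+ 2 - a ^+ 2) / a))).

(** The cap lies in the shell and near its tip: |z - a u|^2 <= R0^2 - a^2, because the height of z
    exceeds a. *)
Lemma prob_cap u a R0 rho : sqn u = 1 -> 0 < a -> a <= R0 -> 0 <= rho ->
  R0 ^+ 2 - a ^+ 2 <= rho ^+ 2 -> Ex Pd (\1_(cap u a R0)) <= cap_size a R0 rho.
Proof.
move=> u1 a0 aR rho0 hrho.
have out z : cap u a R0 z -> a ^+ 2 < sqn (vec z).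
  move=> [az _]; apply: (@cap_outside _ _ a u); first exact: ltW.
  by rewrite nrm1// mulr1.
apply: (le_trans (prob_le_vol (r := a) (measurable_cap _ _ _) (bounded_cap _ _ _) _)).
  by move=> z /out/ltW.
rewrite ler_wpM2l ?expR_ge0//.
apply: le_trans (@shell_cube_vol _ _ d_gt0 (fun i => a * u i) a R0 rho a0 aR rho0).
have bs : sqn_bounded (shell a R0 `&` cube (fun i => a * u i) rho).
  by exists (R0 ^+ 2) => z [/andP[]].
apply: le_vol => //.
- exact: measurable_cap.
- by apply: measurableI; [exact: measurable_shell|exact: measurable_cube].
move=> z zc; have oz := out _ zc; case: zc => az zR.
split; first by rewrite /shell/= oz.
move=> i; apply: le_of_sqr => //; rewrite real_normK ?num_real//.
apply: le_trans hrho; apply: (le_trans (sqn_coord (fun i => vec z i - a * u i) i)).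
by rewrite sqnB dotZ sqnZ u1 dotC; nra.
Qed.

Lemma outer_polar (a : R) (y : Pt) : 2 <= a -> outer a y -> exists (u : 'I_d -> R) (b : R),
  [/\ sqn u = 1, forall i, vec y i = b * u i, a + a^-1 <= b & b <= a + 2 / a].
Proof.
move=> a2 /andP[h1 h2]; have a0 : 0 < a by exact: lt_le_trans a2.
have b_lo : a + a^-1 <= nrm (vec y).
  by rewrite nrm_ge// addr_ge0 ?invr_ge0// ltW.
have b0 : nrm (vec y) != 0.
  by rewrite gt_eqF// (lt_le_trans _ b_lo)// addr_gt0 ?invr_gt0.
exists (fun i => (nrm (vec y))^-1 * vec y i), (nrm (vec y)); split => //.
- by rewrite sqnZ -sqr_nrm -exprMn mulVf// expr1n.
- by move=> i; rewrite mulrA divff// mul1r.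
- by rewrite nrm_le// addr_ge0 ?divr_ge0// ltW.
Qed.

Section tangent_cone.
Variables (r R0 a : R) (x : Om) (j : 'I_n) (y : Pt).
Hypothesis r_gt0 : 0 < r.
Hypothesis ra : r <= a.
Hypothesis a2 : 2 <= a.
Hypothesis aR : a + 2 / a <= R0.
Variables (u : 'I_d -> R) (b : R).
Hypothesis u1 : sqn u = 1.
Hypothesis yE : forall i, vec y i = b * u i.
Hypothesis b_lo : a + a^-1 <= b.
Hypothesis b_hi : b <= a + 2 / a.

Let a0 : 0 < a. Proof. exact: lt_le_trans a2. Qed.

Let ai0 : 0 < a^-1. Proof. by rewrite invr_gt0. Qed.

Let b0 : 0 < b. Proof. by apply: lt_le_trans b_lo; rewrite addr_gt0. Qed.

(* [z] lies on the segment from [y] to a point [b'] of the ball of radius [r];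
   the parameter is chosen so that the component of [b'] along [y] is that of
   the tangency points, [r ^ 2 / b]. *)
Lemma cone_in_body (z : Pt) (h : R) : dot u (vec z) = h -> a < h -> h < b ->
  (b ^+ 2 - r ^+ 2) * sqn (fun i => vec z i - h * u i) <= (b - h) ^+ 2 * r ^+ 2 ->
  bset r R0 (upd x j y) z.
Proof.
move=> uz ah hb hw v.
have br : 0 < b ^+ 2 - r ^+ 2.
  by rewrite subr_gt0 ltr_sqr ?nnegrE ?(ltW b0) ?(ltW r_gt0)//; apply: (le_lt_trans ra); exact: lt_trans hb.
pose tau := (b - h) * b / (b ^+ 2 - r ^+ 2).
have tau0 : 0 < tau by rewrite /tau divr_gt0// mulr_gt0// subr_gt0.
have tau1 : tau <= 1.
  have rh : r <= h by rewrite (le_trans ra)// ltW.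
  have rhb : r * r <= h * b.
    by apply: ler_pM => //; rewrite ?(ltW r_gt0)// (le_trans rh)// ltW.
  by rewrite /tau ler_pdivrMr// mul1r mulrBl expr2 lerD2l lerN2 expr2.
pose w i := vec z i - h * u i.
pose c i := (r ^+ 2 / b) * u i + tau^-1 * w i.
have uw : dot u w = 0 by rewrite /w dotB dotZ uz dot_sqn u1; ring.
have zE : vec z = fun i => (1 - tau) * vec y i + tau * c i.
  apply/funext => i; rewrite yE /c mulrDr (mulrA tau tau^-1) divff ?gt_eqF// mul1r /w.
  have e : (1 - tau) * b + tau * (r ^+ 2 / b) = h.
    rewrite /tau; field; rewrite (gt_eqF b0) /= ; move: br; rewrite lt_neqAle eq_sym => /andP[+ _].
    by [].
  by rewrite -[in h * _]e; ring.
have cr : nrm c <= r.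
  rewrite nrm_le ?(ltW r_gt0)// /c sqn_lin uw u1 mulr0 addr0 mulr1.
  have -> : tau^-1 ^+ 2 * sqn w =
     (b ^+ 2 - r ^+ 2) * ((b ^+ 2 - r ^+ 2) * sqn w) / ((b - h) ^+ 2 * b ^+ 2).
    rewrite /tau; field; rewrite (gt_eqF b0) /= subr_eq0.
    move: br; rewrite lt_neqAle eq_sym => /andP[-> _].
    by rewrite (gt_eqF hb).
  have bh : 0 < (b - h) ^+ 2 * b ^+ 2 by rewrite mulr_gt0// exprn_gt0// subr_gt0.
  apply: (@le_trans _ _ ((r ^+ 2 / b) ^+ 2 + (b ^+ 2 - r ^+ 2) * ((b - h) ^+ 2 * r ^+ 2) /
      ((b - h) ^+ 2 * b ^+ 2))).
    by rewrite lerD2l ler_wpM2r ?invr_ge0 ?(ltW bh)// ler_wpM2l// ltW.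
  rewrite le_eqVlt; apply/orP; left; apply/eqP; field.
  by rewrite (gt_eqF b0) subr_eq0 (gt_eqF hb).
rewrite zE dot_lin.
have [vc|vc] := leP (dot v (vec y)) (dot v c).
  left; split=> //.
  have h1 : dot v c <= r * nrm v.
    rewrite (le_trans (dot_le_nrm _ _))// mulrC ler_wpM2r ?nrm_ge0//.
  by apply: le_trans h1; nra.
right; exists j; rewrite /cfg tnth_upd_eq; split; last by nra.
rewrite -nrm_le; last by rewrite (le_trans _ aR)// addr_ge0 ?divr_ge0// ltW.
have yb : nrm (vec y) <= b.
  rewrite nrm_le ?(ltW b0)// (_ : vec y = fun i => b * u i); last exact/funext.
  by rewrite sqnZ u1 mulr1.
by apply: (le_trans yb); apply: le_trans aR.
Qed.

(** The direction u excludes z: the ball, the origin and all remaining points within radius R0 stay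
    at height at most a. *)
Lemma above_not_body (z : Pt) : a < dot u (vec z) ->
  (forall i, i != j -> ~ cap u a R0 (tnth x i)) ->
  ~ bset r R0 (del (origin R d) j x) z.
Proof.
move=> az H /(_ u) -[[_]|[i [iR]]].
  by apply/negP; rewrite -ltNge (nrm1 u1) mulr1 (le_lt_trans ra).
rewrite cfg_del in iR *; have [_|ij] := eqVneq i j.
  rewrite [in X in _ <= X]/dot big1; last by move=> k _; rewrite mulr0.
  by apply/negP; rewrite -ltNge (lt_trans a0).
move=> h; apply: (H i ij); split; first exact: lt_le_trans h.
by move: iR; rewrite (negbTE ij).
Qed.

Lemma cone_vol (k rs : R) : 0 <= k -> k <= rs -> k <= (4 * a)^-1 ->
  (d%:R ^+ 2 * (1 + d%:R) * rs) ^+ 2 * (a ^+ 2 + 5 - r ^+ 2) <= r ^+ 2 * (2 * a)^-1 ^+ 2 ->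
  (forall i, i != j -> ~ cap u a R0 (tnth x i)) ->
  (2 * rs) ^+ d.-1 * k <= fvol r R0 (upd x j y) - fvol r R0 (del (origin R d) j x).
Proof.
move=> k0 krs ka hrs H.
have r_ge0 := ltW r_gt0.
have rR : r <= R0.
  by apply: (le_trans ra); apply: le_trans aR; rewrite lerDl divr_ge0// ltW.
(* The slab occupies heights between a + 1/(4a) and a + 1/(2a): above the cap base, and at least
   1/(2a) below the apex, whose height is at least a + 1/a. *)
pose h0 := a + (4 * a)^-1.
have a40 : 0 < (4 * a)^-1 by rewrite invr_gt0 mulr_gt0.
have aE2 : (2 * a)^-1 = 2 * (4 * a)^-1 by field; rewrite gt_eqF.
have aE1 : a^-1 = 4 * (4 * a)^-1 by field; rewrite gt_eqF.
have sub : slab u h0 k (d%:R ^+ 2 * (1 + d%:R) * rs) `<=`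
    bset r R0 (upd x j y) `\` bset r R0 (del (origin R d) j x).
  move=> z [/andP[z1 z2] z3]; split; last first.
    by apply: above_not_body => //; rewrite /h0 in z1; lra.
  apply: (@cone_in_body z (dot u (vec z))) => //; rewrite /h0 in z1 z2 z3.
  - lra.
  - by have := b_lo; lra.
  set h := dot u (vec z) in z1 z2 *.
  (* The foot of the perpendicular is the point of the axis nearest to z. *)
  have z4 : sqn (fun i => vec z i - h * u i) <= (d%:R ^+ 2 * (1 + d%:R) * rs) ^+ 2.
    apply: le_trans z3; rewrite !sqnB !dotZ !sqnZ u1 dotC -/h.
    have := sqr_ge0 (h - (a + (4 * a)^-1)); lra.
  have b2 : b ^+ 2 - r ^+ 2 <= a ^+ 2 + 5 - r ^+ 2.
    have : b ^+ 2 <= (a + 2 / a) ^+ 2 by rewrite ler_sqr ?nnegrE ?(ltW b0)// (le_trans _ b_hi)// ltW.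
    have -> : (a + 2 / a) ^+ 2 = a ^+ 2 + 4 * (a * a^-1) + 4 * a^-1 ^+ 2 by ring.
    rewrite divff ?gt_eqF// mulr1.
    have : a^-1 <= 2^-1 by rewrite lef_pV2 ?posrE.
    by move: ai0 => ? ?; nra.
  have br : 0 < b ^+ 2 - r ^+ 2.
    by rewrite subr_gt0 ltr_sqr ?nnegrE ?(ltW b0)//; apply: (le_lt_trans ra); apply: lt_le_trans b_lo; rewrite ltrDl.
  apply: (@le_trans _ _ ((a ^+ 2 + 5 - r ^+ 2) * (d%:R ^+ 2 * (1 + d%:R) * rs) ^+ 2)).
    by apply: ler_pM => //; [exact: ltW|exact: sqn_ge0].
  rewrite mulrC; apply: (le_trans hrs); rewrite mulrC ler_wpM2r ?sqr_ge0//.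
  have : (2 * a)^-1 <= b - h by have := b_lo; lra.
  by move=> bh; rewrite ler_sqr ?nnegrE// ?(le_trans _ bh)// ltW// aE2 mulr_gt0.
apply: (le_trans (slab_vol d_gt0 h0 u1 k0 krs)).
set S := slab _ _ _ _ in sub *.
have mS : measurable S by exact: measurable_slab.
have bS : sqn_bounded S by apply: bounded_slab; exact: u1.
rewrite /fvol /vol -ExB; last 2 first.
- exact: bm_bset.
- exact: bm_bset.
apply: Ex_le; [exact: bm_indic_wgt|by apply: bmB; exact: bm_bset|move=> z].
rewrite -mulrBl ler_wpM2r ?wgt_ge0// !indicE.
have [/set_mem zS|_] := boolP (z \in S).
  by have [h1 h2] := sub z zS; rewrite (mem_set h1) (memNset h2) subr0.
have [/set_mem zd|_] := boolP (z \in bset r R0 (del (origin R d) j x)); last by rewrite subr0.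
rewrite mem_set ?subrr//.
apply: (@bset_del _ _ _ r R0 r_gt0 j) => //.
by rewrite /del upd_upd.
Qed.

End tangent_cone.

Variables (r R0 a rho rs k : R).
Hypothesis r_gt0 : 0 < r.
Hypothesis ra : r <= a.
Hypothesis a2 : 2 <= a.
Hypothesis aR : a + 2 / a <= R0.
Hypothesis rho0 : 0 <= rho.
Hypothesis hrho : R0 ^+ 2 - a ^+ 2 <= rho ^+ 2.
Hypothesis k0 : 0 <= k.
Hypothesis krs : k <= rs.
Hypothesis ka : k <= (4 * a)^-1.
Hypothesis hrs :
  (d%:R ^+ 2 * (1 + d%:R) * rs) ^+ 2 * (a ^+ 2 + 5 - r ^+ 2) <= r ^+ 2 * (2 * a)^-1 ^+ 2.
Hypothesis hcap : n%:R * cap_size a R0 rho <= 1 / 2.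

(** Fix x_j = y in the outer shell. The cap below y contains at most 1/2 of a point on average, so
    with probability at least 1/2 it is empty and the cone volume is gained; otherwise the gain is
    still nonnegative. *)
Lemma outer_influence j :
  ((2 * rs) ^+ d.-1 * k / 2) * Ex Pd (\1_(outer a)) <=
  Ex mu (fun x => \1_(outer a) (tnth x j) * dif (origin R d) j (@fvol R d n r R0) x).
Proof.
have a0 : 0 < a by exact: lt_le_trans a2.
have aR' : a <= R0 by apply: le_trans aR; rewrite lerDl divr_ge0// ltW.
have rR : r <= R0 by exact: le_trans aR'.
set g0 := (2 * rs) ^+ d.-1 * k.
have g00 : 0 <= g0 by rewrite /g0 mulr_ge0// exprn_ge0// mulr_ge0// (le_trans k0).
have bf : bm (@fvol R d n r R0) by exact: bm_fvol.
have bo : bm (\1_(outer a) : Pt -> R) by apply: bm_indic; exact: measurable_outer.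
have bD : bm (fun x => dif (origin R d) j (@fvol R d n r R0) x) by exact: bm_dif.
rewrite (Ex_resample Pd j); last by apply: bmM => //; exact: bm_tnth.
have bH : bm (fun p : Om * Pt => \1_(outer a) (tnth (upd p.1 j p.2) j) *
    dif (origin R d) j (@fvol R d n r R0) (upd p.1 j p.2)).
  apply: (@bm_upd2 _ _ _ n (fun x => \1_(outer a) (tnth x j) * dif (origin R d) j (fvol r R0) x)).
  by apply: bmM => //; exact: bm_tnth.
rewrite (Ex_fubini mu Pd bH) /=.
rewrite -ExZ//; apply: Ex_le; [exact: bmZ|exact: (bm_Exl mu Pd bH)|move=> y].
under eq_fun do rewrite tnth_upd_eq.
have bDy : bm (fun x : Om => dif (origin R d) j (fvol r R0) (upd x j y)) by exact: bm_upd.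
rewrite ExZ// mulrC !indicE.
have [/set_mem oy|] := boolP (y \in outer a); last by rewrite !mul0r.
rewrite !mul1r.
have [u [b [u1 yE b_lo b_hi]]] := outer_polar a2 oy.
have bc : bm (\1_(cap u a R0) : Pt -> R) by apply: bm_indic; exact: measurable_cap.
(* One minus the number of points in the cap bounds the indicator of an empty cap from below. *)
pose phi (x : Om) := g0 * (1 - \sum_(i < n) \1_(cap u a R0) (tnth x i)).
have bsum : bm (fun x : Om => \sum_(i < n) (\1_(cap u a R0) (tnth x i) : R)).
  by apply: bm_sum => i; exact: bm_tnth.
have bphi : bm phi by apply: bmZ; apply: bmB => //; exact: bm_cst.
apply: (@le_trans _ _ (Ex mu phi)).
  rewrite /phi ExZ; last by apply: bmB => //; exact: bm_cst.
  rewrite ExB//; last exact: bm_cst.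
  rewrite Ex_cst Ex_sum; last by move=> i; exact: bm_tnth.
  under eq_bigr do rewrite Ex_tnth//.
  rewrite sum_cst_ord.
  have h1 : n%:R * Ex Pd (\1_(cap u a R0)) <= 1 / 2.
    by apply: le_trans hcap; rewrite ler_wpM2l//; exact: prob_cap.
  by rewrite ler_wpM2l//; lra.
apply: Ex_le => // x.
rewrite /phi /dif.
have -> : del (origin R d) j (upd x j y) = del (origin R d) j x by rewrite /del upd_upd.
have [H|/existsNP[i Hi]] := pselect (forall i, i != j -> ~ cap u a R0 (tnth x i)).
  apply: le_trans (cone_vol r_gt0 ra a2 aR u1 yE b_lo b_hi k0 krs ka hrs H).
  rewrite ler_piMr// gerBl; apply: sumr_ge0 => i _.
  by rewrite indicE.
apply: (@le_trans _ _ 0).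
  rewrite mulr_ge0_le0// subr_le0 (bigD1 i)//= indicE mem_set ?lerDl; last first.
    by apply: contrapT => h; apply: Hi => _.
  by apply: sumr_ge0 => i' _; rewrite indicE.
rewrite subr_ge0; apply: le_vol; [exact: measurable_bset|exact: measurable_bset|exact: bounded_bset|].
rewrite (_ : del (origin R d) j x = del (origin R d) j (upd x j y)); last by rewrite /del upd_upd.
exact: bset_del.
Qed.

Lemma prob_outer : normal_peak (1 : R) ^+ d * expR (- ((a + 2 / a) ^+ 2 / 2)) *
  ((a / d%:R) ^+ d.-1 * (2 * a)^-1) <= Ex Pd (\1_(outer a)).
Proof.
have bo : sqn_bounded (outer a : set Pt) by exists ((a + 2 / a) ^+ 2) => y /andP[].
apply: le_trans (prob_ge_vol (s := a + 2 / a) (measurable_outer _) bo _); last first.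
  by move=> y /andP[].
rewrite ler_wpM2l ?mulr_ge0 ?exprn_ge0 ?expR_ge0 ?normal_peak_ge0//.
exact: outer_vol.
Qed.

End outer_influence.

(** * Nets and Gaussian tails *)

Section sphere_net.
Context (R : realType) (d : nat).
Hypothesis d_gt0 : (0 < d)%N.

Lemma sqn_e1 : sqn (fun i : 'I_d => (i == Ordinal d_gt0)%:R : R) = 1.
Proof.
rewrite /sqn (bigD1 (Ordinal d_gt0))//= expr1n big1 ?addr0// => i /negbTE.
by move=> e; rewrite (_ : (i == _) = false) ?expr0n.
Qed.

(** Grid cells of side 1/m: each cell that meets the sphere is represented by one of its unit
    vectors, and two points of a cell differ by at most 1/m in every coordinate. *)
Lemma sphere_net (m : nat) : exists v : {ffun 'I_d -> 'I_(2 * m).+1} -> 'I_d -> R,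
  (forall k, sqn (v k) = 1) /\
  forall u, sqn u = 1 -> exists k, m%:R ^+ 2 * sqn (fun i => u i - v k i) <= d%:R.
Proof.
pose t (u : 'I_d -> R) i := Num.truncn (m%:R * (u i + 1)).
pose idx u : {ffun 'I_d -> 'I_(2 * m).+1} := [ffun i => inord (t u i)].
have ui (u : 'I_d -> R) i : sqn u = 1 -> -1 <= u i <= 1.
  move=> u1; rewrite -ler_norml; apply: le_of_sqr => //.
  by rewrite real_normK ?num_real// expr1n -u1; exact: sqn_coord.
have t_itv u i : sqn u = 1 -> (t u i)%:R <= m%:R * (u i + 1) < (t u i).+1%:R.
  by move=> /(ui u i) /andP[h1 h2]; apply: truncn_itv; rewrite mulr_ge0//; lra.
have t_le u i : sqn u = 1 -> (t u i < (2 * m).+1)%N.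
  move=> u1; rewrite ltnS -(ler_nat R); have /andP[h _] := t_itv u i u1.
  apply: (le_trans h); rewrite natrM mulrC ler_wpM2r//.
  by have /andP[_] := ui u i u1; lra.
have ex k : exists v : 'I_d -> R, sqn v = 1 /\
    forall u, sqn u = 1 -> idx u = k -> m%:R ^+ 2 * sqn (fun i => u i - v i) <= d%:R.
  have [[v [v1 vk]]|H] := pselect (exists v, sqn v = 1 /\ idx v = k); last first.
    (* Cells without unit vectors receive a basis vector as default. *)
    by exists (fun i => (i == Ordinal d_gt0)%:R); split; [exact: sqn_e1|move=> u u1 uk; exfalso; apply: H; exists u].
  exists v; split => // u u1 uk.
  rewrite /sqn mulr_sumr; apply: (@le_trans _ _ (\sum_(i < d) 1)); last first.
    by rewrite sumr_const card_ord.
  apply: ler_sum => i _; rewrite -exprMn -real_normK ?num_real// exprn_ile1//.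
  have tE : t u i = t v i.
    have := congr1 (fun f : {ffun _ -> _} => nat_of_ord (f i)) (etrans uk (esym vk)).
    by rewrite !ffunE !inordK ?t_le.
  have := t_itv u i u1; have := t_itv v i v1; rewrite tE -!natr1 => /andP[a1 a2] /andP[b1 b2].
  by rewrite ler_norml mulrBr; apply/andP; split; lra.
have [v hv] := choice ex.
exists v; split=> [k|u u1]; first by case: (hv k).
by exists (idx u); case: (hv (idx u)) => _; apply.
Qed.

End sphere_net.

Section gaussian_tail.
Context (R : realType).
Local Notation B := (measurableTypeR R).
Local Notation N := (@normal_prob R 0 1).
Local Notation leb := (@lebesgue_measure R).

(** The integrand times the standard normal density is s times the normal density with standard
    deviation s. *)
Lemma normal_exp_sqr (s : R) : 0 < s ->
  (\int[N]_t (expR ((1 - s ^- 2) * (t : B) ^+ 2 / 2))%:E = s%:E)%E.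
Proof.
move=> s0; rewrite integral_normal_prob; last 2 first.
- apply/measurable_EFinP; apply: measurableT_comp => //.
  by apply: measurable_funM => //; apply: measurable_funM => //; exact: measurable_funX.
- by move=> t; rewrite lee_fin expR_ge0.
transitivity (\int[leb]_t (s%:E * (normal_pdf 0 s t)%:E))%E.
  apply: eq_integral => t _; rewrite -!EFinM; congr EFin.
  rewrite normal_pdf01E normal_pdfE ?gt_eqF// /normal_fun subr0.
  have -> : normal_peak (1 : R) = s * normal_peak s.
    rewrite /normal_peak expr1n mul1r.
    rewrite -[X in s / Num.sqrt X]mulrnAr sqrtrM ?sqr_ge0// sqrtr_sqr gtr0_norm// invfM mulrA divff ?gt_eqF//.
    by rewrite mul1r.
  rewrite -!mulrA mulrCA; congr (_ * _); rewrite mulrCA; congr (_ * _).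
  rewrite -expRD; congr expR; rewrite -mulr_natl; field.
  by rewrite gt_eqF.
rewrite ge0_integralZl//=.
- by rewrite integral_normal_pdf mule1.
- by apply/measurable_EFinP; exact: measurable_normal_pdf.
- by move=> t _; rewrite lee_fin normal_pdf_ge0.
- by rewrite lee_fin ltW.
Qed.

Variable d : nat.
Local Notation Pt := (d.-tuple B).
Local Notation Pd := (tprob N d).

Lemma expR_sqn (c : R) (v : 'I_d -> R) : expR (c * sqn v / 2) = \prod_i expR (c * v i ^+ 2 / 2).
Proof. by rewrite -expR_sum /sqn mulr_sumr mulr_suml. Qed.

Lemma gauss_exp_sqn (s : R) : 0 < s ->
  (\int[Pd]_y (expR ((1 - s ^- 2) * sqn (vec y) / 2))%:E = (s ^+ d)%:E)%E.
Proof.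
move=> s0; under eq_integral do rewrite expR_sqn.
rewrite (@tprob_prod _ _ _ N d (fun=> (fun t : B => expR ((1 - s ^- 2) * t ^+ 2 / 2)))
  (fun=> s)).
- by rewrite prodr_const card_ord.
- move=> i; apply: measurableT_comp => //.
  by apply: measurable_funM => //; apply: measurable_funM => //; exact: measurable_funX.
- by move=> i t; exact: expR_ge0.
- by move=> i; exact: normal_exp_sqr.
Qed.

(** The hull volume is of order |x_i|^d when x_i is the farthest point; this is its square,
    restricted to far points. *)
Definition heavy (R0 : R) (y : Pt) : R :=
  sqn (vec y) ^+ d * \1_[set y : Pt | R0 ^+ 2 < sqn (vec y)] y.

Lemma measurable_heavy R0 : measurable_fun setT (heavy R0).
Proof.
apply: measurable_funM; first by apply: measurable_funX; exact: measurable_sqn.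
by apply: measurable_indic; apply: measurable_lt_fun => //; exact: measurable_sqn.
Qed.

Lemma heavy_ge0 R0 y : 0 <= heavy R0 y.
Proof. by rewrite /heavy mulr_ge0// exprn_ge0// sqn_ge0. Qed.

(** Exponential Markov bound with the tilt of standard deviation R0, whose total mass is R0^d; the
    polynomial factor is traded for R0^(2d) times a small exponential. *)
Lemma gauss_tail (R0 : R) : 2 <= R0 ^+ 2 -> 4 * d%:R <= R0 ^+ 2 -> 0 < R0 ->
  (\int[Pd]_y (heavy R0 y)%:E <=
    (expR (1 / 2 - R0 ^+ 2 / 2) * R0 ^+ (3 * d))%:E)%E.
Proof.
move=> R2 Rd R00.
have R20 : 0 < R0 ^+ 2 by exact: exprn_gt0.
pose th := 1 - R0 ^- 2.
have th12 : 1 / 2 <= th.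
  have : R0 ^- 2 <= 2^-1 by rewrite lef_pV2 ?posrE.
  by rewrite /th; lra.
pose c := expR (1 / 2 - R0 ^+ 2 / 2) * R0 ^+ (2 * d).
have c0 : 0 <= c by rewrite mulr_ge0 ?expR_ge0// exprn_ge0// ltW.
have mE : measurable_fun setT (fun y : Pt => expR (th * sqn (vec y) / 2)).
  apply: measurableT_comp => //.
  by apply: measurable_funM => //; apply: measurable_funM => //; exact: measurable_sqn.
apply: (@le_trans _ _ (\int[Pd]_y (c%:E * (expR (th * sqn (vec y) / 2))%:E)))%E.
  apply: ge0_le_integral => //.
  - by move=> y _; rewrite lee_fin heavy_ge0.
  - by apply/measurable_EFinP; exact: measurable_heavy.
  - by apply/measurable_EFinP; apply: measurable_funM.
  move=> y _; rewrite -EFinM lee_fin /heavy indicE.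
  have [/set_mem/= ys|_] := boolP (y \in _); last by rewrite mulr0 mulr_ge0 ?expR_ge0.
  rewrite mulr1; set s := sqn (vec y) in ys *.
  have s0 : 0 <= s by exact: sqn_ge0.
  (* The d-th power of x <= exp(x - 1) at x = s / R0^2. *)
  have h1 : s ^+ d <= R0 ^+ (2 * d) * expR (d%:R * (s / R0 ^+ 2 - 1)).
    rewrite mulrC -ler_pdivrMr ?exprn_gt0// exprM -expr_div_n expRM_natl.
    apply: lerXn2r; rewrite ?nnegrE ?expR_ge0 ?divr_ge0 ?(ltW R20)//.
    by have := expR_ge1Dx (s / R0 ^+ 2 - 1); rewrite addrC subrK.
  apply: (le_trans h1); rewrite /c.
  have -> : expR (1 / 2 - R0 ^+ 2 / 2) * R0 ^+ (2 * d) * expR (th * s / 2) =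
    R0 ^+ (2 * d) * (expR (1 / 2 - R0 ^+ 2 / 2) * expR (th * s / 2)) by ring.
  rewrite ler_wpM2l ?exprn_ge0 ?(ltW R00)//.
  rewrite -expRD ler_expR.
  have -> : d%:R * (s / R0 ^+ 2 - 1) = d%:R / R0 ^+ 2 * (s - R0 ^+ 2).
    by field; rewrite gt_eqF.
  have -> : 1 / 2 - R0 ^+ 2 / 2 + th * s / 2 = th / 2 * (s - R0 ^+ 2).
    by rewrite /th; field; rewrite gt_eqF.
  rewrite ler_wpM2r ?subr_ge0 ?(ltW ys)// ler_pdivrMr//.
  have h4 : 4^-1 <= th / 2 by lra.
  by apply: (@le_trans _ _ (4^-1 * R0 ^+ 2)); [lra|rewrite ler_wpM2r// ltW].
have mEE : measurable_fun setT (fun y : Pt => (expR (th * sqn (vec y) / 2))%:E).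
  exact/measurable_EFinP.
have E0 (y : Pt) : setT y -> (0 <= (expR (th * sqn (vec y) / 2))%:E)%E.
  by rewrite lee_fin expR_ge0.
have c0' : (0 <= c%:E)%E by rewrite lee_fin.
rewrite (ge0_integralZl _ measurableT mEE E0 c0').
rewrite gauss_exp_sqn// -EFinM lee_fin /c -mulrA -exprD.
by rewrite (_ : 2 * d + d = 3 * d)%N//; lia.
Qed.

End gaussian_tail.

(** * Truncation of the Gaussian polytope *)

Section polytope_volume.
Context (R : realType) (d n : nat).
Hypothesis d_gt0 : (0 < d)%N.
Local Notation B := (measurableTypeR R).
Local Notation N := (@normal_prob R 0 1).
Local Notation Pt := (d.-tuple B).
Local Notation Pd := (tprob N d).
Local Notation Om := (n.-tuple Pt).
Local Notation mu := (tprob Pd n).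
Implicit Types (x : Om) (y z : Pt).

Definition hset x : set Pt := [set y | hull (cfg x) (vec y)].

Definition hvol x := vol (hset x).

Lemma measurable_hset x : measurable (hset x).
Proof. exact: (@measurable_gbody_slice R d n false (fun=> True) 0 (lexx 0) measurableT x). Qed.

Lemma volKE x : volK (cfg x) = hvol x.
Proof.
have e : conv_hull (cfg x) = hull (cfg x).
  by apply/seteqP; split => y /hullE.
by rewrite /volK e VolE//; exact: measurable_hset.
Qed.

Lemma hvol_ge0 x : 0 <= hvol x. Proof. exact: vol_ge0. Qed.

Lemma measurable_hvol : measurable_fun setT hvol.
Proof.
apply: measurableT_comp => //.
pose S : set (Om * Pt) := [set p | hull (cfg p.1) (vec p.2)].
have mS : measurable S.
  exact: (@measurable_gbody R d n false (fun=> True) 0 (lexx 0) measurableT).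
apply: (@measurable_fun_fubini_tonelli_F _ _ _ _ _ Pd
  (fun p : Om * Pt => (\1_(hset p.1) p.2 * wgt p.2)%:E)); last by move=> p; rewrite lee_fin mulr_ge0// wgt_ge0.
apply/measurable_EFinP; apply: measurable_funM.
  rewrite (_ : (fun p : Om * Pt => \1_(hset p.1) p.2) = (\1_S : Om * Pt -> R)).
    exact: measurable_indic.
  by apply/funext => -[x y]; rewrite !indicE; congr (nat_of_bool _)%:R; apply/idP/idP; rewrite !inE.
exact: (measurableT_comp (@measurable_wgt R d) (@measurable_snd _ _ Om Pt)).
Qed.

Lemma vol_ball (A : set Pt) (M : R) : measurable A -> 0 <= M ->
  (forall y, A y -> sqn (vec y) <= M ^+ 2) -> vol A <= (2 * M) ^+ d.
Proof.
move=> mA M0 AM.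
have AMi y i : A y -> `|vec y i| <= M.
  move=> /AM h; apply: le_of_sqr => //; rewrite real_normK ?num_real//.
  by apply: le_trans h; exact: sqn_coord.
have -> : (2 * M) ^+ d = (2 * M) ^+ d.-1 * (2 * M) by rewrite -exprSr prednK.
apply: (@vol_slice_le _ _ A (Ordinal d_gt0) (fun=> 0) M) => //; first by exists (M ^+ 2).
move=> y; exists (- M), M, 0, 0; split => //; [lra|lra|move=> t At; split].
  by move=> j ji; have := AMi _ j At; rewrite vec_upd (negbTE ji) subr0.
by have := AMi _ (Ordinal d_gt0) At; rewrite vec_upd eqxx ler_norml => ->.
Qed.

Lemma hvol_le x (M : R) : 0 <= M -> (forall i, sqn (cfg x i) <= M ^+ 2) ->
  hvol x <= (2 * M) ^+ d.
Proof.
move=> M0 H; apply: vol_ball => // [|y Hy]; first exact: measurable_hset.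
rewrite -nrm_le//; case: (Hy (vec y)) => [[]//|[i [_ hi]]].
have h : nrm (vec y) * nrm (vec y) <= nrm (vec y) * M.
  rewrite -expr2 sqr_nrm -dot_sqn (le_trans hi)// (le_trans (dot_le_nrm _ _))//.
  by rewrite ler_wpM2l ?nrm_ge0// nrm_le.
have := nrm_ge0 (vec y); rewrite le_eqVlt => /predU1P[<-//|n0].
by rewrite ler_pM2l in h.
Qed.

Variables r R0 : R.
Hypothesis r_gt0 : 0 < r.
Hypothesis rR : r <= R0.
Hypothesis R01 : 1 <= R0.

Let R00 : 0 <= R0. Proof. exact: le_trans R01. Qed.

Lemma fvol_le x : fvol r R0 x <= (2 * R0) ^+ d.
Proof.
apply: vol_ball => // [|y]; first exact: measurable_bset.
exact: bset_ball.
Qed.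

(** If no point is discarded and in every direction some point reaches the ball, both bodies have
    the same support conditions. *)
Lemma hvol_fvol x : (forall i, sqn (cfg x i) <= R0 ^+ 2) ->
  (forall u, exists i, r * nrm u <= dot u (cfg x i)) -> hvol x = fvol r R0 x.
Proof.
move=> H1 H2; congr vol; apply/seteqP; split => y Hy u.
  by case: (Hy u) => [[]//|[i [_ hi]]]; right; exists i.
right; case: (Hy u) => [[_ h]|[i [_ hi]]]; last by exists i.
by have [i hi] := H2 u; exists i; split => //; exact: le_trans h hi.
Qed.

(** Indicator that no sample point lies in C, as a product so that independence factorises its
    integral. *)
Definition miss (C : set Pt) x : R := \prod_(i < n) (1 - \1_C (tnth x i)).

Lemma miss_ge0 C x : 0 <= miss C x.
Proof.
apply: prodr_ge0 => i _; rewrite indicE subr_ge0.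
by case: (_ \in _).
Qed.

Lemma miss1 C x : (forall i, ~ C (tnth x i)) -> miss C x = 1.
Proof. by move=> H; apply: big1 => i _; rewrite indicE memNset// subr0. Qed.

Lemma measurable_miss C : measurable C -> measurable_fun setT (miss C).
Proof.
move=> mC; apply: measurable_prod => i _; apply: measurable_funB => //.
exact: (measurableT_comp (measurable_indic mC) (measurable_tnth i)).
Qed.

Lemma integral_miss C : measurable C ->
  (\int[mu]_x (miss C x)%:E <= (expR (- (n%:R * Ex Pd (\1_C))))%:E)%E.
Proof.
move=> mC.
have bC : bm (fun y => 1 - (\1_C y : R)) by apply: bmB; [exact: bm_cst|exact: bm_indic].
rewrite /miss (@tprob_prod _ _ _ Pd n (fun=> (fun y : Pt => 1 - \1_C y))
  (fun=> 1 - Ex Pd (\1_C))); first last.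
- by move=> i; rewrite -Ex_EFin// ExB ?Ex_cst//; [exact: bm_cst|exact: bm_indic].
- by move=> i y; rewrite subr_ge0 indicE; case: (_ \in _).
- by move=> i; exact: bC.1.
rewrite lee_fin prodr_const card_ord -mulrN expRM_natl; apply: lerXn2r.
- rewrite nnegrE subr_ge0 -[leRHS](Ex_cst Pd).
  apply: Ex_le; [exact: bm_indic|exact: bm_cst|move=> y].
  by rewrite indicE; case: (_ \in _).
- by rewrite nnegrE expR_ge0.
- exact: expR_ge1Dx.
Qed.

Variables (K : finType) (v : K -> 'I_d -> R).
Hypothesis v1 : forall k, sqn (v k) = 1.
Hypothesis net : forall u, sqn u = 1 ->
  exists k, R0 ^+ 4 * sqn (fun i => u i - v k i) <= 1.

Local Notation C k := (cap (v k) (r + R0^-1) R0).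

(** One integrable majorant both for the indicator of [hvol <> fvol] and for the squared difference.
    The first sum pays for missed caps, where both volumes are at most (2 R0)^d, the second for far
    points. *)
Definition bad x : R := 4 ^+ d *
  (R0 ^+ (2 * d) * (\sum_k miss (C k) x) + \sum_(i < n) heavy R0 (tnth x i)).

Lemma bad_config x : hvol x <> fvol r R0 x ->
  (exists k, miss (C k) x = 1) \/ exists i, R0 ^+ 2 < sqn (cfg x i).
Proof.
move=> Vf; apply: contrapT => /not_orP[nk ni]; apply: Vf.
have xR i : sqn (cfg x i) <= R0 ^+ 2.
  by rewrite leNgt; apply/negP => h; apply: ni; exists i.
have hit k : exists i, C k (tnth x i).
  by apply: contrapT => h; apply: nk; exists k; apply: miss1 => i Ci; apply: h; exists i.
apply: hvol_fvol => // u.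
have [u0|un0] := eqVneq (nrm u) 0.
  have /sqn_eq0 -> : sqn u = 0 by rewrite -sqr_nrm u0 expr0n.
  have [k _] := net (sqn_e1 R d_gt0).
  have [i _] := hit k; exists i.
  by rewrite /nrm /sqn /dot !big1 ?sqrtr0 ?mulr0// => j _; rewrite ?mul0r// expr0n.
have n0 : 0 < nrm u by rewrite lt_neqAle eq_sym un0 nrm_ge0.
pose u' i := (nrm u)^-1 * u i.
have u'1 : sqn u' = 1 by rewrite /u' sqnZ -sqr_nrm -exprMn mulVf// expr1n.
have [k hk] := net u'1; have [i [h1 h2]] := hit k.
exists i; rewrite mulrC -ler_pdivlMl//.
have -> : (nrm u)^-1 * dot u (cfg x i) = dot u' (cfg x i) by rewrite dotC -dotZ dotC.
pose w j := u' j - v k j.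
have R0p : 0 < R0 by exact: lt_le_trans R01.
(* The net has precision R0^-2 and the point has norm at most R0, so passing from v_k to u' costs at
   most 1/R0. That is why the caps start at r + 1/R0. *)
have hw : nrm w * nrm (cfg x i) <= R0^-1.
  have w1 : nrm w <= R0 ^- 2.
    rewrite nrm_le ?invr_ge0 ?exprn_ge0// exprVn -exprM -[leRHS]mul1r.
    by rewrite ler_pdivlMr ?exprn_gt0// mulrC.
  apply: (@le_trans _ _ (R0 ^- 2 * R0)).
    by apply: ler_pM; rewrite ?nrm_ge0// nrm_le.
  by rewrite le_eqVlt; apply/orP; left; apply/eqP; field; rewrite gt_eqF.
have e : dot u' (cfg x i) = dot (v k) (cfg x i) - dot (fun j => - w j) (cfg x i).
  rewrite ![dot _ (cfg x i)]dotC -dotB; congr dot; apply/funext => j.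
  by rewrite /w; ring.
have h3 := dot_le_nrm (fun j => - w j) (cfg x i).
have nw : nrm (fun j => - w j) = nrm w.
  by rewrite /nrm /sqn; congr Num.sqrt; apply: eq_bigr => j _; rewrite sqrrN.
rewrite nw in h3; rewrite e.
have h1' : r + R0^-1 < dot (v k) (cfg x i) by exact: h1.
lra.
Qed.

Let S1_ge0 x : 0 <= \sum_k miss (C k) x.
Proof. by apply: sumr_ge0 => k _; exact: miss_ge0. Qed.

Let S2_ge0 x : 0 <= \sum_(i < n) heavy R0 (tnth x i).
Proof. by apply: sumr_ge0 => i _; exact: heavy_ge0. Qed.

Let bad_le x (c : R) : c <= R0 ^+ (2 * d) * (\sum_k miss (C k) x) +
  \sum_(i < n) heavy R0 (tnth x i) -> 4 ^+ d * c <= bad x.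
Proof. by move=> h; rewrite /bad ler_wpM2l// exprn_ge0. Qed.

Lemma bad_ge0 x : 0 <= bad x.
Proof. by rewrite /bad mulr_ge0 ?addr_ge0 ?mulr_ge0 ?exprn_ge0. Qed.

Let miss_part x k : miss (C k) x = 1 -> 4 ^+ d * R0 ^+ (2 * d) <= bad x.
Proof.
move=> m1; apply: bad_le; rewrite -[leLHS]addr0 lerD// ler_peMr ?exprn_ge0//.
rewrite (bigD1 k)//= m1 lerDl; apply: sumr_ge0 => j _; exact: miss_ge0.
Qed.

Let heavy_part x i : R0 ^+ 2 < sqn (cfg x i) -> 4 ^+ d * sqn (cfg x i) ^+ d <= bad x.
Proof.
move=> xi; apply: bad_le; rewrite -[leLHS]add0r lerD ?mulr_ge0 ?exprn_ge0//.
rewrite (bigD1 i)//= -[leLHS]addr0 lerD//; last first.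
  by apply: sumr_ge0 => j _; exact: heavy_ge0.
by rewrite /heavy indicE mem_set// mulr1.
Qed.

Lemma bad_ge1 x : hvol x <> fvol r R0 x -> 1 <= bad x.
Proof.
have h4 : 1 <= 4 ^+ d :> R by rewrite exprn_ege1// ler1n.
move=> /bad_config [[k /miss_part]|[i xi]].
  apply: le_trans; rewrite -[leLHS]mulr1; apply: ler_pM => //.
  by rewrite exprn_ege1.
apply: le_trans (heavy_part xi); rewrite -[leLHS]mulr1; apply: ler_pM => //.
rewrite exprn_ege1// (le_trans _ (ltW xi))// expr2.
by rewrite -[leLHS]mulr1; apply: ler_pM.
Qed.

Lemma bad_sqr x : (hvol x - fvol r R0 x) ^+ 2 <= bad x.
Proof.
have [e|Vf] := eqVneq (hvol x) (fvol r R0 x).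
  by rewrite e subrr expr0n bad_ge0.
have sub M : 0 <= M -> hvol x <= (2 * M) ^+ d -> fvol r R0 x <= (2 * M) ^+ d ->
    (hvol x - fvol r R0 x) ^+ 2 <= 4 ^+ d * (M ^+ 2) ^+ d.
  move=> M0 h1 h2.
  have -> : 4 ^+ d * (M ^+ 2) ^+ d = ((2 * M) ^+ d) ^+ 2.
    by rewrite -exprMn -exprM mulnC exprM; congr (_ ^+ d); ring.
  rewrite -real_normK ?num_real// ler_sqr ?nnegrE ?exprn_ge0 ?mulr_ge0//.
  have := hvol_ge0 x; have : 0 <= fvol r R0 x by exact: fvol_ge0.
  by rewrite ler_norml => a1 a2; apply/andP; split; lra.
have [[i0 xi0]|ni] := pselect (exists i, R0 ^+ 2 < sqn (cfg x i)).
  (* The farthest point bounds both volumes, and its own heavy term pays for the square. *)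
  case: (@Order.TotalTheory.arg_maxP _ _ 'I_n i0 xpredT (fun i => sqn (cfg x i))) => // i _ hi.
  have xi : R0 ^+ 2 < sqn (cfg x i) by apply: (lt_le_trans xi0); exact: hi.
  apply: le_trans (heavy_part xi); rewrite -sqr_nrm; apply: sub; first exact: nrm_ge0.
    by apply: hvol_le => [|j]; rewrite ?nrm_ge0// sqr_nrm; exact: hi.
  apply: (le_trans (fvol_le x)); apply: lerXn2r; rewrite ?nnegrE ?mulr_ge0 ?nrm_ge0//.
  by rewrite ler_wpM2l// ltW// nrm_gt.
have xR i : sqn (cfg x i) <= R0 ^+ 2.
  by rewrite leNgt; apply/negP => h; apply: ni; exists i.
case: (bad_config (elimN eqP Vf)) => [[k /miss_part]|//].
by apply: le_trans; rewrite exprM; apply: sub => //; [exact: hvol_le|exact: fvol_le].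
Qed.

Lemma measurable_bad : measurable_fun setT bad.
Proof.
apply: measurable_funM => //; apply: measurable_funD.
  apply: measurable_funM => //; apply: measurable_sum => k.
  by apply: measurable_miss; exact: measurable_cap.
apply: measurable_sum => i.
exact: (measurableT_comp (measurable_heavy R0) (measurable_tnth i)).
Qed.

Lemma integral_bad (p : R) : 2 <= R0 ^+ 2 -> 4 * d%:R <= R0 ^+ 2 ->
  (forall k, p <= Ex Pd (\1_(C k))) ->
  (\int[mu]_x (bad x)%:E <= (4 ^+ d * (R0 ^+ (2 * d) * (#|K|%:R * expR (- (n%:R * p))) +
     n%:R * (expR (1 / 2 - R0 ^+ 2 / 2) * R0 ^+ (3 * d))))%:E)%E.
Proof.
move=> R2 Rd hp.
have R0p : 0 < R0 by exact: lt_le_trans R01.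
have m1 k : measurable_fun setT (miss (C k)).
  by apply: measurable_miss; exact: measurable_cap.
have m2 i : measurable_fun setT (fun x : Om => heavy R0 (tnth x i)).
  exact: (measurableT_comp (measurable_heavy R0) (measurable_tnth i)).
have e1 : (\int[mu]_x (\sum_k miss (C k) x)%:E <= (#|K|%:R * expR (- (n%:R * p)))%:E)%E.
  under eq_integral do rewrite -sumEFin.
  rewrite ge0_integral_sum//; last 2 first.
  - by move=> k; apply/measurable_EFinP.
  - by move=> k x _; rewrite lee_fin miss_ge0.
  apply: (@le_trans _ _ (\sum_(k : K) (expR (- (n%:R * p)))%:E)%E).
    apply: lee_sum => k _; apply: (le_trans (integral_miss (measurable_cap _ _ _))).
    by rewrite lee_fin ler_expR lerN2 ler_wpM2l.
  by rewrite sumEFin lee_fin sumr_const -[leLHS]mulr_natl.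
have e2 : (\int[mu]_x (\sum_(i < n) heavy R0 (tnth x i))%:E <=
    (n%:R * (expR (1 / 2 - R0 ^+ 2 / 2) * R0 ^+ (3 * d)))%:E)%E.
  under eq_integral do rewrite -sumEFin.
  rewrite ge0_integral_sum//; last 2 first.
  - by move=> k; apply/measurable_EFinP.
  - by move=> k x _; rewrite lee_fin heavy_ge0.
  rewrite -sum_cst_ord -sumEFin; apply: lee_sum => i _.
  rewrite (@integral_tnth _ _ _ Pd n i (fun y => (heavy R0 y)%:E)); last 2 first.
  - by apply/measurable_EFinP; exact: measurable_heavy.
  - by move=> y; rewrite lee_fin heavy_ge0.
  exact: gauss_tail.
have mS1 : measurable_fun setT (fun x => (\sum_k miss (C k) x)%:E).
  by apply/measurable_EFinP; exact: measurable_sum.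
have mS2 : measurable_fun setT (fun x : Om => (\sum_(i < n) heavy R0 (tnth x i))%:E).
  by apply/measurable_EFinP; exact: measurable_sum.
have c1 : (0 <= (4 ^+ d)%:E :> \bar R)%E by rewrite lee_fin exprn_ge0.
have c2 : (0 <= (R0 ^+ (2 * d))%:E)%E by rewrite lee_fin exprn_ge0.
have p1 (x : Om) : setT x -> (0 <= (\sum_k miss (C k) x)%:E)%E by rewrite lee_fin.
have p2 (x : Om) : setT x -> (0 <= (\sum_(i < n) heavy R0 (tnth x i))%:E)%E by rewrite lee_fin.
rewrite /bad; under eq_integral do rewrite EFinM EFinD EFinM.
rewrite ge0_integralZl//; last 2 first.
- by apply: emeasurable_funD => //; apply: measurable_funeM.
- by move=> x _; rewrite adde_ge0// ?mule_ge0// ?p1// p2.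
rewrite ge0_integralD//; last 2 first.
- by move=> x _; rewrite mule_ge0// p1.
- exact: measurable_funeM.
rewrite ge0_integralZl// EFinM EFinD EFinM.
by apply: lee_wpmul2l => //; apply: leeD => //; apply: lee_wpmul2l.
Qed.

End polytope_volume.

(** * Lower bound for the probability of a cap *)

Section cap_probability.
Context (R : realType) (d : nat).
Hypothesis d_gt0 : (0 < d)%N.
Local Notation B := (measurableTypeR R).
Local Notation N := (@normal_prob R 0 1).
Local Notation Pt := (d.-tuple B).
Local Notation Pd := (tprob N d).

Lemma prob_cap_ge (v : 'I_d -> R) (a R0 : R) : sqn v = 1 ->
  d%:R ^+ 2 * (1 + d%:R) <= a -> (a + 2 / a) ^+ 2 + 1 <= R0 ^+ 2 ->
  normal_peak (1 : R) ^+ d * expR (- (((a + 2 / a) ^+ 2 + 1) / 2)) *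
    ((2 * (d%:R ^+ 2 * (1 + d%:R))^-1) ^+ d.-1 * a^-1) <= Ex Pd (\1_(cap v a R0)).
Proof.
set D := d%:R ^+ 2 * (1 + d%:R); move=> v1 Da aR.
have D0 : 0 < D by rewrite /D mulr_gt0 ?exprn_gt0 ?ltr0n// ltr_pwDl.
have a0 : 0 < a by exact: lt_le_trans Da.
have ai0 : 0 < a^-1 by rewrite invr_gt0.
have aD : a^-1 <= D^-1 by rewrite lef_pV2 ?posrE.
(* Height between a + 1/a and a + 2/a and cross radius 1: inside the cap, and squared norm at most
   (a + 2/a)^2 + 1. *)
pose S := slab v (a + a^-1) a^-1 (D * D^-1).
have mS : measurable S by exact: measurable_slab.
have bS : sqn_bounded S by exact: bounded_slab.
have S_sqn z : S z -> a + a^-1 <= dot v (vec z) /\ sqn (vec z) <= (a + 2 / a) ^+ 2 + 1.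
  move=> [/andP[h1 h2]]; rewrite divff ?gt_eqF// expr1n sqnB dotZ sqnZ v1 dotC => h3.
  split=> //; set t := dot v (vec z) in h1 h2 h3 *.
  have h4 : t <= a + 2 / a by lra.
  have : t ^+ 2 <= (a + 2 / a) ^+ 2.
    have t0 : 0 <= t by apply: le_trans h1; rewrite addr_ge0// ltW.
    by rewrite ler_sqr ?nnegrE//; exact: le_trans h4.
  by have := sqr_ge0 (t - (a + a^-1)); lra.
pose s := Num.sqrt ((a + 2 / a) ^+ 2 + 1).
have s2 : s ^+ 2 = (a + 2 / a) ^+ 2 + 1 by rewrite sqr_sqrtr// addr_ge0// sqr_ge0.
apply: (@le_trans _ _ (Ex Pd (\1_S))); last first.
  apply: Ex_le; [exact: bm_indic|by apply: bm_indic; exact: measurable_cap|move=> z].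
  apply: indic_le => /S_sqn [h1 h2]; split; last exact: le_trans aR.
  by apply: lt_le_trans h1; rewrite ltrDl.
apply: le_trans (prob_ge_vol (s := s) mS bS _); last first.
  by move=> z /S_sqn[_]; rewrite s2.
rewrite s2 ler_wpM2l ?mulr_ge0 ?exprn_ge0 ?expR_ge0 ?normal_peak_ge0//.
by apply: slab_vol => //; exact: ltW.
Qed.

End cap_probability.

(** * Transfer of the limit law *)

Section Phi_affine.
Context (R : realType).

Lemma Phi_ge0 (t : R) : 0 <= Phi t.
Proof. by rewrite Phi_Ex; apply: Ex_ge0 => x; rewrite indicE. Qed.

Lemma Phi_le1 (t : R) : Phi t <= 1.
Proof.
rewrite Phi_Ex -[leRHS](Ex_cst (@normal_prob R 0 1)).
apply: Ex_le; [exact: bm_le|exact: bm_cst|move=> x].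
by rewrite indicE; case: (_ \in _).
Qed.

Lemma Phi_dist (s t : R) : `|Phi s - Phi t| <= `|s - t|.
Proof.
have [st|/ltW ts] := leP s t.
  rewrite distrC (distrC s) !ger0_norm ?subr_ge0 ?Phi_mono//.
  by rewrite lerBlDl Phi_lip.
by rewrite !ger0_norm ?subr_ge0 ?Phi_mono// lerBlDl Phi_lip.
Qed.

(** For bounded t the Lipschitz bound suffices. For large |t| both arguments lie in the same tail,
    because s >= 1/2 and |m| <= 1/2. *)
Lemma Phi_affine (e : R) : 0 < e -> exists2 eta : R, 0 < eta <= 1 / 2 &
  forall s m t, `|s - 1| <= eta -> `|m| <= eta -> `|Phi (s * t + m) - Phi t| <= e.
Proof.
move=> e0; have [B B1 [Bl Br]] := normal_tail e0.
pose eta := Num.min (1 / 2) (e / (2 * B + 3)).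
have B3 : 0 < 2 * B + 3 by lra.
have eta0 : 0 < eta by rewrite lt_min divr_gt0// divr_gt0.
have eta2 : eta <= 1 / 2 by rewrite ge_min lexx.
have etaB : eta * (2 * B + 3) <= e by rewrite -ler_pdivlMr// ge_min lexx orbT.
exists eta; first by rewrite eta0 eta2.
move=> s m t hs hm.
have := hs; rewrite ler_norml => /andP[s1 s2].
have := hm; rewrite ler_norml => /andP[m1 m2].
have P0 := Phi_ge0; have P1 := Phi_le1.
have [tB|tB] := leP `|t| (2 * B + 2).
  apply: (le_trans (Phi_dist _ _)); apply: le_trans etaB.
  have -> : s * t + m - t = (s - 1) * t + m by ring.
  apply: (le_trans (ler_normD _ _)); rewrite normrM.
  have : `|s - 1| * `|t| <= eta * (2 * B + 2) by apply: ler_pM.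
  lra.
have [t0|t0] := leP 0 t.
  rewrite ger0_norm// in tB.
  have hB : B <= s * t + m by nra.
  have := Phi_mono hB; have := Phi_mono (_ : B <= t) => /(_ _) h.
  have := h ltac:(lra); have := P1 t; have := P1 (s * t + m).
  by rewrite ler_norml; lra.
rewrite ltr0_norm// in tB.
have hB : s * t + m <= - B by nra.
have := Phi_mono hB; have := Phi_mono (_ : t <= - B) => /(_ _) h.
have := h ltac:(lra); have := P0 t; have := P0 (s * t + m).
by rewrite ler_norml; lra.
Qed.

End Phi_affine.

Lemma sqrt_ratio_close (R : realType) (v w eta : R) : 0 < v -> 0 < eta <= 1 / 2 ->
  (1 - eta) * v <= w <= (1 + eta) * v -> `|Num.sqrt w / Num.sqrt v - 1| <= eta.
Proof.
move=> v0 /andP[e0 e1] /andP[h1 h2].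
have w0 : 0 < w by apply: lt_le_trans h1; rewrite mulr_gt0//; lra.
set s := Num.sqrt w / Num.sqrt v.
have s0 : 0 < s by rewrite divr_gt0 ?sqrtr_gt0.
have s2 : s ^+ 2 = w / v by rewrite expr_div_n !sqr_sqrtr// ltW.
have a1 : 1 - eta <= s ^+ 2 by rewrite s2 ler_pdivlMr.
have a2 : s ^+ 2 <= 1 + eta by rewrite s2 ler_pdivrMr.
move: s s0 s2 a1 a2 => s s0 _ a1 a2.
by rewrite ler_norml; apply/andP; split; nra.
Qed.

Lemma standardize_le (R : realType) (w a b t s s' : R) : 0 < s -> 0 < s' ->
  ((w - a) / s <= t) = ((w - b) / s' <= s / s' * t + (a - b) / s').
Proof.
move=> s0 s0'; have -> : s / s' * t + (a - b) / s' = (s * t + (a - b)) / s' by ring.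
by rewrite ler_pdivrMr// ler_pM2r ?invr_gt0//; apply/idP/idP; lra.
Qed.

Section transfer.
Context (R : realType) d (T : measurableType d) (mu : probability T R).
(** [f] is the truncated functional, [V] the true one, and [Psi] controls both their squared
    difference and the event that they differ. *)
Variables (f V Psi : T -> R) (beta eta : R).
Hypothesis bf : bm f.
Hypothesis mV : measurable_fun setT V.
Hypothesis mPsi : measurable_fun setT Psi.
Hypothesis Psi0 : forall x, 0 <= Psi x.
Hypothesis Psi_sqr : forall x, (V x - f x) ^+ 2 <= Psi x.
Hypothesis Psi_neq : forall x, V x <> f x -> 1 <= Psi x.
Hypothesis int_Psi : (\int[mu]_x (Psi x)%:E <= beta%:E)%E.
Local Notation v := (Ex mu (fun x => (f x - Ex mu f) ^+ 2)).
Local Notation EV := (Ex mu V).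
Local Notation VV := (Ex mu (fun x => (V x - EV) ^+ 2)).
Hypothesis v_gt0 : 0 < v.
Hypothesis eta0 : 0 < eta <= 1 / 2.
Hypothesis beta_v : beta <= eta ^+ 2 * v / 32.

Local Notation integ g := (mu.-integrable setT (EFin \o g)).

Let iPsi : integ Psi.
Proof.
apply/integrableP; split; first exact/measurable_EFinP.
under eq_integral do rewrite /= ger0_norm//.
by rewrite (le_lt_trans int_Psi)// ltry.
Qed.

Let if_ g : bm g -> integ g. Proof. exact: bm_integrable. Qed.

Let idom (g h : T -> R) : measurable_fun setT g -> integ h -> (forall x, `|g x| <= h x) -> integ g.
Proof.
move=> mg ih gh; apply: (le_integrable measurableT _ _ ih).
  exact/measurable_EFinP.
by move=> x _ /=; rewrite lee_fin (le_trans (gh x))// ler_norm.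
Qed.

Let iD g h : integ g -> integ h -> integ (fun x => g x + h x).
Proof. by move=> ig ih; have := integrableD measurableT ig ih. Qed.

Let iZ c g : integ g -> integ (fun x => c * g x).
Proof. by move=> ig; have := integrableZl measurableT c ig. Qed.

Let ED g h : integ g -> integ h -> Ex mu (fun x => g x + h x) = Ex mu g + Ex mu h.
Proof. by move=> ig ih; rewrite /Ex RintegralD. Qed.

Let EZ c g : integ g -> Ex mu (fun x => c * g x) = c * Ex mu g.
Proof. by move=> ig; rewrite /Ex RintegralZl. Qed.

Let Ele g h : integ g -> integ h -> (forall x, g x <= h x) -> Ex mu g <= Ex mu h.
Proof. by move=> ig ih gh; apply: le_Rintegral. Qed.

Let EPsi_ge0 : 0 <= Ex mu Psi. Proof. exact: Ex_ge0. Qed.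

Let EPsi : Ex mu Psi <= beta.
Proof.
rewrite -lee_fin /Ex /Rintegral fineK//.
exact: (integrable_fin_num measurableT iPsi).
Qed.

Let D x := V x - f x.
Let mf : measurable_fun setT f. Proof. exact: bf.1. Qed.
Let mD : measurable_fun setT D. Proof. exact: measurable_funB. Qed.

(** Young's inequality with a free parameter replaces Cauchy-Schwarz, as [V] may be unbounded; c is
    later set to the target size of the mean shift. *)
Let D_le (c : R) x : 0 < c -> `|D x| <= c / 2 + (2 * c)^-1 * Psi x.
Proof.
move=> c0; have h := Psi_sqr x; rewrite -/(D x) -real_normK ?num_real// in h.
have : 0 <= (`|D x| - c) ^+ 2 by exact: sqr_ge0.
have -> : c / 2 + (2 * c)^-1 * Psi x = (c ^+ 2 + Psi x) / (2 * c).
  by field; rewrite gt_eqF.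
rewrite ler_pdivlMr ?mulr_gt0//; nra.
Qed.

Let iDif : integ D.
Proof.
apply: (idom (h := fun x => 1 / 2 + (2 * 1)^-1 * Psi x)) => // [|x].
  by apply: iD; [apply: if_; exact: bm_cst|exact: iZ].
exact: D_le.
Qed.

Let m' := Ex mu D.

Let EVE : EV = Ex mu f + m'.
Proof.
rewrite /m' -ED//; last exact: if_.
by congr Ex; apply/funext => x; rewrite /D; ring.
Qed.

Let m'_le (c : R) : 0 < c -> `|m'| <= c / 2 + (2 * c)^-1 * beta.
Proof.
move=> c0; have : `|m'| <= Ex mu (fun x => `|D x|) by exact: le_normr_Rintegral.
move=> h; apply: (le_trans h).
have ic : integ (fun=> c / 2) by apply: if_; exact: bm_cst.
have iP : integ (fun x => (2 * c)^-1 * Psi x) by exact: iZ.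
apply: (@le_trans _ _ (Ex mu (fun x => c / 2 + (2 * c)^-1 * Psi x))).
  apply: Ele; [|exact: iD|by move=> x; exact: D_le].
  apply: (idom (h := fun x => c / 2 + (2 * c)^-1 * Psi x)).
  - exact: measurableT_comp.
  - exact: iD.
  - by move=> x; rewrite normr_id; exact: D_le.
by rewrite ED// Ex_cst EZ// lerD2l ler_wpM2l// invr_ge0 mulr_ge0// ltW.
Qed.

Let m'2 : m' ^+ 2 <= eta ^+ 2 * v / 32.
Proof.
case/andP: eta0 => eta_gt0 _.
pose c := Num.sqrt (eta ^+ 2 * v / 32).
have c0 : 0 < c by rewrite sqrtr_gt0 divr_gt0// mulr_gt0// exprn_gt0.
have c2 : c ^+ 2 = eta ^+ 2 * v / 32.
  by rewrite sqr_sqrtr// divr_ge0// mulr_ge0 ?sqr_ge0// ltW.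
rewrite -c2 -real_normK ?num_real// ler_sqr ?nnegrE ?(ltW c0)//.
apply: (le_trans (m'_le c0)).
have : (2 * c)^-1 * beta <= c / 2.
  rewrite mulrC ler_pdivrMr ?mulr_gt0//; apply: (le_trans beta_v); rewrite -c2.
  by rewrite expr2; lra.
lra.
Qed.

Let bf2 : bm (fun x => (f x - Ex mu f) ^+ 2).
Proof. by apply: bmX; apply: bmB => //; exact: bm_cst. Qed.

Let pw x : (V x - EV) ^+ 2 <= (1 + eta / 2) * (f x - Ex mu f) ^+ 2 +
    (4 / eta * (2 * Psi x) + 4 / eta * (2 * m' ^+ 2)) /\
  (1 - eta / 2) * (f x - Ex mu f) ^+ 2 -
    (4 / eta * (2 * Psi x) + 4 / eta * (2 * m' ^+ 2)) <= (V x - EV) ^+ 2.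
Proof.
case/andP: eta0 => e0 e1.
have -> : V x - EV = (f x - Ex mu f) + (D x - m') by rewrite EVE /D; ring.
set a := f x - _; set b := D x - m'.
have hb : b ^+ 2 <= 2 * Psi x + 2 * m' ^+ 2.
  by have := Psi_sqr x; rewrite -/(D x) /b; have := sqr_ge0 (D x + m'); nra.
have i0 : 0 < eta^-1 by rewrite invr_gt0.
have ee : eta * eta^-1 = 1 by rewrite divff// gt_eqF.
have i2 : 2 <= eta^-1 by nra.
have b0 := sqr_ge0 b; have a0 := sqr_ge0 a.
have key : `|2 * (a * b)| <= eta / 2 * a ^+ 2 + 2 / eta * b ^+ 2.
  have h1 := sqr_ge0 (eta / 2 * a - b); have h2 := sqr_ge0 (eta / 2 * a + b).
  have h1' : 0 <= 2 / eta * (eta / 2 * a - b) ^+ 2 by rewrite mulr_ge0// divr_ge0// ltW.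
  have h2' : 0 <= 2 / eta * (eta / 2 * a + b) ^+ 2 by rewrite mulr_ge0// divr_ge0// ltW.
  have e3 : 2 / eta * (eta / 2 * a - b) ^+ 2 =
    eta / 2 * a ^+ 2 + 2 / eta * b ^+ 2 - 2 * (a * b) by field; rewrite gt_eqF.
  have e4 : 2 / eta * (eta / 2 * a + b) ^+ 2 =
    eta / 2 * a ^+ 2 + 2 / eta * b ^+ 2 + 2 * (a * b) by field; rewrite gt_eqF.
  by rewrite ler_norml; apply/andP; split; lra.
move: key; rewrite ler_norml => /andP[k1 k2].
have hb2 : 4 / eta * b ^+ 2 <= 4 / eta * (2 * Psi x) + 4 / eta * (2 * m' ^+ 2).
  by rewrite -mulrDr ler_wpM2l// divr_ge0// ltW.
have hb3 : b ^+ 2 <= 2 / eta * b ^+ 2.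
  by rewrite -[leLHS]mul1r ler_wpM2r//; lra.
have e5 : 4 / eta * b ^+ 2 = 2 / eta * b ^+ 2 + 2 / eta * b ^+ 2 by ring.
have e6 : (a + b) ^+ 2 = a ^+ 2 + 2 * (a * b) + b ^+ 2 by ring.
by split; rewrite e6; lra.
Qed.

Let iW : integ (fun x => 4 / eta * (2 * Psi x) + 4 / eta * (2 * m' ^+ 2)).
Proof. by apply: iD; [apply: iZ; exact: iZ|apply: if_; exact: bm_cst]. Qed.

(** The factor 1/32 in [beta_v] is chosen here: (4 / eta) 4 (eta^2 v / 32) = eta v / 2. *)
Let EW : Ex mu (fun x => 4 / eta * (2 * Psi x) + 4 / eta * (2 * m' ^+ 2)) <= eta / 2 * v.
Proof.
case/andP: eta0 => e0 e1.
rewrite ED; [|by apply: iZ; exact: iZ|by apply: if_; exact: bm_cst].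
rewrite Ex_cst EZ; last exact: iZ.
rewrite EZ//.
have i0 : 0 <= 4 / eta by rewrite divr_ge0// ltW.
have h : 4 / eta * (2 * Ex mu Psi) + 4 / eta * (2 * m' ^+ 2) <=
    4 / eta * (4 * (eta ^+ 2 * v / 32)).
  by rewrite -mulrDr ler_wpM2l//; have := le_trans EPsi beta_v; have := m'2; lra.
apply: (le_trans h); rewrite le_eqVlt; apply/orP; left; apply/eqP; field.
by rewrite gt_eqF.
Qed.

Let iV : integ (fun x => (V x - EV) ^+ 2).
Proof.
apply: (idom (h := fun x => (1 + eta / 2) * (f x - Ex mu f) ^+ 2 +
    (4 / eta * (2 * Psi x) + 4 / eta * (2 * m' ^+ 2)))).
- by apply: measurable_funX; apply: measurable_funB.
- by apply: iD => //; apply: iZ; exact: if_.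
- by move=> x; rewrite ger0_norm ?sqr_ge0//; case: (pw x).
Qed.

#[local] Opaque Ex.

Lemma transfer_var : (1 - eta) * v <= VV <= (1 + eta) * v.
Proof.
have if2 := if_ bf2.
have EW' := EW.
apply/andP; split.
  apply: (@le_trans _ _ (Ex mu (fun x => (1 - eta / 2) * (f x - Ex mu f) ^+ 2 +
      (-1) * (4 / eta * (2 * Psi x) + 4 / eta * (2 * m' ^+ 2))))).
    rewrite ED ?EZ//; [|exact: iZ|exact: iZ].
    by set w := Ex mu (fun x => _ + _) in EW' *; move: EW'; lra.
  apply: Ele => //; first by apply: iD; exact: iZ.
  by move=> x; rewrite mulN1r; case: (pw x).
apply: (@le_trans _ _ (Ex mu (fun x => (1 + eta / 2) * (f x - Ex mu f) ^+ 2 +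
      (4 / eta * (2 * Psi x) + 4 / eta * (2 * m' ^+ 2))))).
  apply: Ele => //; first by apply: iD => //; exact: iZ.
  by move=> x; case: (pw x).
rewrite ED ?EZ//; last exact: iZ.
by set w := Ex mu (fun x => _ + _) in EW' *; move: EW'; lra.
Qed.

Local Notation sf := (Num.sqrt v).
Local Notation sV := (Num.sqrt VV).

Let sf0 : 0 < sf. Proof. by rewrite sqrtr_gt0. Qed.

Let VV0 : 0 < VV.
Proof.
case/andP: eta0 => e0 e1; case/andP: transfer_var => h _.
by apply: lt_le_trans h; rewrite mulr_gt0//; lra.
Qed.

Let sV0 : 0 < sV. Proof. by rewrite sqrtr_gt0. Qed.

Lemma transfer_scale : `|sV / sf - 1| <= eta.
Proof. by apply: sqrt_ratio_close transfer_var. Qed.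

Lemma transfer_shift : `|(EV - Ex mu f) / sf| <= eta.
Proof.
case/andP: eta0 => e0 e1.
apply: le_of_sqr; first exact: ltW.
rewrite real_normK ?num_real// EVE addrAC subrr add0r expr_div_n (sqr_sqrtr (ltW v_gt0)).
rewrite (ler_pdivrMr _ _ v_gt0); apply: (le_trans m'2).
have : 0 <= eta ^+ 2 * v := mulr_ge0 (sqr_ge0 eta) (ltW v_gt0).
by move: (_ * v) => w; lra.
Qed.

(** The two events are the same condition, after an affine change of the level, wherever V = f; they
    differ with probability at most the mean of [Psi]. *)
Lemma transfer_law t :
  `|Ex mu (\1_[set x | (V x - EV) / sV <= t]) -
    Ex mu (fun x => \1_[set u | u <= sV / sf * t + (EV - Ex mu f) / sf]
                      ((f x - Ex mu f) / sf))| <= beta.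
Proof.
set E := [set x | _]; set t' := sV / sf * t + (EV - Ex mu f) / sf.
pose F := [set x | (f x - Ex mu f) / sf <= t'].
have mE : measurable E.
  apply: measurable_le_fun => //; apply: measurable_funM => //.
  exact: measurable_funB.
have mF : measurable F.
  apply: measurable_le_fun => //; apply: measurable_funM => //.
  exact: measurable_funB.
have -> : (fun x => \1_[set u | u <= t'] ((f x - Ex mu f) / sf)) = (\1_F : T -> R).
  by apply/funext => x; rewrite !indicE; congr (nat_of_bool _)%:R; apply/idP/idP; rewrite !inE.
have bE : bm (\1_E : T -> R) by exact: bm_indic.
have bF : bm (\1_F : T -> R) by exact: bm_indic.
rewrite -ExB//.
have bEF : bm (fun x => \1_E x - \1_F x : R) by exact: bmB.
apply: (le_trans (Ex_norm mu bEF)); apply: le_trans EPsi.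
apply: Ele => //; first by apply: if_; exact: bm_norm.
move=> x; have [e|/eqP Vf] := eqVneq (V x) (f x).
  suff -> : \1_E x = \1_F x :> R by rewrite subrr normr0.
  have h := standardize_le (V x) EV (Ex mu f) t sV0 sf0; rewrite e in h.
  rewrite !indicE; congr (nat_of_bool _)%:R; apply/idP/idP; rewrite !inE /E /F /= e.
    exact (fun H => eq_ind _ is_true H _ h).
  exact (fun H => eq_ind_r is_true H h).
apply: le_trans (Psi_neq Vf); rewrite !indicE.
by case: (x \in E); case: (x \in F); rewrite ?subrr ?subr0 ?sub0r ?normr0 ?normrN ?normr1.
Qed.

End transfer.

#[local] Transparent Ex.

(** * Explicit conditions for a fixed sample size *)

Section bounds.
Context (R : realType) (d : nat).

Definition shell_prob (r R0 : R) : R := expR (- (r ^+ 2 / 2)) *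
  (d%:R * ((2 * R0) ^+ d.-1 * (2 * d%:R * (R0 ^+ 2 - r ^+ 2) / r))).

Definition outer_prob (a : R) : R := normal_peak (1 : R) ^+ d *
  expR (- ((a + 2 / a) ^+ 2 / 2)) * ((a / d%:R) ^+ d.-1 * (2 * a)^-1).

Definition cap_prob (a : R) : R := normal_peak (1 : R) ^+ d *
  expR (- (((a + 2 / a) ^+ 2 + 1) / 2)) *
  ((2 * (d%:R ^+ 2 * (1 + d%:R))^-1) ^+ d.-1 * a^-1).

(** [x] is the sample size as a real number, so that the bound can be followed along a real
    parameter; the power of 2m + 1 is the size of the net. *)
Definition bad_bound (x : R) (m : nat) (r R0 : R) : R := 4 ^+ d *
  (R0 ^+ (2 * d) * (((2 * m).+1 ^ d)%:R * expR (- (x * cap_prob (r + R0^-1)))) +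
   x * (expR (1 / 2 - R0 ^+ 2 / 2) * R0 ^+ (3 * d))).

End bounds.

(** Each error term receives half of 1/K. The hypotheses are squared so that only integer powers
    have to be compared later. *)
Lemma stein_arith (R : realType) (K X Z v : R) : 0 < K -> 0 < v ->
  X * (4 * K ^+ 4) <= v ^+ 2 -> Z ^+ 2 * (4 * K ^+ 4) <= v ^+ 3 ->
  K * Num.sqrt X / v + K * Z / Num.sqrt v ^+ 3 <= K^-1.
Proof.
move=> K0 v0 hX hZ.
have K4 : 0 < 4 * K ^+ 4 by rewrite mulr_gt0// exprn_gt0.
have s0 : 0 < Num.sqrt v by rewrite sqrtr_gt0.
have K2 : 0 < 2 * K ^+ 2 by rewrite mulr_gt0// exprn_gt0.
have h1 : Num.sqrt X <= v / (2 * K ^+ 2).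
  apply: le_of_sqr; first by rewrite divr_ge0// ltW.
  have [X0|X0] := leP 0 X; last by rewrite ltr0_sqrtr// expr0n sqr_ge0.
  rewrite sqr_sqrtr// expr_div_n.
  have -> : (2 * K ^+ 2) ^+ 2 = 4 * K ^+ 4 by ring.
  by rewrite ler_pdivlMr.
have h2 : Z <= Num.sqrt v ^+ 3 / (2 * K ^+ 2).
  apply: le_of_sqr; first by rewrite divr_ge0 ?exprn_ge0// ltW.
  have -> : (Num.sqrt v ^+ 3 / (2 * K ^+ 2)) ^+ 2 = (Num.sqrt v ^+ 2) ^+ 3 / (4 * K ^+ 4).
    by field; rewrite gt_eqF.
  by rewrite sqr_sqrtr ?(ltW v0)// ler_pdivlMr.
have e1 : K * Num.sqrt X / v <= K^-1 / 2.
  rewrite ler_pdivrMr//.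
  have -> : K^-1 / 2 * v = K * (v / (2 * K ^+ 2)) by field; rewrite gt_eqF.
  by rewrite ler_wpM2l// ltW.
have e2 : K * Z / Num.sqrt v ^+ 3 <= K^-1 / 2.
  rewrite ler_pdivrMr ?exprn_gt0//.
  have -> : K^-1 / 2 * Num.sqrt v ^+ 3 = K * (Num.sqrt v ^+ 3 / (2 * K ^+ 2)).
    by field; rewrite gt_eqF.
  by rewrite ler_wpM2l// ltW.
lra.
Qed.

Lemma stein_arith_mono (R : realType) (K x y dl w v0 v : R) : 0 < K -> 0 < v0 ->
  v0 <= v -> x <= y -> 0 <= x -> 0 <= dl ->
  y * dl ^+ 4 * w ^+ 2 * (120 * K ^+ 4) <= v0 ^+ 2 ->
  (y * dl ^+ 3) ^+ 2 * (16 * K ^+ 4) <= v0 ^+ 3 ->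
  K * Num.sqrt (30 * x * dl ^+ 4 * w ^+ 2) / v + K * (2 * x * dl ^+ 3) / Num.sqrt v ^+ 3
    <= K^-1.
Proof.
move=> K0 v00 vv xy x0 dl0 h1 h2.
have v1 : 0 < v by exact: lt_le_trans vv.
have y0 : 0 <= y by exact: le_trans xy.
have K4 : 0 <= K ^+ 4 by rewrite exprn_ge0// ltW.
apply: stein_arith => //.
  apply: (@le_trans _ _ (v0 ^+ 2)); last by rewrite ler_sqr ?nnegrE// ltW.
  apply: le_trans h1.
  have -> : 30 * x * dl ^+ 4 * w ^+ 2 * (4 * K ^+ 4) = x * (dl ^+ 4 * w ^+ 2 * (120 * K ^+ 4)).
    by ring.
  rewrite -!(mulrA y) ler_wpM2r//.
  by apply: mulr_ge0; [rewrite mulr_ge0 ?sqr_ge0 ?exprn_ge0|rewrite mulr_ge0].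
apply: (@le_trans _ _ (v0 ^+ 3)); last by apply: lerXn2r; rewrite ?nnegrE// ltW.
apply: le_trans h2.
have -> : (2 * x * dl ^+ 3) ^+ 2 * (4 * K ^+ 4) = (x * dl ^+ 3) ^+ 2 * (16 * K ^+ 4) by ring.
have d3 : 0 <= dl ^+ 3 by exact: exprn_ge0.
apply: ler_wpM2r; first exact: mulr_ge0.
apply: lerXn2r; rewrite ?nnegrE; [exact: mulr_ge0|exact: mulr_ge0|].
exact: ler_wpM2r.
Qed.

Lemma sqr_div_sqrt (R : realType) (x v : R) : 0 <= v -> (x / Num.sqrt v) ^+ 2 = v^-1 * x ^+ 2.
Proof. by move=> v0; rewrite expr_div_n sqr_sqrtr// mulrC. Qed.

Lemma dist3_le (R : realDomainType) (w x y z e : R) :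
  `|w - x| <= e -> `|x - y| <= e -> `|y - z| <= e -> `|w - z| <= 3 * e.
Proof. by rewrite !ler_norml; lra. Qed.

Section finite_sample.
Context (R : realType) (d n : nat).
Hypothesis d_gt0 : (0 < d)%N.
Local Notation B := (measurableTypeR R).
Local Notation N := (@normal_prob R 0 1).
Local Notation Pt := (d.-tuple B).
Local Notation Pd := (tprob N d).
Local Notation Om := (n.-tuple Pt).
Local Notation mu := (tprob Pd n).

Lemma volK_ge0 (x : 'I_n -> 'I_d -> R) : 0 <= volK x.
Proof.
rewrite /volK /Vol fine_ge0//; apply: iprod_ge0 => [g g0|y]; first exact: integral_ge0.
by rewrite lee_fin.
Qed.

Lemma Esample_volK : Esample (@volK R d n) = Ex mu (@hvol R d n).
Proof.
rewrite /Esample gauss_sample_intE; last by move=> x; rewrite lee_fin volK_ge0.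
  by congr fine; apply: eq_integral => x _; rewrite volKE.
apply/measurable_EFinP; under eq_fun do rewrite volKE; exact: measurable_hvol.
Qed.

Lemma Varsample_volK : Varsample (@volK R d n) =
  Ex mu (fun x => (hvol x - Ex mu (@hvol R d n)) ^+ 2).
Proof.
rewrite /Varsample gauss_sample_intE; last by move=> x; rewrite lee_fin sqr_ge0.
  by congr fine; apply: eq_integral => x _; rewrite volKE Esample_volK.
apply/measurable_EFinP; under eq_fun do rewrite volKE.
by apply: measurable_funX; apply: measurable_funB => //; exact: measurable_hvol.
Qed.

Definition std_hvol (x : Om) : R := (hvol x - Ex mu (@hvol R d n)) /
  Num.sqrt (Ex mu (fun x => (hvol x - Ex mu (@hvol R d n)) ^+ 2)).

Lemma Psample_volK t : Psample [set x : 'I_n -> 'I_d -> R |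
    (volK x - Esample (@volK R d n)) / Num.sqrt (Varsample (@volK R d n)) <= t] =
  Ex mu (\1_[set x | std_hvol x <= t]).
Proof.
rewrite /Psample Esample_volK Varsample_volK gauss_sample_intE; last first.
- by move=> x; rewrite lee_fin indicE.
- apply/measurable_EFinP.
  rewrite (_ : (fun x : Om => _) = (\1_[set x | std_hvol x <= t] : Om -> R)).
    apply: measurable_indic; apply: measurable_le_fun => //.
    apply: measurable_funM => //; apply: measurable_funB => //; exact: measurable_hvol.
  apply/funext => x; rewrite !indicE; congr (nat_of_bool _)%:R.
  by apply/idP/idP; rewrite !inE /= volKE.
congr fine; apply: eq_integral => x _; rewrite !indicE; congr (nat_of_bool _)%:R%:E.
by apply/idP/idP; rewrite !inE /= volKE.
Qed.

Variables r R0 rho a rho2 rs k : R.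
Hypothesis r_gt0 : 0 < r.
Hypothesis ra : r <= a.
Hypothesis a2 : 2 <= a.
Hypothesis aR : a + 2 / a <= R0.
Hypothesis rho_ge0 : 0 <= rho.
Hypothesis rhoE : 16 * (R0 ^+ 2 - r ^+ 2) <= rho ^+ 2.
Hypothesis rho2_ge0 : 0 <= rho2.
Hypothesis rho2E : R0 ^+ 2 - a ^+ 2 <= rho2 ^+ 2.
Hypothesis k_ge0 : 0 <= k.
Hypothesis krs : k <= rs.
Hypothesis ka : k <= (4 * a)^-1.
Hypothesis hrs :
  (d%:R ^+ 2 * (1 + d%:R) * rs) ^+ 2 * (a ^+ 2 + 5 - r ^+ 2) <= r ^+ 2 * (2 * a)^-1 ^+ 2.
Hypothesis hcap : n%:R * cap_size d a R0 rho2 <= 1 / 2.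
Local Notation delta := (loc_size d r R0 rho).
Local Notation pi := (expR (- (r ^+ 2 / 2)) * delta).
Local Notation gam := ((2 * rs) ^+ d.-1 * k / 2).
Local Notation q := (shell_prob d r R0).
Hypothesis hgam : delta * q <= gam / 2.
Local Notation v0 := (n%:R * outer_prob d a * (gam / 2) ^+ 2).
Local Notation F := (@fvol R d n r R0).

Let rR : r <= R0.
Proof.
have a0 : 0 < a by exact: lt_le_trans a2.
by rewrite (le_trans ra)// (le_trans _ aR)// lerDl divr_ge0// ltW.
Qed.

Let delta0 : 0 <= delta. Proof. exact: loc_size_ge0. Qed.

Let q_ge : Ex Pd (sind r R0) <= q. Proof. exact: prob_shell. Qed.

Let q0 : 0 <= Ex Pd (sind r R0).
Proof. by apply: Ex_ge0 => y; case/andP: (sind01 r R0 y). Qed.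

(** By [hgam] the centring loss in [var_lower] leaves at least half of the gain [gam]. *)
Lemma fvol_var_ge : v0 <= var Pd F.
Proof.
have bo : bm (\1_(outer a) : Pt -> R) by apply: bm_indic; exact: measurable_outer.
have o01 (y : Pt) : 0 <= (\1_(outer a) y : R) <= 1 by exact: indic01.
have a0 : 0 < a by exact: lt_le_trans a2.
have ot0 : (\1_(outer a) (origin R d) : R) = 0.
  rewrite indicE memNset// => -[/andP[]]; rewrite vec_origin.
  rewrite (_ : sqn _ = 0); last by rewrite /sqn big1// => i _; rewrite expr0n.
  rewrite leNgt => /negP h _; apply: h; rewrite exprn_gt0// addr_gt0// invr_gt0//.
have hq : delta * Ex Pd (sind r R0) <= delta * q by rewrite ler_wpM2l.
have g0 : 0 <= gam by rewrite divr_ge0// mulr_ge0// exprn_ge0// mulr_ge0// (le_trans k_ge0).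
have := var_lower (@bm_fvol R d n r R0 r_gt0 rR) (bm_sind d r R0)
  (fvol_locD d_gt0 r_gt0 rR rho_ge0 rhoE) bo o01 ot0
  (outer_influence d_gt0 r_gt0 ra a2 aR rho2_ge0 rho2E k_ge0 krs ka hrs hcap).
have hg : delta * Ex Pd (sind r R0) <= gam / 2 by exact: le_trans hgam.
move: (delta * _) (gam) hg g0 => A G hg g0.
move=> h; apply: (le_trans _ (h _)); last by lra.
rewrite -mulrA -[leRHS]mulrA ler_wpM2l//; apply: ler_pM.
- by rewrite !mulr_ge0 ?exprn_ge0 ?normal_peak_ge0 ?expR_ge0 ?divr_ge0 ?invr_ge0 ?mulr_ge0// ltW.
- exact: sqr_ge0.
- exact: prob_outer.
by apply: lerXn2r; rewrite ?nnegrE; lra.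
Qed.

Variable K : R.
Hypothesis K_gt0 : 0 < K.
Hypothesis v0_gt0 : 0 < v0.
Hypothesis stein1 : n%:R * q * delta ^+ 4 * (1 + n%:R * pi) ^+ 2 * (120 * K ^+ 4) <= v0 ^+ 2.
Hypothesis stein2 : (n%:R * q * delta ^+ 3) ^+ 2 * (16 * K ^+ 4) <= v0 ^+ 3.

Let v_gt0 : 0 < var Pd F.
Proof. exact: lt_le_trans fvol_var_ge. Qed.

Lemma fvol_stein (g g' : R -> R) : bm g -> bm g' -> (forall u, `|g' u| <= K) ->
  (forall u v, `|g v - g u - g' u * (v - u)| <= K * (v - u) ^+ 2) ->
  `|Ex mu (fun x => g (stdize Pd F x) * stdize Pd F x) -
    Ex mu (fun x => g' (stdize Pd F x))| <= K^-1.
Proof.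
move=> bg bg' g'K gK.
have pi0 : 0 <= pi by rewrite mulr_ge0 ?expR_ge0.
apply: (le_trans (stein_bound (@bm_fvol R d n r R0 r_gt0 rR) (bm_sind d r R0)
  (@sind01 R d r R0) (bm_bind d r R0) (@bind_ge0 R d r R0) (@bind_le_l R d r R0)
  (Ex_bind d_gt0 r_gt0 rR rho_ge0 rhoE) delta0 pi0
  (fvol_locD d_gt0 r_gt0 rR rho_ge0 rhoE) (fvol_locDD d_gt0 r_gt0 rR rho_ge0 rhoE)
  v_gt0 bg bg' g'K (ltW K_gt0) gK)).
have vv := fvol_var_ge.
have nq : n%:R * Ex Pd (sind r R0) <= n%:R * q by rewrite ler_wpM2l.
have nq0 : 0 <= n%:R * Ex Pd (sind r R0) by rewrite mulr_ge0.
exact: (@stein_arith_mono R K _ (n%:R * q) delta (1 + n%:R * pi) _ _ K_gt0 v0_gt0 vv nq nq0 delta0 stein1 stein2).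
Qed.

Lemma bm_stdize : bm (stdize Pd F).
Proof.
have bF : bm F by exact: bm_fvol.
rewrite (_ : stdize Pd F = fun x => (Num.sqrt (var Pd F))^-1 * (F x - Ex mu F)).
  by apply: bmZ; exact: bm_center.
by apply/funext => x; rewrite /stdize mulrC.
Qed.

Lemma Ex_stdize_sqr : Ex mu (fun x => stdize Pd F x ^+ 2) <= 1.
Proof.
have bF : bm F by exact: bm_fvol.
rewrite (_ : (fun x => _) = fun x => (var Pd F)^-1 * (F x - Ex mu F) ^+ 2).
  rewrite ExZ; last by apply: bmX; exact: bm_center.
  by rewrite -/(var Pd F) mulVf// gt_eqF.
by apply/funext => x; exact: sqr_div_sqrt (ltW v_gt0).
Qed.

Variables (e eta : R) (m : nat).
Hypothesis e_gt0 : 0 < e.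
Hypothesis kolm : forall t,
  `|Ex mu (fun x => \1_[set u | u <= t] (stdize Pd F x)) - Phi t| <= e.
Hypothesis eta_le : 0 < eta <= 1 / 2.
Hypothesis eta_Phi : forall s m t : R, `|s - 1| <= eta -> `|m| <= eta ->
  `|Phi (s * t + m) - Phi t| <= e.
Hypothesis mR : d%:R * R0 ^+ 4 <= m%:R ^+ 2.
Hypothesis rD : d%:R ^+ 2 * (1 + d%:R) <= r.
Hypothesis capR : (r + R0^-1 + 2 / (r + R0^-1)) ^+ 2 + 1 <= R0 ^+ 2.
Hypothesis Rd : 4 * d%:R <= R0 ^+ 2.
Hypothesis bad_var : bad_bound d n%:R m r R0 <= eta ^+ 2 * v0 / 32.
Hypothesis bad_e : bad_bound d n%:R m r R0 <= e.

(** Three errors of size e: replacing the hull by the truncated body, the normal approximation of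
    the latter at an affinely changed level, and the effect of that change on [Phi]. *)
Lemma hvol_kolmogorov t : `|Ex mu (\1_[set x | std_hvol x <= t]) - Phi t| <= 3 * e.
Proof.
have R02 : 2 <= R0.
  apply: (le_trans a2); apply: le_trans aR.
  by rewrite lerDl divr_ge0// (le_trans _ a2).
have R01 : 1 <= R0 by apply: le_trans R02; rewrite ler1n.
have R0_gt0 : 0 < R0 by exact: lt_le_trans R01.
have R2 : 2 <= R0 ^+ 2 by apply: (le_trans R02); rewrite expr2 ler_peMr// ltW.
have [v [v1 vnet]] := sphere_net R d_gt0 m.
have net u : sqn u = 1 -> exists k, R0 ^+ 4 * sqn (fun i => u i - v k i) <= 1.
  move=> /vnet[l hl]; exists l.
  have d0 : 0 < d%:R :> R by rewrite ltr0n.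
  rewrite -(ler_pM2l d0) mulr1 mulrA; apply: le_trans hl.
  by rewrite ler_wpM2r// sqn_ge0.
have hp l : cap_prob d (r + R0^-1) <= Ex Pd (\1_(cap (v l) (r + R0^-1) R0)).
  apply: prob_cap_ge => //; apply: (le_trans rD).
  by rewrite lerDl invr_ge0 ltW.
have int_bad := integral_bad n R01 R2 Rd hp.
have bF : bm F by exact: bm_fvol.
have ibad : (\int[mu]_x (bad r R0 v x)%:E <= (bad_bound d n%:R m r R0)%:E)%E.
  apply: (le_trans int_bad); rewrite lee_fin /bad_bound.
  by rewrite card_ffun !card_ord.
have badv : bad_bound d n%:R m r R0 <= eta ^+ 2 * var Pd F / 32.
  apply: (le_trans bad_var); rewrite ler_wpM2r ?invr_ge0// ler_wpM2l ?sqr_ge0//.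
  exact: fvol_var_ge.
have mh := @measurable_hvol R d n.
have mb : measurable_fun setT (@bad R d n r R0 _ v) by exact: measurable_bad.
have b0 : forall x : Om, 0 <= bad r R0 v x by exact: bad_ge0.
have bs := @bad_sqr R d n d_gt0 r R0 r_gt0 rR R01 _ v net.
have bn := @bad_ge1 R d n d_gt0 r R0 R01 _ v net.
have vp := v_gt0; rewrite /var in vp badv.
have hlaw := transfer_law bF mh mb b0 bs bn ibad vp eta_le badv t.
have hscale := transfer_scale bF mh mb b0 bs ibad vp eta_le badv.
have hshift := transfer_shift bF mh mb b0 bs ibad vp eta_le badv.
have hPhi := eta_Phi t hscale hshift.
have hk := kolm (Num.sqrt (Ex mu (fun x => (hvol x - Ex mu (@hvol R d n)) ^+ 2)) /
  Num.sqrt (var Pd F) * t + (Ex mu (@hvol R d n) - Ex mu F) / Num.sqrt (var Pd F)).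
rewrite /stdize /var in hk; rewrite /std_hvol.
exact: (dist3_le (le_trans hlaw bad_e) hk hPhi).
Qed.

End finite_sample.

(** All smallness requirements that depend on e are packed into a single [kappa], fixed before the
    dimension and the parameters. *)
Lemma sample_clt (R : realType) (e : R) : 0 < e -> exists2 kappa : R, 0 < kappa &
  forall (d n m : nat) (r R0 rho a rho2 rs k : R), (0 < d)%N ->
  let delta := loc_size d r R0 rho in
  let p := expR (- (r ^+ 2 / 2)) * delta in
  let gam := (2 * rs) ^+ d.-1 * k / 2 in
  let q := shell_prob d r R0 in
  let v0 := n%:R * outer_prob d a * (gam / 2) ^+ 2 in
  0 < r -> r <= a -> 2 <= a -> a + 2 / a <= R0 ->
  0 <= rho -> 16 * (R0 ^+ 2 - r ^+ 2) <= rho ^+ 2 ->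
  0 <= rho2 -> R0 ^+ 2 - a ^+ 2 <= rho2 ^+ 2 ->
  0 <= k -> k <= rs -> k <= (4 * a)^-1 ->
  (d%:R ^+ 2 * (1 + d%:R) * rs) ^+ 2 * (a ^+ 2 + 5 - r ^+ 2) <= r ^+ 2 * (2 * a)^-1 ^+ 2 ->
  n%:R * cap_size d a R0 rho2 <= 1 / 2 ->
  delta * q <= gam / 2 ->
  0 < v0 ->
  n%:R * q * delta ^+ 4 * (1 + n%:R * p) ^+ 2 <= kappa * v0 ^+ 2 ->
  (n%:R * q * delta ^+ 3) ^+ 2 <= kappa * v0 ^+ 3 ->
  d%:R * R0 ^+ 4 <= m%:R ^+ 2 ->
  d%:R ^+ 2 * (1 + d%:R) <= r ->
  (r + R0^-1 + 2 / (r + R0^-1)) ^+ 2 + 1 <= R0 ^+ 2 ->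
  4 * d%:R <= R0 ^+ 2 ->
  bad_bound d n%:R m r R0 <= kappa * v0 ->
  bad_bound d n%:R m r R0 <= kappa ->
  forall t, `|Psample [set x : 'I_n -> 'I_d -> R |
      (volK x - Esample (@volK R d n)) / Num.sqrt (Varsample (@volK R d n)) <= t]
     - Phi t| <= e.
Proof.
move=> e0; have e3 : 0 < e / 3 by rewrite divr_gt0.
have [K K0 HK] := kolmogorov_stein e3.
have [eta eta_le Heta] := Phi_affine e3.
have eta0 : 0 < eta by case/andP: eta_le.
have K4 : 0 < K ^+ 4 by exact: exprn_gt0.
pose kappa := Num.min (120 * K ^+ 4)^-1 (Num.min (16 * K ^+ 4)^-1
  (Num.min (eta ^+ 2 / 32) (e / 3))).
have k1 : kappa <= (120 * K ^+ 4)^-1 by rewrite ge_min lexx.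
have k2 : kappa <= (16 * K ^+ 4)^-1 by rewrite !ge_min lexx orbT.
have k3 : kappa <= eta ^+ 2 / 32 by rewrite !ge_min lexx !orbT.
have k4 : kappa <= e / 3 by rewrite !ge_min lexx !orbT.
have kappa0 : 0 < kappa.
  by rewrite !lt_min !invr_gt0 !mulr_gt0//= invr_gt0.
exists kappa => //.
move=> d n m r R0 rho a rho2 rs k d_gt0 delta p gam q v0.
move=> r_gt0 ra a2 aR rho0 rhoE rho20 rho2E k0 krs ka hrs hcap hgam v00 s1 s2 mR rD capR Rd b1 b2 t.
have s1' : n%:R * q * delta ^+ 4 * (1 + n%:R * p) ^+ 2 * (120 * K ^+ 4) <= v0 ^+ 2.
  rewrite -ler_pdivlMr ?mulr_gt0//; apply: (le_trans s1).
  by rewrite mulrC ler_wpM2l ?sqr_ge0.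
have s2' : (n%:R * q * delta ^+ 3) ^+ 2 * (16 * K ^+ 4) <= v0 ^+ 3.
  rewrite -ler_pdivlMr ?mulr_gt0//; apply: (le_trans s2).
  by rewrite mulrC ler_wpM2l ?exprn_ge0// ltW.
have b1' : bad_bound d n%:R m r R0 <= eta ^+ 2 * v0 / 32.
  by apply: (le_trans b1); rewrite mulrAC ler_wpM2r// ltW.
rewrite Psample_volK//.
have -> : e = 3 * (e / 3) by field.
apply: (hvol_kolmogorov d_gt0 r_gt0 ra a2 aR rho0 rhoE rho20 rho2E k0 krs ka hrs hcap hgam
  v00 (eta := eta) (m := m)) => //; last exact: le_trans k4.
apply: HK.
- by apply: bm_stdize r_gt0 ra a2 aR.
- exact: (Ex_stdize_sqr d_gt0 r_gt0 ra a2 aR rho0 rhoE rho20 rho2E k0 krs ka hrs hcap hgam v00).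
- move=> g g' bg bg'.
  exact: (fvol_stein d_gt0 r_gt0 ra a2 aR rho0 rhoE rho20 rho2E k0 krs ka hrs hcap hgam K0 v00).
Qed.

(** * Asymptotic parameters *)

Section power_growth.
Context (R : realType).
Implicit Types (f g : R -> R) (s t : int).

(** Orders of growth by integer powers of y at infinity, with constants ignored; nonnegativity is
    part of [up] so that bounds can be multiplied. *)
Definition up f s := exists2 C : R, 0 < C & \forall y \near +oo, 0 <= f y <= C * y ^ s.
Definition lo f s := exists2 c : R, 0 < c & \forall y \near +oo, c * y ^ s <= f y.

Lemma near_ge (M : R) : \forall y \near +oo, M <= y.
Proof. exact: nbhs_pinfty_ge (num_real M). Qed.

Lemma up_le f g s : up g s -> (\forall y \near +oo, 0 <= f y <= g y) -> up f s.
Proof.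
move=> [C C0 hg] hf; exists C => //; near=> y.
have /andP[h1 h2] : 0 <= g y <= C * y ^ s by near: y.
have /andP[h3 h4] : 0 <= f y <= g y by near: y.
by rewrite h3 (le_trans h4).
Unshelve. all: by end_near. Qed.

Lemma lo_ge f g s : lo g s -> (\forall y \near +oo, g y <= f y) -> lo f s.
Proof.
move=> [C C0 hg] hf; exists C => //; near=> y.
have h1 : C * y ^ s <= g y by near: y.
apply: (le_trans h1); near: y; exact: hf.
Unshelve. all: by end_near. Qed.

Lemma up_ge0 f s : up f s -> \forall y \near +oo, 0 <= f y.
Proof.
move=> [C C0 hg]; near=> y.
have /andP[h1 h2] : 0 <= f y <= C * y ^ s by near: y.
by [].
Unshelve. all: by end_near. Qed.

Lemma lo_gt0 f s : lo f s -> \forall y \near +oo, 0 < f y.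
Proof.
move=> [c c0 h]; near=> y.
have y1 : 1 <= y by near: y; exact: near_ge.
have y0 : 0 < y by exact: lt_le_trans y1.
have h1 : c * y ^ s <= f y by near: y.
by apply: lt_le_trans h1; rewrite mulr_gt0// exprz_gt0.
Unshelve. all: by end_near. Qed.

Lemma up_mul f g s t : up f s -> up g t -> up (fun y => f y * g y) (s + t).
Proof.
move=> [C C0 hf] [D D0 hg]; exists (C * D); first exact: mulr_gt0.
near=> y.
have y1 : 1 <= y by near: y; exact: near_ge.
have y0 : y != 0 by rewrite gt_eqF// (lt_le_trans _ y1).
have /andP[h1 h2] : 0 <= f y <= C * y ^ s by near: y.
have /andP[h3 h4] : 0 <= g y <= D * y ^ t by near: y.
rewrite mulr_ge0//= expfzDr// mulrACA; exact: ler_pM.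
Unshelve. all: by end_near. Qed.

Lemma lo_mul f g s t : lo f s -> lo g t -> lo (fun y => f y * g y) (s + t).
Proof.
move=> [C C0 hf] [D D0 hg]; exists (C * D); first exact: mulr_gt0.
near=> y.
have y1 : 1 <= y by near: y; exact: near_ge.
have y0 : 0 < y by exact: lt_le_trans y1.
have h2 : C * y ^ s <= f y by near: y.
have h4 : D * y ^ t <= g y by near: y.
rewrite expfzDr ?gt_eqF// mulrACA; apply: ler_pM => //.
  by rewrite mulr_ge0 ?exprz_ge0// ltW.
by rewrite mulr_ge0 ?exprz_ge0// ltW.
Unshelve. all: by end_near. Qed.

Lemma up_cst (c : R) : 0 <= c -> up (fun=> c) 0.
Proof.
move=> c0; exists (c + 1); first by rewrite ltr_wpDl.
by near=> y; rewrite expr0z mulr1 c0/= lerDl.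
Unshelve. all: by end_near. Qed.

Lemma lo_cst (c : R) : 0 < c -> lo (fun=> c) 0.
Proof. by move=> c0; exists c => //; near=> y; rewrite expr0z mulr1. Unshelve. all: by end_near. Qed.

Lemma up_id : up id 1.
Proof.
exists 1 => //; near=> y; rewrite expr1z mul1r lexx andbT.
near: y; exact: near_ge.
Unshelve. all: by end_near. Qed.

Lemma lo_id : lo id 1.
Proof. by exists 1 => //; near=> y; rewrite expr1z mul1r. Unshelve. all: by end_near. Qed.

Lemma up_exp f s k : up f s -> up (fun y => f y ^+ k) (s * k%:Z).
Proof.
move=> hf; elim: k => [|k IH]; first by rewrite mulr0; exact: up_cst.
under [X in up X]eq_fun do rewrite exprS.
have -> : s * k.+1%:Z = s + s * k%:Z by rewrite -addn1 PoszD mulrDr mulr1 addrC.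
exact: up_mul.
Qed.

Lemma lo_exp f s k : lo f s -> lo (fun y => f y ^+ k) (s * k%:Z).
Proof.
move=> hf; elim: k => [|k IH]; first by rewrite mulr0; exact: lo_cst.
under [X in lo X]eq_fun do rewrite exprS.
have -> : s * k.+1%:Z = s + s * k%:Z by rewrite -addn1 PoszD mulrDr mulr1 addrC.
exact: lo_mul.
Qed.

Lemma up_weak f s t : (s <= t)%R -> up f s -> up f t.
Proof.
move=> st [C C0 hf]; exists C => //; near=> y.
have y1 : 1 <= y by near: y; exact: near_ge.
have /andP[h1 h2] : 0 <= f y <= C * y ^ s by near: y.
by rewrite h1 (le_trans h2)// ler_wpM2l ?(ltW C0)// ler_weXz2l.
Unshelve. all: by end_near. Qed.

Lemma up_add f g s : up f s -> up g s -> up (fun y => f y + g y) s.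
Proof.
move=> [C C0 hf] [D D0 hg]; exists (C + D); first exact: addr_gt0.
near=> y.
have /andP[h1 h2] : 0 <= f y <= C * y ^ s by near: y.
have /andP[h3 h4] : 0 <= g y <= D * y ^ s by near: y.
by rewrite addr_ge0//= mulrDl lerD.
Unshelve. all: by end_near. Qed.

Lemma up_inv f s : lo f s -> up (fun y => (f y)^-1) (- s).
Proof.
move=> [c c0 h]; exists c^-1; first by rewrite invr_gt0.
near=> y.
have y1 : 1 <= y by near: y; exact: near_ge.
have y0 : 0 < y by exact: lt_le_trans y1.
have h1 : c * y ^ s <= f y by near: y.
have cy : 0 < c * y ^ s by rewrite mulr_gt0// exprz_gt0.
have f0 : 0 < f y by exact: lt_le_trans h1.
by rewrite invr_ge0 (ltW f0)/= -invr_expz -invfM lef_pV2 ?posrE.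
Unshelve. all: by end_near. Qed.

Lemma lo_inv f s : up f s -> (\forall y \near +oo, 0 < f y) -> lo (fun y => (f y)^-1) (- s).
Proof.
move=> [c c0 h] fp; exists c^-1; first by rewrite invr_gt0.
near=> y.
have y1 : 1 <= y by near: y; exact: near_ge.
have y0 : 0 < y by exact: lt_le_trans y1.
have /andP[h0 h1] : 0 <= f y <= c * y ^ s by near: y.
have f0 : 0 < f y by near: y.
by rewrite -invr_expz -invfM lef_pV2 ?posrE// (lt_le_trans f0).
Unshelve. all: by end_near. Qed.

(** Exponents are integers, so a strict gap is worth at least one factor y, which outgrows every
    constant. *)
Lemma up_lo f g s t (kappa : R) : up f s -> lo g t -> s < t -> 0 < kappa ->
  \forall y \near +oo, f y <= kappa * g y.
Proof.
move=> [C C0 hf] [c c0 hg] st k0; near=> y.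
have y1 : 1 <= y by near: y; exact: near_ge.
have y0 : 0 < y by exact: lt_le_trans y1.
have yC : C / (kappa * c) <= y by near: y; exact: near_ge.
have /andP[_ h2] : 0 <= f y <= C * y ^ s by near: y.
have h4 : c * y ^ t <= g y by near: y.
apply: (le_trans h2); apply: (@le_trans _ _ (kappa * (c * y ^ t))); last first.
  by rewrite ler_wpM2l// ltW.
have st1 : s + 1 <= t by rewrite -lezD1 // addrC in st *.
have hst : y ^ (s + 1) <= y ^ t by exact: ler_weXz2l.
rewrite mulrA; apply: (@le_trans _ _ (kappa * c * y ^ (s + 1))); last first.
  by rewrite ler_wpM2l// mulr_ge0// ltW.
rewrite expfzDr ?gt_eqF// expr1z (mulrC (y ^ s)) mulrA ler_wpM2r ?exprz_ge0 ?(ltW y0)//.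
by rewrite mulrC -ler_pdivrMr ?mulr_gt0.
Unshelve. all: by end_near. Qed.

Lemma up_expRN (c : R) s : 0 < c -> up (fun y => expR (- (c * y))) s.
Proof.
move=> c0; suff h (k : nat) : up (fun y => expR (- (c * y))) (- k.+1%:Z).
  apply: up_weak (h `|s|%N); lia.
exists ((k.+1%:R / c) ^+ k.+1); first by rewrite exprn_gt0// divr_gt0.
near=> y.
have y1 : 1 <= y by near: y; exact: near_ge.
have y0 : 0 < y by exact: lt_le_trans y1.
rewrite expR_ge0/= expRN -invr_expz -exprnP -[leLHS]mul1r.
rewrite ler_pdivrMr ?expR_gt0// mulrAC ler_pdivlMr ?exprn_gt0// mul1r.
have Kn : k.+1%:R != 0 :> R by rewrite pnatr_eq0.
have hx : (c * y / k.+1%:R) ^+ k.+1 <= expR (c * y).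
  have -> : expR (c * y) = expR (c * y / k.+1%:R) ^+ k.+1.
    by rewrite -expRM_natl; congr expR; rewrite [RHS]mulrC divfK.
  apply: lerXn2r; rewrite ?nnegrE ?expR_ge0//.
    by rewrite divr_ge0// mulr_ge0// ltW.
  by apply: le_trans (expR_ge1Dx _); rewrite lerDr.
apply: (@le_trans _ _ ((k.+1%:R / c) ^+ k.+1 * (c * y / k.+1%:R) ^+ k.+1)).
  rewrite -exprMn le_eqVlt; apply/orP; left; apply/eqP; congr (_ ^+ _).
  by move: (k.+1%:R) Kn => K Kn; field; rewrite Kn gt_eqF.
by rewrite ler_wpM2l// exprn_ge0// divr_ge0// ltW.
Unshelve. all: by end_near. Qed.

End power_growth.

Lemma ln_le_id (R : realType) (y : R) : 1 <= y -> 0 <= ln y <= y.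
Proof.
move=> y1; have y0 : 0 < y by exact: lt_le_trans y1.
rewrite ln_ge0//=; have := expR_ge1Dx (ln y); rewrite lnK ?posrE//; lra.
Qed.

Lemma outer_exponent (d : nat) : ((15 * d + 3) * d.-1)%:Z - d%:Z - 1 =
  0 + (1 * (14 * d + 2)%:Z + 0) +
  (((15 * d + 3)%:Z + 0) * d.-1%:Z + - (0 + (15 * d + 3)%:Z)) :> int.
Proof. by rewrite PoszM; lia. Qed.

Lemma shell_exponent (d : nat) : 1 * (15 * d + 4)%:Z + (0 + ((0 + (15 * d + 3)%:Z) * d.-1%:Z +
  (0 + 0 + 1 + - (15 * d + 3)%:Z))) = 2 + ((15 * d + 3) * d.-1)%:Z :> int.
Proof. by rewrite PoszM; lia. Qed.

Section parameters.
Context (R : realType) (d : nat).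
Hypothesis hd : (2 <= d)%N.
Local Notation p := (15 * d + 3)%N.
Local Notation A := ((15 * d + 4)%:R : R).
Local Notation A' := ((14 * d + 2)%:R : R).
Implicit Types y : R.

(** With n = exp(Y^2) and Y = y^p, the factor n exp(- r^2 / 2) is y^A at [rin] and y^A' at [rmid],
    and exp(-y) at [rout]. A = p + 1 makes the expected number of points in a cap at [rin] at least
    of order y^A / Y = y. A' = p - d - 1 makes that number at [rmid] at most of order y^(A' + d) / Y
    = 1/y, so such caps are typically empty. *)
Definition rin y := Num.sqrt (2 * (y ^+ p) ^+ 2 - 2 * A * ln y).
Definition rmid y := Num.sqrt (2 * (y ^+ p) ^+ 2 - 2 * A' * ln y).
Definition rout y := Num.sqrt (2 * (y ^+ p) ^+ 2 + 2 * y).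
Definition nsize y := expR ((y ^+ p) ^+ 2).

Let AA' : A = A' + d%:R + 2.
Proof. by rewrite -!natrD; congr (_%:R); lia. Qed.

Let A'0 : 0 <= A'. Proof. by []. Qed.
Let d1 : 2 <= d%:R :> R. Proof. by rewrite ler_nat. Qed.

Lemma param_basic y : 2 * A + 100 <= y -> let Y := y ^+ p in
  [/\ [/\ rin y ^+ 2 = 2 * Y ^+ 2 - 2 * A * ln y, rmid y ^+ 2 = 2 * Y ^+ 2 - 2 * A' * ln y &
      rout y ^+ 2 = 2 * Y ^+ 2 + 2 * y],
      [/\ y ^+ 2 <= Y, Y <= rin y, rin y <= rmid y & rmid y + 2 / rmid y <= rout y] &
      [/\ rout y <= 2 * Y, 2 <= rmid y, (rmid y + 2 / rmid y) ^+ 2 <= rmid y ^+ 2 + 5 &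
      (rin y + (rout y)^-1 + 2 / (rin y + (rout y)^-1)) ^+ 2 + 1 <= rin y ^+ 2 + 9]].
Proof.
move=> yM Y.
have A0 : 0 <= A by [].
have y1 : 1 <= y by lra.
have y0 : 0 < y by lra.
have /andP[L0 Ly] := ln_le_id y1; set L := ln y in L0 Ly *.
have yY : y ^+ 2 <= Y by rewrite ler_weXn2l//; lia.
have Y0 : 0 < Y by exact: exprn_gt0.
have y2 : 100 * y <= y ^+ 2 by nra.
have AL : 2 * A * L <= y ^+ 2.
  apply: (@le_trans _ _ (2 * A * y)); first by rewrite ler_wpM2l// mulr_ge0.
  by rewrite expr2 ler_wpM2r ?(ltW y0)//; lra.
have A'L : A' * L <= A * L by rewrite ler_wpM2r// AA'; lra.
have Y1 : 100 <= Y by nra.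
have YY : Y <= Y ^+ 2 by rewrite expr2; nra.
have r2 : rin y ^+ 2 = 2 * Y ^+ 2 - 2 * A * L by rewrite sqr_sqrtr// -/Y -/L; lra.
have m2 : rmid y ^+ 2 = 2 * Y ^+ 2 - 2 * A' * L by rewrite sqr_sqrtr// -/Y -/L; lra.
have R2 : rout y ^+ 2 = 2 * Y ^+ 2 + 2 * y by rewrite sqr_sqrtr// -/Y; lra.
have r0 : 0 <= rin y by exact: sqrtr_ge0.
have m0 : 0 <= rmid y by exact: sqrtr_ge0.
have R0 : 0 <= rout y by exact: sqrtr_ge0.
have Yr : Y <= rin y by apply: le_of_sqr => //; rewrite r2; lra.
have rm : rin y <= rmid y by apply: le_of_sqr => //; rewrite r2 m2; lra.
have m100 : 100 <= rmid y by lra.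
have sq5 (x : R) : 2 <= x -> (x + 2 / x) ^+ 2 <= x ^+ 2 + 5.
  move=> x2; have x0 : x != 0 by rewrite gt_eqF//; lra.
  have -> : (x + 2 / x) ^+ 2 = x ^+ 2 + 4 + 4 * x^-1 ^+ 2 by field.
  have xi : x^-1 <= 2^-1 by rewrite lef_pV2 ?posrE//; lra.
  have xi0 : 0 <= x^-1 by rewrite invr_ge0; lra.
  by nra.
have mR : rmid y + 2 / rmid y <= rout y.
  apply: le_of_sqr => //; apply: (le_trans (sq5 _ _)); first by lra.
  by have AL0 : 0 <= A' * L := mulr_ge0 A'0 L0; rewrite m2 R2; lra.
have rR : rin y <= rout y.
  by apply: (le_trans rm); apply: le_trans mR; rewrite lerDl divr_ge0.
have R0p : 0 < rout y by lra.
split; split => //.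
- by apply: le_of_sqr; [lra|rewrite R2 exprMn; lra].
- by lra.
- by apply: sq5; lra.
apply: (@le_trans _ _ ((rin y + (rout y)^-1) ^+ 2 + 5 + 1)).
  rewrite lerD2r; apply: sq5; apply: (@le_trans _ _ (rin y)); first by lra.
  by rewrite lerDl invr_ge0.
have Ri : (rout y)^-1 <= 1 by rewrite invf_le1//; lra.
have Ri0 : 0 <= (rout y)^-1 by rewrite invr_ge0.
have rRi : rin y * (rout y)^-1 <= 1 by rewrite ler_pdivrMr// mul1r.
have -> : (rin y + (rout y)^-1) ^+ 2 = rin y ^+ 2 + 2 * (rin y * (rout y)^-1) + (rout y)^-1 ^+ 2 by ring.
have : (rout y)^-1 ^+ 2 <= 1 by rewrite exprn_ile1.
lra.
Qed.

Lemma nsize_exp y (c : R) (m : nat) : 0 < y ->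
  nsize y * expR (- ((2 * (y ^+ p) ^+ 2 - 2 * m%:R * ln y + c) / 2)) = y ^+ m * expR (- (c / 2)).
Proof.
move=> y0; rewrite /nsize -[in y ^+ m](@lnK _ y) ?posrE// -expRM_natl -!expRD.
by congr expR; field.
Qed.

Let near_basic : \forall y \near +oo, 2 * A + 100 <= y.
Proof. exact: near_ge. Qed.

Let up_Y : up (fun y => y ^+ p) p.
Proof. by have := up_exp p (up_id R); rewrite mul1r. Qed.

Let lo_Y : lo (fun y => y ^+ p) p.
Proof. by have := lo_exp p (lo_id R); rewrite mul1r. Qed.

Lemma lo_rin : lo rin p.
Proof.
apply: lo_ge lo_Y _; near=> y.
by have [] := param_basic (y := y) _ => [|_ [] //]; near: y.
Unshelve. all: by end_near. Qed.

Lemma lo_rmid : lo rmid p.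
Proof.
apply: lo_ge lo_rin _; near=> y.
by have [] := param_basic (y := y) _ => [|_ [] //]; near: y.
Unshelve. all: by end_near. Qed.

Lemma up_rout : up rout p.
Proof.
have h := up_mul (up_cst (ler0n R 2)) up_Y.
rewrite add0r in h; apply: (up_le h); near=> y.
rewrite sqrtr_ge0/=.
by have [] := param_basic (y := y) _ => [|_ _ [] //]; near: y.
Unshelve. all: by end_near. Qed.

Lemma up_rmid : up rmid p.
Proof.
apply: (up_le up_rout); near=> y.
rewrite sqrtr_ge0/=.
have [|_ [_ _ _ h] _] := param_basic (y := y) _; first by near: y.
by apply: le_trans h; rewrite lerDl divr_ge0// sqrtr_ge0.
Unshelve. all: by end_near. Qed.

(** For y >= 1, R0^2 - r^2 = 2 y + 2 A ln y is at most (2 A + 2) y; the 7 also covers the 5 in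
    [rmid y ^+ 2 + 5 - rin y ^+ 2]. *)
Definition gapc : R := 2 * A + 7.
Definition slabc : R := d%:R ^+ 2 * (1 + d%:R).
(** Order sqrt(y) would suffice; order y keeps all exponents integral and costs only a power of
    y. *)
Definition rho_ y := 4 * gapc * y.
(** Chosen so that (slabc rs)^2 gapc y = 1 / (16 gapc y) <= 1/16, the size allowed by the cone
    condition because r >= Y and a <= 2 Y. *)
Definition rs_ y := (4 * slabc * gapc)^-1 / y.
Definition k_ y := (4 * rmid y)^-1.
Definition delta_ y := loc_size d (rin y) (rout y) (rho_ y).

Lemma gapc_ge : 60 <= gapc.
Proof.
have h : 60 <= 2 * A by rewrite -natrM ler_nat; lia.
by rewrite /gapc; apply: (le_trans h); rewrite lerDl.
Qed.

Lemma slabc_gt0 : 0 < slabc. Proof.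
have d0 : 0 < d%:R :> R by rewrite ltr0n; lia.
by rewrite /slabc mulr_gt0 ?exprn_gt0// addr_gt0.
Qed.

Lemma param_gaps y : 2 * A + 100 <= y ->
  [/\ 2 * y <= rout y ^+ 2 - rin y ^+ 2 <= gapc * y,
      0 <= rout y ^+ 2 - rmid y ^+ 2 <= gapc * y &
      rmid y ^+ 2 + 5 - rin y ^+ 2 <= gapc * y].
Proof.
move=> yM; have [[r2 m2 R2] _ _] := param_basic yM.
have y1 : 1 <= y by have : 0 <= A by []; lra.
have /andP[L0 Ly] := ln_le_id y1.
have a1 : A * ln y <= A * y by rewrite ler_wpM2l.
have a2 : A' * ln y <= A * ln y by rewrite ler_wpM2r// ler_nat leq_add// leq_mul.
have a3 : 0 <= A' * ln y by rewrite mulr_ge0.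
rewrite r2 m2 R2 /gapc; split; [apply/andP; split|apply/andP; split|]; lra.
Qed.

Lemma up_gap : up (fun y => rout y ^+ 2 - rin y ^+ 2) 1.
Proof.
exists gapc; first by apply: (lt_le_trans _ gapc_ge).
near=> y; have yM : 2 * A + 100 <= y by near: y.
have [/andP[h1 h2] _ _] := param_gaps yM.
rewrite expr1z h2 andbT; by apply: le_trans h1; rewrite mulr_ge0.
Unshelve. all: by end_near. Qed.

Lemma up_gap_mid : up (fun y => rout y ^+ 2 - rmid y ^+ 2) 1.
Proof.
exists gapc; first by apply: (lt_le_trans _ gapc_ge).
near=> y; have yM : 2 * A + 100 <= y by near: y.
have [_ h _] := param_gaps yM.
by rewrite expr1z.
Unshelve. all: by end_near. Qed.

Lemma up_rho : up rho_ 1.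
Proof.
have h := up_mul (up_cst (_ : 0 <= 4 * gapc)) (up_id R).
by apply: h; have := gapc_ge; lra.
Qed.

Let upc (c : R) (c0 : 0 <= c) := up_cst c0.
Let dR0 : 0 <= d%:R :> R. Proof. by []. Qed.
Let c2 : 0 <= 2 :> R. Proof. by []. Qed.

Lemma up_delta : up delta_ (d%:Z - p%:Z).
Proof.
have h := up_mul (upc dR0) (up_mul (up_exp d.-1 (up_mul (upc c2) up_rho))
  (up_mul (up_mul (up_mul (upc c2) (upc dR0)) up_gap) (up_inv lo_rin))).
apply: up_weak h; lia.
Qed.

Let near_pos : \forall y \near +oo, 0 < y :> R.
Proof. by near=> y; apply: (@lt_le_trans _ _ 1) => //; near: y; exact: near_ge. Unshelve. all: by end_near. Qed.

Lemma nsize_rin y : 2 * A + 100 <= y -> nsize y * expR (- (rin y ^+ 2 / 2)) = y ^+ (15 * d + 4).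
Proof.
move=> yM; have [[r2 _ _] _ _] := param_basic yM.
have y0 : 0 < y by have : 0 <= A by []; lra.
have := nsize_exp 0 (15 * d + 4) y0; rewrite addr0 mul0r oppr0 expR0 mulr1 => <-.
by rewrite r2.
Qed.

Lemma nsize_rmid y (c : R) : 2 * A + 100 <= y ->
  nsize y * expR (- ((rmid y ^+ 2 + c) / 2)) = y ^+ (14 * d + 2) * expR (- (c / 2)).
Proof.
move=> yM; have [[_ m2 _] _ _] := param_basic yM.
have y0 : 0 < y by have : 0 <= A by []; lra.
by rewrite m2 nsize_exp.
Qed.

Lemma up_shell : up (fun y => nsize y * shell_prob d (rin y) (rout y)) (2 + (p * d.-1)%:Z).
Proof.
have h := up_mul (up_exp (15 * d + 4) (up_id R)) (up_mul (upc dR0)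
  (up_mul (up_exp d.-1 (up_mul (upc c2) up_rout))
  (up_mul (up_mul (up_mul (upc c2) (upc dR0)) up_gap) (up_inv lo_rin)))).
have h0 := up_ge0 h.
apply: (@up_weak _ _ (1 * (15 * d + 4)%:Z + (0 + ((0 + p%:Z) * d.-1%:Z + (0 + 0 + 1 + - p%:Z))))).
  by rewrite shell_exponent.
apply: (up_le h); near=> y.
rewrite /shell_prob mulrA nsize_rin ?lexx ?andbT; last by near: y.
by near: y.
Unshelve. all: by end_near. Qed.

Lemma up_pi : up (fun y => nsize y * (expR (- (rin y ^+ 2 / 2)) * delta_ y)) (d%:Z + 1).
Proof.
have h := up_mul (up_exp (15 * d + 4) (up_id R)) up_delta.
have h0 := up_ge0 h.
apply: (@up_weak _ _ (1 * (15 * d + 4)%:Z + (d%:Z - p%:Z))); first by lia.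
apply: (up_le h); near=> y.
rewrite mulrA nsize_rin ?lexx ?andbT; last by near: y.
by near: y.
Unshelve. all: by end_near. Qed.

(** The exponent is A' + d - p = -1; this is what fixes A'. *)
Lemma up_cap : up (fun y => nsize y * cap_size d (rmid y) (rout y) (rho_ y)) (-1).
Proof.
have h := up_mul (up_exp (14 * d + 2) (up_id R)) (up_mul (upc dR0)
  (up_mul (up_exp d.-1 (up_mul (upc c2) up_rho))
  (up_mul (up_mul (up_mul (upc c2) (upc dR0)) up_gap_mid) (up_inv lo_rmid)))).
have h0 := up_ge0 h.
apply: (@up_weak _ _ (1 * (14 * d + 2)%:Z + (0 + ((0 + 1) * d.-1%:Z + (0 + 0 + 1 + - p%:Z))))).
  by lia.
apply: (up_le h); near=> y.
have := nsize_rmid (y := y) 0; rewrite addr0 mul0r oppr0 expR0 mulr1 => e.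
rewrite /cap_size mulrA e ?lexx ?andbT; last by near: y.
by near: y.
Unshelve. all: by end_near. Qed.

Definition gam_ y := (2 * rs_ y) ^+ d.-1 * k_ y / 2.

Let loc (c : R) (c0 : 0 < c) := lo_cst c0.
Let c2p : 0 < 2 :> R. Proof. by []. Qed.
Let c2i : 0 < 2^-1 :> R. Proof. by rewrite invr_gt0. Qed.

Lemma lo_yi : lo (fun y => y^-1) (-1).
Proof. exact: (lo_inv (up_id R) near_pos). Qed.

Let mid_pos : \forall y \near +oo, 0 < 4 * rmid y.
Proof.
near=> y; rewrite mulr_gt0//; apply: (@lt_le_trans _ _ 2) => //.
by have [|_ _ []] := param_basic (y := y); first by near: y.
Unshelve. all: by end_near. Qed.

Lemma lo_gam : lo gam_ (- (d.-1%:Z) - p%:Z).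
Proof.
have cp : 0 < (4 * slabc * gapc)^-1.
  by rewrite invr_gt0; apply: mulr_gt0; [exact: (mulr_gt0 _ slabc_gt0)|exact: (lt_le_trans _ gapc_ge)].
have c4 : 0 <= 4 :> R by [].
have h := lo_mul (lo_mul (lo_exp d.-1 (lo_mul (loc c2p) (lo_mul (loc cp) lo_yi)))
  (lo_inv (up_mul (upc c4) up_rmid) mid_pos)) (loc c2i).
have -> : - d.-1%:Z - p%:Z = (0 + (0 + -1)) * d.-1%:Z + - (0 + p%:Z) + 0 by lia.
exact: h.
Qed.

Let peak0 : 0 < normal_peak (1 : R) ^+ d.
Proof. by rewrite exprn_gt0// normal_peak1_gt0. Qed.

Lemma lo_outer : lo (fun y => nsize y * outer_prob d (rmid y)) ((p * d.-1)%:Z - d%:Z - 1).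
Proof.
have e5 : 0 < expR (- (5 / 2)) :> R by exact: expR_gt0.
have di : 0 < d%:R^-1 :> R by rewrite invr_gt0 ltr0n (leq_trans _ hd).
have mid_pos2 : \forall y \near +oo, 0 < 2 * rmid y.
  near=> y; have h : 0 < 4 * rmid y by near: y.
  by move: h; rewrite !pmulr_rgt0.
have h := lo_mul (lo_mul (loc peak0) (lo_mul (lo_exp (14 * d + 2) (lo_id R)) (loc e5)))
  (lo_mul (lo_exp d.-1 (lo_mul lo_rmid (loc di))) (lo_inv (up_mul (upc c2) up_rmid) mid_pos2)).
have -> : (p * d.-1)%:Z - d%:Z - 1 =
  0 + (1 * (14 * d + 2)%:Z + 0) + ((p%:Z + 0) * d.-1%:Z + - (0 + p%:Z)).
  exact: outer_exponent.
apply: (lo_ge h); near=> y.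
have yM : 2 * A + 100 <= y by near: y.
rewrite /outer_prob -(nsize_rmid 5 yM) [leRHS]mulrA.
have [_ _ [_ m2 m5 _]] := param_basic yM.
rewrite ler_wpM2r//.
  by rewrite mulr_ge0 ?invr_ge0 ?exprn_ge0 ?divr_ge0 ?mulr_ge0//; lra.
rewrite (mulrCA (nsize y)) ler_wpM2l ?(ltW peak0)// ler_wpM2l ?expR_ge0//.
by rewrite ler_expR lerN2 ler_wpM2r// invr_ge0.
Unshelve. all: by end_near. Qed.

Definition v0_ y := nsize y * outer_prob d (rmid y) * (gam_ y / 2) ^+ 2.

(** The number of outer points has exponent A' + p(d-1) - p, and the gain - (d-1) - p of one cone
    counts twice. *)
Lemma lo_v0 : lo v0_ ((p * d.-1)%:Z - 2 * p%:Z - 3 * d%:Z + 1).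
Proof.
have h := lo_mul lo_outer (lo_exp 2 (lo_mul lo_gam (loc c2i))).
have -> : (p * d.-1)%:Z - 2 * p%:Z - 3 * d%:Z + 1 =
  (p * d.-1)%:Z - d%:Z - 1 + (- d.-1%:Z - p%:Z + 0) * 2%:Z by lia.
exact: h.
Qed.

End parameters.

Section admissible.
Context (R : realType) (d : nat).
Hypothesis hd : (2 <= d)%N.
Local Notation p := (15 * d + 3)%N.
Local Notation A := ((15 * d + 4)%:R : R).
Local Notation rin := (@rin R d).
Local Notation rmid := (@rmid R d).
Local Notation rout := (@rout R d).
Local Notation nsize := (@nsize R d).
Local Notation rho_ := (@rho_ R d).
Local Notation rs_ := (@rs_ R d).
Local Notation k_ := (@k_ R d).
Local Notation gapc := (@gapc R d).
Local Notation slabc := (@slabc R d).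
Implicit Types y : R.

Let near_basic : \forall y \near +oo, 2 * A + 100 <= y.
Proof. exact: near_ge. Qed.

Let d_gt0 : (0 < d)%N. Proof. exact: ltnW. Qed.

(** The least convenient m with m^2 >= d R0^4; the net has only polynomially many points in y. *)
Definition net_ y := (Num.truncn (d%:R * rout y ^+ 2)).+1.

Lemma up_net : up (fun y => ((2 * net_ y).+1 ^ d)%:R) (2 * p%:Z * d%:Z).
Proof.
have h1 : up (fun y => 2 * (d%:R * rout y ^+ 2) + 3) (p%:Z * 2).
  apply: up_add.
    by have := up_mul (up_cst (ler0n R 2)) (up_mul (up_cst (ler0n R d)) (up_exp 2 (up_rout R hd)));
      rewrite !add0r.
  by apply: up_weak (up_cst (ler0n R 3)); rewrite mulr_ge0.
have h2 := up_exp d h1; rewrite (mulrC 2); apply: (up_le h2); near=> y.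
rewrite natrX exprn_ge0//=; apply: lerXn2r; rewrite ?nnegrE//.
  by apply: addr_ge0 => //; apply: mulr_ge0 => //; apply: mulr_ge0 => //; exact: sqr_ge0.
have : (Num.truncn (d%:R * rout y ^+ 2))%:R <= d%:R * rout y ^+ 2.
  by rewrite truncn_le// mulr_ge0// sqr_ge0.
by rewrite /net_ -natr1 natrM -natr1; lra.
Unshelve. all: by end_near. Qed.

(** Here A = p + 1 is used: y^A / Y = y. A given cap is then missed with probability at most exp(-c
    y), which outweighs the size of the net. *)
Lemma cap_rate : exists2 c : R, 0 < c &
  \forall y \near +oo, c * y <= nsize y * cap_prob d (rin y + (rout y)^-1).
Proof.
have pk : 0 < normal_peak (1 : R) ^+ d by rewrite exprn_gt0// normal_peak1_gt0.
have e9 : 0 < expR (- (9 / 2)) :> R by exact: expR_gt0.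
have D2 : 0 < (2 * slabc^-1) ^+ d.-1 by rewrite exprn_gt0// mulr_gt0// invr_gt0 slabc_gt0.
exists (normal_peak (1 : R) ^+ d * expR (- (9 / 2)) * ((2 * slabc^-1) ^+ d.-1 * 3^-1)).
  by rewrite !mulr_gt0// invr_gt0.
near=> y.
have yM : 2 * A + 100 <= y by near: y.
have [_ [yY Yr rm mR] [R2 m2 m5 cR]] := param_basic hd yM.
have A0 : 0 <= A by [].
have y0 : 0 < y by lra.
have y1 : 1 <= y by lra.
have Y0 : 0 < y ^+ p by exact: exprn_gt0.
have Y1 : 1 <= y ^+ p by exact: exprn_ege1.
have m0 : 0 <= 2 / rmid y by rewrite divr_ge0//; lra.
have R01 : 1 <= rout y by lra.
have Ri : (rout y)^-1 <= 1 by rewrite invf_le1//; lra.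
have Ri0 : 0 < (rout y)^-1 by rewrite invr_gt0; lra.
set r' := rin y + (rout y)^-1 in cR *.
have r'0 : 0 < r' by rewrite /r'; lra.
have r'3 : r' <= 3 * y ^+ p by rewrite /r'; lra.
rewrite /cap_prob.
have e1 : y ^+ (15 * d + 4) * expR (- (9 / 2)) <= nsize y * expR (- (((r' + 2 / r') ^+ 2 + 1) / 2)).
  rewrite -(nsize_rin hd yM) -mulrA -expRD ler_wpM2l ?expR_ge0// ler_expR; lra.
have e2 : (3 * y ^+ p)^-1 <= r'^-1 by rewrite lef_pV2 ?posrE ?mulr_gt0.
have -> : nsize y * (normal_peak 1 ^+ d * expR (- (((r' + 2 / r') ^+ 2 + 1) / 2)) *
    ((2 / slabc) ^+ d.-1 / r')) =
  normal_peak 1 ^+ d * (2 / slabc) ^+ d.-1 *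
   ((nsize y * expR (- (((r' + 2 / r') ^+ 2 + 1) / 2))) * r'^-1) by ring.
have -> : normal_peak 1 ^+ d * expR (- (9 / 2)) * ((2 / slabc) ^+ d.-1 / 3) * y =
  normal_peak 1 ^+ d * (2 / slabc) ^+ d.-1 *
   ((y ^+ (15 * d + 4) * expR (- (9 / 2))) * (3 * y ^+ p)^-1).
  have -> : (15 * d + 4 = p.+1)%N by rewrite !addnS.
  rewrite exprS; move: (y ^+ p) Y0 (normal_peak 1 ^+ d) ((2 / slabc) ^+ d.-1) (expR _).
  by move=> Y Y0 a b c; field; rewrite gt_eqF.
apply: ler_wpM2l; first by rewrite mulr_ge0 ?(ltW pk) ?(ltW D2).
by apply: ler_pM => //; rewrite ?invr_ge0 ?mulr_ge0 ?expR_ge0 ?(ltW Y0)// exprn_ge0// ltW.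
Unshelve. all: by end_near. Qed.

(** Both terms decay exponentially in y: missed caps by [cap_rate], far points because n exp(- R0^2
    / 2) = exp(-y). *)
Lemma up_bad s : up (fun y => bad_bound d (nsize y) (net_ y) (rin y) (rout y)) s.
Proof.
have [c c0 hc] := cap_rate.
have h1 t := up_mul (up_exp (2 * d) (up_rout R hd)) (up_mul up_net (up_expRN t c0)).
have h2 t := up_mul (up_cst (expR_ge0 (1 / 2))) (up_mul (up_expRN t (@ltr01 R)) (up_exp (3 * d) (up_rout R hd))).
have h4 : 0 <= 4 ^+ d :> R by rewrite exprn_ge0.
have h1' : up (fun y => rout y ^+ (2 * d) * (((2 * net_ y).+1 ^ d)%:R * expR (- (c * y)))) s.
  have := h1 (s - (p%:Z * (2 * d)%:Z + 2 * p%:Z * d%:Z)).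
  by rewrite addrA [X in up _ X]addrC subrK.
have h2' : up (fun y => expR (1 / 2) * (expR (- (1 * y)) * rout y ^+ (3 * d))) s.
  by have := h2 (s - p%:Z * (3 * d)%:Z); rewrite add0r subrK.
have h := up_mul (up_cst h4) (up_add h1' h2'); rewrite add0r in h.
apply: (up_le h); near=> y.
have yM : 2 * A + 100 <= y by near: y.
have [[_ _ R2] _ _] := param_basic hd yM.
have Rd0 : 0 <= rout y by exact: sqrtr_ge0.
have hcy : c * y <= nsize y * cap_prob d (rin y + (rout y)^-1) by near: y.
rewrite /bad_bound; apply/andP; split.
  by rewrite mulr_ge0// addr_ge0 ?mulr_ge0 ?exprn_ge0 ?expR_ge0.
rewrite ler_wpM2l//; apply: lerD.
  by rewrite ler_wpM2l ?exprn_ge0// ler_wpM2l// ler_expR lerN2.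
rewrite !mulrA ler_wpM2r ?exprn_ge0// /nsize -!expRD ler_expR R2; lra.
Unshelve. all: by end_near. Qed.

(** The hypotheses of [sample_clt] with a real [x] for the sample size, so that they can be verified
    along y before y is tied to an integer. *)
Definition admissible (kappa : R) (x : R) (m : nat) (r R0 rho a rho2 rs k : R) : Prop :=
  let delta := loc_size d r R0 rho in
  let p := expR (- (r ^+ 2 / 2)) * delta in
  let gam := (2 * rs) ^+ d.-1 * k / 2 in
  let q := shell_prob d r R0 in
  let v0 := x * outer_prob d a * (gam / 2) ^+ 2 in
  [/\ [/\ 0 < r, r <= a, 2 <= a & a + 2 / a <= R0],
      [/\ 0 <= rho, 16 * (R0 ^+ 2 - r ^+ 2) <= rho ^+ 2, 0 <= rho2 &
        R0 ^+ 2 - a ^+ 2 <= rho2 ^+ 2],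
      [/\ 0 <= k, k <= rs, k <= (4 * a)^-1 &
        (d%:R ^+ 2 * (1 + d%:R) * rs) ^+ 2 * (a ^+ 2 + 5 - r ^+ 2) <= r ^+ 2 * (2 * a)^-1 ^+ 2],
      [/\ x * cap_size d a R0 rho2 <= 1 / 2, delta * q <= gam / 2, 0 < v0 &
        x * q * delta ^+ 4 * (1 + x * p) ^+ 2 <= kappa * v0 ^+ 2] &
      [/\ (x * q * delta ^+ 3) ^+ 2 <= kappa * v0 ^+ 3, d%:R * R0 ^+ 4 <= m%:R ^+ 2,
        d%:R ^+ 2 * (1 + d%:R) <= r & [/\
        (r + R0^-1 + 2 / (r + R0^-1)) ^+ 2 + 1 <= R0 ^+ 2, 4 * d%:R <= R0 ^+ 2,
        bad_bound d x m r R0 <= kappa * v0 & bad_bound d x m r R0 <= kappa]]].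

(** The shell probability is the expected count divided by n, and n >= exp(y) beats every power of
    y. *)
Lemma near_small_ball : \forall y \near +oo, delta_ d y * shell_prob d (rin y) (rout y) <= gam_ d y / 2.
Proof.
have h := up_mul (up_mul (up_delta R hd) (up_shell R hd))
  (up_expRN (- d.-1%:Z - p%:Z - 1 - (d%:Z - p%:Z + (2 + (p * d.-1)%:Z))) (@ltr01 R)).
rewrite [X in up _ X]addrC subrK in h.
have hs : - d.-1%:Z - p%:Z - 1 < - d.-1%:Z - p%:Z by rewrite ltrBlDr ltrDl.
have h12 : 0 < 2^-1 :> R by rewrite invr_gt0.
near=> y; rewrite mulrC [leRHS]mulrC.
have yM : 2 * A + 100 <= y by near: y.
have A0 : 0 <= A by [].
have y0 : 0 < y by lra.
have y1 : 1 <= y by lra.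
have hy : delta_ d y * (nsize y * shell_prob d (rin y) (rout y)) * expR (- (1 * y)) <= 2^-1 * gam_ d y.
  by near: y; exact: (up_lo h (lo_gam R hd) hs h12).
apply: le_trans hy; rewrite mulrC.
have hsz : 1 <= nsize y * expR (- (1 * y)).
  rewrite /nsize -expRD mul1r -[leLHS]expR0 ler_expR subr_ge0.
  rewrite -exprM -{1}[y]expr1 ler_weXn2l// muln_gt0 addn_gt0 orbT.
  by [].
have dq : 0 <= delta_ d y * (nsize y * shell_prob d (rin y) (rout y)).
  by near: y; exact: (up_ge0 (up_mul (up_delta R hd) (up_shell R hd))).
have s0 : 0 < nsize y by exact: expR_gt0.
have dq' : 0 <= delta_ d y * shell_prob d (rin y) (rout y).
  by move: dq; rewrite mulrCA pmulr_rge0.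
have -> : delta_ d y * (nsize y * shell_prob d (rin y) (rout y)) * expR (- (1 * y)) =
  nsize y * expR (- (1 * y)) * (delta_ d y * shell_prob d (rin y) (rout y)) by ring.
rewrite -[leLHS]mul1r; exact: ler_wpM2r.
Unshelve. all: by end_near. Qed.

Lemma param_shape y : 2 * A + 100 <= y -> slabc + 4 * d%:R <= y ->
  [/\ [/\ 0 < rin y, rin y <= rmid y, 2 <= rmid y & rmid y + 2 / rmid y <= rout y],
      [/\ 0 <= rho_ y, 16 * (rout y ^+ 2 - rin y ^+ 2) <= rho_ y ^+ 2, 0 <= rho_ y &
        rout y ^+ 2 - rmid y ^+ 2 <= rho_ y ^+ 2],
      [/\ 0 <= k_ y, k_ y <= (4 * rmid y)^-1 &
        (d%:R ^+ 2 * (1 + d%:R) * rs_ y) ^+ 2 * (rmid y ^+ 2 + 5 - rin y ^+ 2) <=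
          rin y ^+ 2 * (2 * rmid y)^-1 ^+ 2] &
      [/\ d%:R * rout y ^+ 4 <= (net_ y)%:R ^+ 2, d%:R ^+ 2 * (1 + d%:R) <= rin y,
        (rin y + (rout y)^-1 + 2 / (rin y + (rout y)^-1)) ^+ 2 + 1 <= rout y ^+ 2 &
        4 * d%:R <= rout y ^+ 2]].
Proof.
move=> yM yD; have A0 : 0 <= A by [].
have y0 : 0 < y by lra.
have y1 : 1 <= y by lra.
have D0 : 0 < slabc := slabc_gt0 R hd; have c160 : 60 <= gapc := gapc_ge R hd.
have dR0 : 0 <= d%:R :> R by [].
have [[r2 m2 R2] [yY Yr rm mR] [RY m2' m5 cR]] := param_basic hd yM.
have [/andP[g1 g2] /andP[g3 g4] g5] := param_gaps hd yM.
have yY1 : y <= y ^+ p by apply: le_trans yY; rewrite expr2 ler_peMl// ltW.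
have cy1 : 1 <= gapc * y by rewrite -[leLHS]mulr1; apply: ler_pM => //; lra.
have rho_ge0 : 0 <= rho_ y by rewrite /rho_ -mulrA mulr_ge0// (le_trans _ cy1).
have rho2 : 16 * (gapc * y) <= rho_ y ^+ 2.
  have -> : rho_ y ^+ 2 = 16 * ((gapc * y) * (gapc * y)) by rewrite /rho_; ring.
  by rewrite ler_wpM2l// ler_peMl// (le_trans _ cy1).
have m0 : 0 < rmid y by exact: lt_le_trans m2'.
have k4 : 0 <= (4 * rmid y)^-1 by rewrite invr_ge0 mulr_ge0// ltW.
split.
- by split => //; apply: lt_le_trans Yr; exact: exprn_gt0.
- split => //; last by apply: le_trans rho2; move: g4 cy1; clear -hd near_basic d_gt0; lra.
  by apply: le_trans rho2; rewrite ler_wpM2l.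
- split => //.
  have -> : (d%:R ^+ 2 * (1 + d%:R) * rs_ y) ^+ 2 = (16 * (gapc * y) * (gapc * y))^-1.
    have c0 : gapc != 0 by rewrite gt_eqF// (lt_le_trans _ c160).
    rewrite /rs_ -/slabc; field.
    by rewrite c0 (gt_eqF y0) gt_eqF.
  have h16 : 16^-1 <= rin y ^+ 2 * (2 * rmid y)^-1 ^+ 2.
    have mY : rmid y <= 2 * y ^+ p.
      by apply: le_trans RY; apply: le_trans mR; rewrite lerDl divr_ge0// ltW.
    have Y0 : 0 <= y ^+ p by rewrite exprn_ge0// ltW.
    rewrite -exprMn; have -> : 16^-1 = 4^-1 ^+ 2 :> R by field.
    apply: lerXn2r; rewrite ?nnegrE ?invr_ge0//.
      by rewrite divr_ge0 ?mulr_ge0 ?(ltW m0)// (le_trans Y0).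
    by rewrite ler_pdivlMr ?mulr_gt0//; move: mY Yr; clear -hd near_basic d_gt0; lra.
  apply: le_trans h16; move: (le_trans g5 (lexx _)) cy1.
  move: (gapc * y) (_ - _) => w v vw w1.
  have w0 : 0 < w by exact: lt_le_trans w1.
  rewrite mulrC ler_pdivrMr ?mulr_gt0//; apply: (le_trans vw).
  have -> : 16^-1 * (16 * w * w) = w * w by field.
  by rewrite ler_peMl// ltW.
split.
- have h : d%:R * rout y ^+ 2 <= (net_ y)%:R by rewrite /net_ ltW// truncnS_gt.
  have d1 : 1 <= d%:R :> R by rewrite ler1n.
  apply: (@le_trans _ _ ((d%:R * rout y ^+ 2) ^+ 2)).
    by rewrite exprMn -exprM ler_wpM2r ?exprn_ge0 ?sqrtr_ge0// expr2 ler_peMl.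
  by apply: lerXn2r; rewrite ?nnegrE// mulr_ge0// sqr_ge0.
- by rewrite -/slabc; move: yD Yr yY1 dR0; clear -hd near_basic d_gt0; lra.
- by apply: (le_trans cR); move: g1 yM A0; clear -hd near_basic d_gt0; lra.
by have := sqr_ge0 (rin y); move: g1 yM yD D0 A0; clear -hd near_basic d_gt0; lra.
Qed.

Lemma near_admissible kappa : 0 < kappa -> \forall y \near +oo,
  admissible kappa (nsize y) (net_ y) (rin y) (rout y) (rho_ y) (rmid y) (rho_ y) (rs_ y) (k_ y).
Proof.
move=> k0.
have upk : up k_ (- p%:Z) by have := up_inv (lo_mul (lo_cst (ltr0n R 4)) (lo_rmid R hd)); rewrite add0r.
have c4 : 0 < (4 * slabc * gapc)^-1.
  rewrite invr_gt0; apply: mulr_gt0; first by rewrite mulr_gt0 ?slabc_gt0.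
  exact: (lt_le_trans _ (gapc_ge R hd)).
have lors : lo rs_ (0 + -1) by exact: (lo_mul (lo_cst c4) (lo_yi R)).
(* The place where d >= 2 enters the comparison of exponents. *)
have Z1 : (p%:Z <= (p * d.-1)%:Z)%R.
  by rewrite lez_nat leq_pmulr// -ltnS prednK.
have n1 : \forall y \near +oo, k_ y <= 1 * rs_ y.
  by apply: (up_lo upk lors) => //; rewrite add0r; lia.
have n2 : \forall y \near +oo, nsize y * cap_size d (rmid y) (rout y) (rho_ y) <= 1 / 2 * 1.
  by apply: (up_lo (up_cap R hd) (lo_cst (@ltr01 R))).
have n3 := near_small_ball.
have n4 := lo_gt0 (lo_v0 R hd).
have n5 : \forall y \near +oo, nsize y * shell_prob d (rin y) (rout y) * delta_ d y ^+ 4 *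
    (1 + nsize y * (expR (- (rin y ^+ 2 / 2)) * delta_ d y)) ^+ 2 <= kappa * v0_ d y ^+ 2.
  have u1 : up (fun y => 1 + nsize y * (expR (- (rin y ^+ 2 / 2)) * delta_ d y)) (d%:Z + 1).
    by apply: up_add (up_pi R hd); apply: up_weak (up_cst (@ler01 R)); lia.
  have u := up_mul (up_mul (up_shell R hd) (up_exp 4 (up_delta R hd))) (up_exp 2 u1).
  (* The exponents compare as p(d-1) > 12 d + 2. *)
  by apply: (up_lo u (lo_exp 2 (lo_v0 R hd))) => //; move: Z1; clear -hd near_basic d_gt0; lia.
have n6 : \forall y \near +oo, (nsize y * shell_prob d (rin y) (rout y) * delta_ d y ^+ 3) ^+ 2
    <= kappa * v0_ d y ^+ 3.
  have u := up_exp 2 (up_mul (up_shell R hd) (up_exp 3 (up_delta R hd))).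
  (* The exponents compare as p(d-1) > 15 d + 1, the constraint that determines p. *)
  by apply: (up_lo u (lo_exp 3 (lo_v0 R hd))) => //; move: Z1; clear -hd near_basic d_gt0; lia.
have n7 : \forall y \near +oo, bad_bound d (nsize y) (net_ y) (rin y) (rout y) <= kappa * v0_ d y.
  by apply: (up_lo (up_bad ((p * d.-1)%:Z - 2 * p%:Z - 3 * d%:Z)) (lo_v0 R hd) _ k0); rewrite ltrDl.
have n8 : \forall y \near +oo, bad_bound d (nsize y) (net_ y) (rin y) (rout y) <= kappa * 1.
  by apply: (up_lo (up_bad (-1)) (lo_cst (@ltr01 R)) _ k0).
near=> y.
have yM : 2 * A + 100 <= y by near: y.
have yD : slabc + 4 * d%:R <= y by near: y; exact: near_ge.
have [g1 g2 [g3 g4 g5] [g6 g7 g8 g9]] := param_shape yM yD.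
rewrite /admissible; split => //.
- by split => //; rewrite -[leRHS]mul1r; near: y.
- by split; [rewrite -[leRHS]mulr1; near: y|near: y|near: y|near: y].
split=> //; first by near: y.
by split=> //; [near: y|rewrite -[leRHS]mulr1; near: y].
Unshelve. all: by end_near. Qed.

End admissible.

Theorem theorem1p1 (R : realType) (d : nat) (hd : (2 <= d)%N) :
  exists eps : nat -> R, eps @ \oo --> 0 /\
    forall n : nat, (1 <= n)%N -> forall t : R,
      `| Psample [set x : 'I_n -> 'I_d -> R |
            (volK x - Esample (@volK R d n)) / Num.sqrt (Varsample (@volK R d n)) <= t]
         - Phi t | <= eps n.
Proof.
have d0 : (0 < d)%N by exact: ltnW.
pose dist n t := `| Psample [set x : 'I_n -> 'I_d -> R |
            (volK x - Esample (@volK R d n)) / Num.sqrt (Varsample (@volK R d n)) <= t]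
         - Phi t |.
have dist1 n t : dist n t <= 1.
  rewrite /dist Psample_volK//; set P := Ex _ _.
  have mE : measurable [set x : n.-tuple (d.-tuple (measurableTypeR R)) | std_hvol x <= t].
    apply: measurable_le_fun => //; apply: measurable_funM => //.
    by apply: measurable_funB => //; exact: measurable_hvol.
  have P0 : 0 <= P by apply: Ex_ge0 => x; rewrite indicE.
  have P1 : P <= 1.
    rewrite -[leRHS](Ex_cst (tprob (tprob (normal_prob (0 : R) 1) d) n)).
    apply: Ex_le; [exact: bm_indic|exact: bm_cst|move=> x].
    by rewrite indicE; case: (_ \in _).
  have := Phi_ge0 t; have := Phi_le1 t.
  by rewrite ler_norml; lra.
have small e : 0 < e -> exists n0 : nat, forall n, (n0 <= n)%N -> forall t, dist n t <= e.
  move=> e0; have [kappa k0 H] := sample_clt e0.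
  have [M [_ HM]] := near_admissible hd k0.
  pose p := (15 * d + 3)%N; pose M' := Num.max M 1.
  exists (Num.truncn (expR ((M' ^+ p) ^+ 2))).+1 => n nn t.
  have M'1 : 1 <= M' by rewrite le_max lexx orbT.
  have nM : expR ((M' ^+ p) ^+ 2) < n%:R.
    by apply: (lt_le_trans (truncnS_gt _)); rewrite ler_nat.
  have n0 : 0 < n%:R :> R by apply: lt_trans nM; exact: expR_gt0.
  have nL : (M' ^+ p) ^+ 2 < ln (n%:R : R) by rewrite -ltr_expR lnK.
  have L0 : 0 <= ln (n%:R : R).
    by apply: le_trans (ltW nL); exact: sqr_ge0.
  (* The y with exp(y^(2p)) = n; it exceeds the threshold M because n exceeds exp(M'^(2p)). *)
  pose y := ln (n%:R : R) `^ ((p * 2)%:R^-1).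
  have y0 : 0 <= y by exact: powR_ge0.
  have p2 : (p * 2)%:R != 0 :> R by rewrite pnatr_eq0 /p; lia.
  have yp : (y ^+ p) ^+ 2 = ln (n%:R : R).
    by rewrite -exprM -powR_mulrn// -powRrM mulVf// powRr1.
  have yn : nsize d y = n%:R by rewrite /nsize -/p yp lnK.
  have yM : M < y.
    rewrite ltNge; apply/negP => h.
    have yM' : y <= M' by rewrite le_max h.
    have : (y ^+ p) ^+ 2 <= (M' ^+ p) ^+ 2.
      by rewrite -!exprM; apply: lerXn2r; rewrite ?nnegrE// (le_trans _ M'1).
    by rewrite yp leNgt nL.
  have := HM y yM; rewrite yn => -[[a1 a2 a3 a4] [b1 b2 b3 b4] [c1 c2 c3 c4]
    [e1 e2 e3 e4] [f1 f2 f3 [f4 f5 f6 f7]]].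
  exact: (H d n _ _ _ _ _ _ _ _ d0 a1 a2 a3 a4 b1 b2 b3 b4 c1 c2 c3 c4 e1 e2 e3 e4 f1 f2 f3 f4 f5 f6 f7).
have ub n : has_sup (range (dist n)).
  split; first by exists (dist n 0), 0.
  by exists 1 => _ [t _ <-].
(* The supremum over t is finite because the distance never exceeds 1, and it tends to 0 because
   [small] is uniform in t. *)
exists (fun n => sup (range (dist n))); split; last first.
  move=> n _ t; apply: ub_le_sup; first by case: (ub n).
  by exists t.
apply/cvgrPdist_le => e e0; have [n0 hn0] := small e e0.
exists n0 => // n /= nn; rewrite sub0r normrN ger0_norm.
  by apply: ge_sup => [|_ [t _ <-]]; [case: (ub n)|exact: hn0].
apply: (@le_trans _ _ (dist n 0)); first exact: normr_ge0.
by apply: ub_le_sup; [case: (ub n)|exists 0].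
Qed.
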